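(* Let $B$ be a finite Blaschke product with $N\ge2$ zeros counted with multiplicity, and let $\mathcal H$ be a Hilbert space. A unital representation $\pi:\mathcal A_B\to\mathcal B(\mathcal H)$ is completely contractive if and only if there is a unitary operator $U$ acting on a Hilbert space $\mathcal K\supset\mathcal H$ such that for all $j=0,1,2,\dots$, $$\pi(z^jB)=P_{\mathcal H}\,U^jB(U)|_{\mathcal H}.$$
   Context: $A(\mathbb D)$ is the disk algebra, $\mathcal A_B=\mathbb C+B\,A(\mathbb D)$ with the supremum norm. $\mathcal B(\mathcal H)$ is the algebra of bounded operators on $\mathcal H$, $P_{\mathcal H}$ the orthogonal projection of $\mathcal K$ onto $\mathcal H$. Representations are bounded algebra homomorphisms. $\pi$ is completely contractive if for every $r\ge1$ the map $\mathrm{id}_{M_r}\otimes\pi$ on $M_r(\mathbb C)\otimes\mathcal A_B$ (with the supremum of the operator norm) is contractive. *)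

(* Defs.v *)
From HB Require Import structures.
From mathcomp Require Import all_boot all_order all_algebra.
From mathcomp Require Import sesquilinear complex.
From mathcomp Require Import ring.
From mathcomp Require Import all_classical all_reals all_analysis.

Set Implicit Arguments.
Unset Strict Implicit.
Unset Printing Implicit Defensive.

Import Order.TTheory GRing.Theory Num.Theory.
Import numFieldNormedType.Exports.

Local Open Scope classical_set_scope.
Local Open Scope ring_scope.

(* The complex field over [R], declared at type [numClosedFieldType] so that
   the generic topological and normed structures of MathComp-Analysis apply to
   it (they are not found for the raw type [R[i]]). *)
Definition cplx (R : realType) : numClosedFieldType := R[i].

(* The norm of a normed module over [cplx R] takes values in [cplx R]; [nrm] is
   the same norm as an element of [R], where suprema are available. *)
Definition nrm (R : realType) (V : normedModType (cplx R)) (x : V) : R :=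
  complex.Re (`|x| : R[i]).

Section Nrm.
Variables (R : realType) (V : normedModType (cplx R)).
Implicit Types x y : V.

Lemma nrmE x : `|x| = ((nrm x)%:C)%C :> R[i].
Proof.
have : 0 <= (`|x| : R[i]) := normr_ge0 x.
by rewrite /nrm; case: (`|x| : R[i]) => a b; rewrite lecE /= => /andP[/eqP -> _].
Qed.

Lemma nrm_ge0 x : 0 <= nrm x.
Proof. by have := normr_ge0 x; rewrite nrmE lecE /= => /andP[]. Qed.

Lemma nrm_le_add x y : nrm (x + y) <= nrm x + nrm y.
Proof.
have : (`|x + y| : R[i]) <= `|x| + `|y| := ler_normD x y.
by rewrite !nrmE lecE /= => /andP[].
Qed.

End Nrm.

Lemma nrmZ (R : realType) (V : normedModType (cplx R)) (a : cplx R) (x : V) :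
  nrm (a *: x) = nrm a * nrm x.
Proof.
have : (`|a *: x| : R[i]) = (`|a| : R[i]) * `|x| := normrZ a x.
rewrite (nrmE x) (nrmE (a *: x)) (nrmE a) => /(congr1 (@complex.Re R)) /=.
by rewrite mul0r subr0.
Qed.


(* Complex Hilbert spaces; the inner product is linear in its first argument. *)
HB.mixin Record isHilbert (R : realType) H
    of CompleteNormedModule (cplx R) H := {
  inner : {dot H for (@Num.conj (cplx R))};
  inner_norm : forall x : H, `|x| ^+ 2 = inner x x
}.

#[short(type="hilbertType")]
HB.structure Definition Hilbert (R : realType) :=
  {H of isHilbert R H & CompleteNormedModule (cplx R) H}.

Section BoundedOperators.
Variables (R : realType) (H : hilbertType R).
Local Notation C := (cplx R).

Definition is_bop : {pred H -> H} := fun T =>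
  `[< linear T /\ exists M : R, forall x, nrm (T x) <= M * nrm x >].

Lemma is_bop_submod_closed : submod_closed is_bop.
Proof.
split.
- apply/asboolP; split; first by move=> a x y /=; rewrite scaler0 addr0.
  by exists 0 => x; rewrite /nrm normr0 mul0r.
- move=> a S T /asboolP[linS [M SM]] /asboolP[linT [M' TM]]; apply/asboolP.
  split=> [b x y|].
    rewrite !fctE linS linT !scalerDr !scalerA (mulrC a b) -!addrA; congr (_ + _).
    by rewrite addrCA.
  exists (nrm a * M + M') => x.
  rewrite (le_trans (nrm_le_add _ _))// mulrDl lerD// nrmZ -mulrA.
  by rewrite ler_wpM2l// nrm_ge0.
Qed.

HB.instance Definition _ :=
  GRing.isSubmodClosed.Build C (H -> H) is_bop is_bop_submod_closed.

(* The algebra of bounded operators on [H]; its product is composition. It is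
   declared as a [pzRingType], which allows [1 = 0], because [H] may be trivial;
   the library's algebra structures require nonzero rings. *)
Record bop := Bop { bop_fun :> H -> H; _ : bop_fun \in is_bop }.

HB.instance Definition _ := [isSub for bop_fun].
HB.instance Definition _ := [Choice of bop by <:].
HB.instance Definition _ := [SubChoice_isSubLmodule of bop by <:].

Implicit Types S T : bop.

Lemma bop_linear T : linear T.
Proof. by case: T => T /= /asboolP[]. Qed.

HB.instance Definition _ T :=
  GRing.isLinear.Build C H H _ (bop_fun T) (bop_linear T).

Lemma bop_bounded T : exists M : R, 0 <= M /\ forall x, nrm (T x) <= M * nrm x.
Proof.
case: T => T /= /asboolP[_ [M TM]]; exists `|M|; split=> // x.
by rewrite (le_trans (TM x))// ler_wpM2r ?nrm_ge0// ler_norm.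
Qed.

Lemma bop1_subproof : (idfun : H -> H) \in is_bop.
Proof. by apply/asboolP; split=> //; exists 1 => x; rewrite mul1r. Qed.

Lemma bopM_subproof S T : S \o T \in is_bop.
Proof.
apply/asboolP; split=> [a x y /=|]; first by rewrite !linearP.
have [M [M0 SM]] := bop_bounded S; have [M' [_ TM]] := bop_bounded T.
exists (M * M') => x; rewrite (le_trans (SM _))// -mulrA.
by rewrite ler_wpM2l.
Qed.

Definition bop1 : bop := Bop bop1_subproof.
Definition bopM S T : bop := Bop (bopM_subproof S T).

Lemma bopP S T : (forall x, S x = T x) -> S = T.
Proof. by move=> ST; apply: val_inj; apply/funext. Qed.

Lemma bopMA : associative bopM. Proof. by move=> ? ? ?; exact: bopP. Qed.
Lemma bop1M : left_id bop1 bopM. Proof. by move=> ?; exact: bopP. Qed.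
Lemma bopM1 : right_id bop1 bopM. Proof. by move=> ?; exact: bopP. Qed.
Lemma bopMDl : left_distributive bopM +%R.
Proof. by move=> ? ? ?; exact: bopP. Qed.
Lemma bopMDr : right_distributive bopM +%R.
Proof. by move=> S T T'; apply: bopP => x; exact: (raddfD S (T x) (T' x)). Qed.

HB.instance Definition _ :=
  GRing.Zmodule_isPzRing.Build bop bopMA bop1M bopM1 bopMDl bopMDr.

Definition opnorm T : R := sup [set nrm (T x) | x in [set x | nrm x <= 1]].

(* [U] has an adjoint [V] with [V U = U V = 1]. *)
Definition unitary_op (U : bop) : Prop :=
  exists V : bop, [/\ forall x y, inner (U x) y = inner x (V y),
                      V * U = 1 & U * V = 1].

(* Two-sided inverse, with the junk value [0] if there is none. *)
Definition bop_inv T : bop := xget 0 [set S | S * T = 1 /\ T * S = 1].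

(* Orthogonal projection onto [M], meaningful when [M] is a closed subspace. *)
Definition orth_proj (M : set H) (x : H) : H :=
  xget 0 [set y | M y /\ forall m, M m -> inner (x - y) m = 0].

End BoundedOperators.

Definition cdisk (R : realType) := {z : cplx R | `|z| <= 1}.

Section DiskAlgebra.
Variable R : realType.
Local Notation C := (cplx R).

(* The disk algebra: restrictions to the closed disk of functions that are
   continuous there and holomorphic on the open disk. Since [F] is a function
   on [C] as a module over itself, [derivable F z 1] is complex
   differentiability at [z]. *)
Definition disk_algebra : {pred cdisk R -> C} := fun f =>
  `[< exists F : C -> C,
        [/\ forall z : cdisk R, f z = F (val z),
            {within [set z | `|z| <= 1], continuous F} &
            forall z : C, `|z| < 1 -> derivable F z 1] >].

Lemma disk_algebra_cst (a : C) : cst a \in disk_algebra.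
Proof.
apply/asboolP; exists (cst a); split=> //.
by apply: continuous_subspaceT; exact: cst_continuous.
Qed.

Lemma disk_algebra_submod_closed : submod_closed disk_algebra.
Proof.
split; first exact: (disk_algebra_cst 0).
move=> a f g /asboolP[F [fF cF dF]] /asboolP[G [gG cG dG]]; apply/asboolP.
exists (a *: F + G); split=> [z|x|z z1].
- by rewrite !fctE fF gG.
- by apply: cvgD; [apply: cvgZr; exact: cF|exact: cG].
- by apply: derivableD; [apply: derivableZ; exact: dF|exact: dG].
Qed.

Lemma disk_algebraM : {in disk_algebra &, forall f g, f * g \in disk_algebra}.
Proof.
move=> f g /asboolP[F [fF cF dF]] /asboolP[G [gG cG dG]]; apply/asboolP.
exists (F * G); split=> [z|x|z z1].
- by rewrite !fctE fF gG.
- by apply: cvgM; [exact: cF|exact: cG].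
- by apply: derivableM; [exact: dF|exact: dG].
Qed.

Lemma disk_algebra_subring_closed : subring_closed disk_algebra.
Proof.
split; [exact: (disk_algebra_cst 1)| |exact: disk_algebraM].
move=> f g fA gA; rewrite addrC -scaleN1r.
by apply: disk_algebra_submod_closed.2.
Qed.

HB.instance Definition _ :=
  GRing.isSubringClosed.Build _ disk_algebra disk_algebra_subring_closed.
HB.instance Definition _ :=
  GRing.isSubmodClosed.Build C (cdisk R -> C) disk_algebra
    disk_algebra_submod_closed.

End DiskAlgebra.

(* A finite Blaschke product with [N] zeros, counted with multiplicity. *)
Record finite_blaschke (R : realType) (N : nat) := FiniteBlaschke {
  fb_const : cplx R;
  fb_zeros : 'I_N -> cplx R;
  fb_const_norm : `|fb_const| = 1;
  fb_zeros_disk : forall i, `|fb_zeros i| < 1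
}.

Section BlaschkeAlgebra.
Variables (R : realType) (N : nat) (B : finite_blaschke R N).
Local Notation C := (cplx R).

Definition fb_fun (z : C) : C :=
  fb_const B *
  \prod_(i < N) ((z - fb_zeros B i) / (1 - Num.conj (fb_zeros B i) * z)).

Definition fb_cdisk : cdisk R -> C := fun z => fb_fun (val z).

Definition fb_algebra : {pred cdisk R -> C} := fun f =>
  `[< exists (a : C) (g : cdisk R -> C),
        g \in disk_algebra (R := R) /\ f = cst a + fb_cdisk * g >].

Lemma fb_den_neq0 i (z : C) : `|z| <= 1 ->
  1 - Num.conj (fb_zeros B i) * z != 0.
Proof.
move=> z1; rewrite subr_eq0; apply/eqP => /(congr1 Num.norm).
rewrite normr1 normrM norm_conjC => /eqP; apply/negP; rewrite gt_eqF//.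
have [->|z0] := eqVneq z 0; first by rewrite normr0 mulr0.
by rewrite (lt_le_trans _ z1)// gtr_pMl ?normr_gt0// fb_zeros_disk.
Qed.

Lemma fb_factor_disk_algebra i :
  (fun z : cdisk R => (val z - fb_zeros B i) /
     (1 - Num.conj (fb_zeros B i) * val z)) \in disk_algebra (R := R).
Proof.
apply/asboolP.
pose a := fb_zeros B i; pose b := Num.conj a.
exists (fun z : C => (z - a) / (1 - b * z)); split=> [z|z|z z1]; first by [].
  move: z; apply: continuous_in_subspaceT => z /set_mem /= z1.
  have cid : {for z, continuous (@id C)} by exact: cvg_id.
  have ccst (k : C) : {for z, continuous (cst k : C -> C)}.
    exact: cst_continuous.
  have cnum := continuousB cid (ccst a).
  have cden := continuousB (ccst 1) (continuousM (ccst b) cid).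
  have cinv := @continuousV _ _ (fun w : C => 1 - b * w) z
    (fb_den_neq0 i z1) cden.
  exact: (continuousM cnum cinv).
have did : derivable (@id C) z (1 : C) by exact: derivable_id.
have dcst (k : C) : derivable (cst k : C -> C) z (1 : C).
  exact: derivable_cst.
have dnum := derivableB did (dcst a).
have dden := derivableB (dcst 1) (derivableM (dcst b) did).
have dinv := @derivableV _ _ (fun w : C => 1 - b * w) z 1
  (fb_den_neq0 i (ltW z1)) dden.
exact: (derivableM dnum dinv).
Qed.

Lemma fb_cdisk_disk_algebra : fb_cdisk \in disk_algebra (R := R).
Proof.
rewrite (_ : fb_cdisk = cst (fb_const B) * \prod_(i < N) (fun z : cdisk R =>
  (val z - fb_zeros B i) / (1 - Num.conj (fb_zeros B i) * val z))).
  apply: rpredM; first exact: disk_algebra_cst.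
  by apply: rpred_prod => i _; exact: fb_factor_disk_algebra.
by apply/funext => z; rewrite /fb_cdisk /fb_fun mulrfctE /= fct_prodE.
Qed.

Lemma fb_algebra_submod_closed : submod_closed fb_algebra.
Proof.
split.
  apply/asboolP; exists 0, 0; split; first exact: rpred0.
  by rewrite mulr0 addr0.
move=> k f g /asboolP[a [u [uA ->]]] /asboolP[b [v [vA ->]]]; apply/asboolP.
exists (k * a + b), (k *: u + v); split; first by rewrite rpredD// rpredZ.
apply/funext => z; rewrite !fctE /= /GRing.scale /=.
by rewrite !mulrDr mulrCA addrACA.
Qed.

Lemma fb_algebra_subring_closed : subring_closed fb_algebra.
Proof.
split.
- apply/asboolP; exists 1, 0; split; first exact: rpred0.
  by rewrite mulr0 addr0.
- move=> f g fA gA; rewrite addrC -scaleN1r.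
  exact: fb_algebra_submod_closed.2.
- move=> f g /asboolP[a [u [uA ->]]] /asboolP[b [v [vA ->]]]; apply/asboolP.
  exists (a * b), (cst a * v + cst b * u + fb_cdisk * u * v); split.
    have cA := @disk_algebra_cst R; have BA := fb_cdisk_disk_algebra.
    by apply: rpredD; [apply: rpredD|]; apply: rpredM => //; exact: rpredM.
  apply/funext => z; rewrite !fctE; ring.
Qed.

HB.instance Definition _ :=
  GRing.isSubringClosed.Build _ fb_algebra fb_algebra_subring_closed.
HB.instance Definition _ :=
  GRing.isSubmodClosed.Build C (cdisk R -> C) fb_algebra
    fb_algebra_submod_closed.

(* The algebra [C + B A(D)]. *)
Record fbAlg := FbAlg { fbAlg_fun :> cdisk R -> C; _ : fbAlg_fun \in fb_algebra }.

HB.instance Definition _ := [isSub for fbAlg_fun].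
HB.instance Definition _ := [Choice of fbAlg by <:].
HB.instance Definition _ := GRing.SubChoice_isSubComPzRing.Build
  (cdisk R -> C) fb_algebra fbAlg fb_algebra_subring_closed.
HB.instance Definition _ := [SubZmodule_isSubLmodule of fbAlg by <:].

Lemma zjB_subproof j :
  (fun z : cdisk R => val z ^+ j * fb_fun (val z)) \in fb_algebra.
Proof.
apply/asboolP; exists 0, (fun z : cdisk R => val z ^+ j); split; last first.
  by apply/funext => z; rewrite !fctE add0r mulrC.
have -> : (fun z : cdisk R => val z ^+ j) = (fun z : cdisk R => val z) ^+ j.
  by apply/funext => z; rewrite exprfctE.
apply: rpredX; apply/asboolP; exists id; split=> //.
by apply: continuous_subspaceT => x; exact: cvg_id.
Qed.

(* [z^j B] as an element of [C + B A(D)]. *)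
Definition zjB (j : nat) : fbAlg := FbAlg (zjB_subproof j).

Definition supnorm (f : fbAlg) : R := sup [set nrm (f z) | z in [set: cdisk R]].

(* [B(U)], by the rational functional calculus. The inverses exist when [U] is
   unitary, and all the factors commute. *)
Definition fb_op (H : hilbertType R) (U : bop H) : bop H :=
  fb_const B *: \prod_(i < N)
    ((U - fb_zeros B i *: (1 : bop H)) *
     bop_inv (1 - Num.conj (fb_zeros B i) *: U)).

End BlaschkeAlgebra.

Arguments zjB {R N} B j.

Section MatrixNorms.
Variable R : realType.
Local Notation C := (cplx R).

(* The Hilbert norm of [V^r] (that is, of [C^r (x) V]). *)
Definition l2norm (V : normedModType C) r (h : 'I_r -> V) : R :=
  Num.sqrt (\sum_(i < r) nrm (h i) ^+ 2).

(* The norm of the operator on [V^r] with matrix of entries [T i j]. *)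
Definition mx_opnorm (V : normedModType C) r (T : 'I_r -> 'I_r -> V -> V) : R :=
  sup [set l2norm (fun i => \sum_(j < r) T i j (h j)) |
       h in [set h : 'I_r -> V | l2norm h <= 1]].

(* The norm of [M_r(C) (x) A_B = M_r(A_B)]: the supremum over the disk of the
   operator norm on [C^r]. *)
Definition mx_supnorm N (B : finite_blaschke R N) r (F : 'M[fbAlg B]_r) : R :=
  sup [set mx_opnorm (fun i j (x : C) => F i j z * x) | z in [set: cdisk R]].

Variables (N : nat) (B : finite_blaschke R N) (H : hilbertType R).
Implicit Type pi : fbAlg B -> bop H.

Definition unital_rep pi : Prop :=
  [/\ linear pi, monoid_morphism pi &
      exists M : R, forall f, opnorm (pi f) <= M * supnorm f].

(* [map_mx pi] is [id (x) pi] on [M_r(A_B)]. *)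
Definition completely_contractive pi : Prop :=
  forall r : nat, (1 <= r)%N -> forall F : 'M[fbAlg B]_r,
    mx_opnorm (fun i j => map_mx pi F i j : H -> H) <= mx_supnorm F.

End MatrixNorms.

(* Main.v *)
Require Import Defs.
From HB Require Import structures.
From mathcomp Require Import all_boot all_order all_algebra.
From mathcomp Require Import sesquilinear complex ring lra zify.
From mathcomp Require Import all_classical all_reals all_analysis.

Set Implicit Arguments.
Unset Strict Implicit.
Unset Printing Implicit Defensive.

Import Order.TTheory GRing.Theory Num.Theory.
Import numFieldNormedType.Exports.

Local Open Scope classical_set_scope.
Local Open Scope ring_scope.

(** Suppose first that [U] dilates [pi]. Polynomials are dense in the disk algebra
    and [pi] is bounded, so only matrices with entries [c + B p], [p] a
    polynomial, have to be considered; on these [pi] is the compression to [H] of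
    the rational functional calculus of [U]. With [B = b / q], the norm estimate
    for [pi] becomes [|G(U) y| <= M |q(U) y|] for a polynomial matrix [G] with
    [|G(z) c| <= M |q(z)| |c|] on the unit circle. This matrix form of von
    Neumann's inequality ([isometry_poly_bound]) comes from Parseval's identity
    applied to a long piece of the orbit of [y]
    ([dilation_completely_contractive]).

    Conversely let [pi] be completely contractive. If [Re F >= 0] on the circle for
    a matrix [F] over the algebra, the maximum principle gives [Re F >= 0] on the
    disk, so [|1 - t F|^2 <= 1 + t^2 |F|^2]; applying [pi] and letting [t] tend to
    zero gives [Re pi(F) >= 0] ([cc_positive]). Hence
    [Re (f <h, x> <x, k>) |-> Re <pi(f) h, k>] is a well-defined positive
    functional on real functions of [(z, x)], [z] on the circle and [x] in [H].
    M. Riesz's extension theorem ([riesz_extension]) extends it to all functions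
    dominated by finite-rank forms; this replaces Arveson's extension theorem
    ([cp_extension]). The extension defines a semi-inner product on the bounded
    finite-rank functions from the circle to [H], and multiplication by the
    coordinate [z] on its completion is the unitary [U], for which [B(U)] is
    multiplication by [B] ([shift_zjB], [dilation_zjB]).

    The completion is realized as the space of bounded functionals, with squared
    norm [sup (2 l(g) - <g, g>)]: in this form the parallelogram law, the
    reproducing property and the density of the original vectors are changes of
    variables under the supremum.

    The two facts on the disk algebra that are used, density of polynomials
    ([disk_algebra_poly_approx]) and the maximum principle
    ([disk_algebra_re_ge0]), rest on Goursat's theorem. It is proved for
    dyadic Riemann sums instead of integrals: applied to [g (exp (s + i t))], it
    makes averages of [g] over the [2 ^ n]-th roots of unity on two circles agree
    as [n] grows. This yields the mean value property, hence Cauchy's formula,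
    whose truncated kernel gives the approximating polynomials. *)

(** * Real-valued estimates in the complex field *)

Definition re (R : realType) (z : cplx R) : R := complex.Re (z : R[i]).
Definition im (R : realType) (z : cplx R) : R := complex.Im (z : R[i]).
Definition ofR (R : realType) (x : R) : cplx R := (x%:C)%C.
Definition iC (R : realType) : cplx R := ('i)%C.

Section NrmTheory.
Variables (R : realType) (V : normedModType (cplx R)).
Implicit Types x y : V.

Lemma nrm0 : nrm (0 : V) = 0.
Proof. by rewrite /nrm normr0. Qed.

Lemma nrmN x : nrm (- x) = nrm x.
Proof. by rewrite /nrm normrN. Qed.

Lemma nrm_eq0 x : nrm x = 0 -> x = 0.
Proof.
move=> x0; apply/eqP; rewrite -normr_eq0; apply/eqP.
by have := nrmE x; rewrite x0.
Qed.

Lemma nrmB x y : nrm (x - y) = nrm (y - x).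
Proof. by rewrite -nrmN opprB. Qed.

Lemma nrm_le_sub x y : nrm (x - y) <= nrm x + nrm y.
Proof. by rewrite -(nrmN y); exact: nrm_le_add. Qed.

Lemma nrm_lerB x y : nrm x - nrm y <= nrm (x - y).
Proof. by rewrite lerBlDr -{1}(subrK y x); exact: nrm_le_add. Qed.

Lemma nrm_sum (I : Type) (r : seq I) (P : pred I) (F : I -> V) :
  nrm (\sum_(i <- r | P i) F i) <= \sum_(i <- r | P i) nrm (F i).
Proof.
elim/big_ind2 : _ => //; first by rewrite nrm0.
by move=> a b c d ab cd; rewrite (le_trans (nrm_le_add _ _))// lerD.
Qed.

Lemma normr_le_nrm x (a : R) : ((`|x| : cplx R) <= ofR a) = (nrm x <= a).
Proof. by rewrite nrmE lecR. Qed.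

Lemma normr_lt_nrm x (a : R) : ((`|x| : cplx R) < ofR a) = (nrm x < a).
Proof. by rewrite nrmE ltcR. Qed.

End NrmTheory.

Section Cplx.
Variable R : realType.
Local Notation C := (cplx R).
Implicit Types z w : C.

Lemma nrm1 : nrm (1 : C) = 1.
Proof. by rewrite /nrm normr1. Qed.

Lemma nrmM z w : nrm (z * w) = nrm z * nrm w.
Proof. exact: (nrmZ z (w : C)). Qed.

Lemma nrmX z n : nrm (z ^+ n) = nrm z ^+ n.
Proof. by elim: n => [|n ih]; rewrite ?nrm1// !exprS nrmM ih. Qed.

Lemma nrm_gt0 z : z != 0 -> 0 < nrm z.
Proof.
move=> z0; rewrite lt_def nrm_ge0 andbT; apply: contra z0 => /eqP z0.
by apply/eqP; exact: nrm_eq0.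
Qed.

Lemma nrmV z : nrm z^-1 = (nrm z)^-1.
Proof.
have [->|z0] := eqVneq z 0; first by rewrite invr0 nrm0 invr0.
by apply: (mulfI (lt0r_neq0 (nrm_gt0 z0))); rewrite -nrmM !divff ?nrm1// lt0r_neq0// nrm_gt0.
Qed.

Lemma nrm_conj z : nrm (Num.conj z) = nrm z.
Proof. by rewrite /nrm norm_conjC. Qed.

Lemma normC1_nrm z : ((`|z| : C) <= 1) = (nrm z <= 1).
Proof. exact: (normr_le_nrm z 1). Qed.

Lemma normC1_nrm_lt z : ((`|z| : C) < 1) = (nrm z < 1).
Proof. exact: (normr_lt_nrm z 1). Qed.

Lemma conj_re z : re (Num.conj z) = re z.
Proof. by rewrite /re /Num.conj/=; case: z. Qed.

Lemma conj_im z : im (Num.conj z) = - im z.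
Proof. by case: z. Qed.

Lemma cplxP z w : re z = re w -> im z = im w -> z = w.
Proof. by case: z w => a b [c d]; rewrite /re /im /= => -> ->. Qed.

Lemma reD z w : re (z + w) = re z + re w. Proof. by case: z w => a b []. Qed.
Lemma imD z w : im (z + w) = im z + im w. Proof. by case: z w => a b []. Qed.
Lemma reN z : re (- z) = - re z. Proof. by case: z. Qed.
Lemma imN z : im (- z) = - im z. Proof. by case: z. Qed.
Lemma reM z w : re (z * w) = re z * re w - im z * im w.
Proof. by case: z w => a b []. Qed.
Lemma imM z w : im (z * w) = re z * im w + im z * re w.
Proof. by case: z w => a b []. Qed.
Lemma re0 : re (0 : C) = 0. Proof. by []. Qed.
Lemma im0 : im (0 : C) = 0. Proof. by []. Qed.
Lemma re1 : re (1 : C) = 1. Proof. by []. Qed.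
Lemma im1 : im (1 : C) = 0. Proof. by []. Qed.
Lemma re_ofR (a : R) : re (ofR a) = a. Proof. by []. Qed.
Lemma im_ofR (a : R) : im (ofR a) = 0. Proof. by []. Qed.
Lemma re_iC : re (iC R) = 0 :> R. Proof. by []. Qed.
Lemma im_iC : im (iC R) = 1. Proof. by []. Qed.
Definition cE := (reD, imD, reN, imN, reM, imM, re0, im0, re1, im1, re_ofR,
  im_ofR, re_iC, im_iC, conj_re, conj_im).

Lemma posC_ofR (e : C) : 0 < e -> exists2 r : R, 0 < r & e = ofR r.
Proof.
move=> e0; have eE : e = ofR (re e).
  by apply: cplxP; rewrite ?cE//; move: e0; rewrite ltcE /= => /andP[/eqP].
by exists (re e) => //; move: e0; rewrite {1}eE ltcR.
Qed.

Lemma re_sum (I : Type) (r : seq I) (P : pred I) (F : I -> C) :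
  re (\sum_(i <- r | P i) F i) = \sum_(i <- r | P i) re (F i).
Proof. by elim/big_rec2 : _ => // i a b _ <-; rewrite reD. Qed.

Lemma mulCconj z : z * Num.conj z = ofR (nrm z ^+ 2).
Proof.
rewrite -normCK nrmE; apply: cplxP; rewrite !expr2 !cE; last by ring.
by rewrite mulr0 subr0.
Qed.

Lemma nrm_sqr z : nrm z ^+ 2 = re z ^+ 2 + im z ^+ 2.
Proof.
have := congr1 (@re R) (mulCconj z); rewrite !cE => <-; ring.
Qed.

Lemma re_le_nrm z : `|re z| <= nrm z.
Proof.
rewrite -ler_sqr ?nnegrE ?nrm_ge0// real_normK ?num_real// nrm_sqr.
by rewrite lerDl sqr_ge0.
Qed.

Lemma im_le_nrm z : `|im z| <= nrm z.
Proof.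
rewrite -ler_sqr ?nnegrE ?nrm_ge0// real_normK ?num_real// nrm_sqr.
by rewrite lerDr sqr_ge0.
Qed.

Lemma nrm_le_reim z : nrm z <= `|re z| + `|im z|.
Proof.
rewrite -ler_sqr ?nnegrE ?nrm_ge0 ?addr_ge0// nrm_sqr sqrrD.
rewrite !real_normK ?num_real//.
by rewrite lerD2r lerDl mulrn_wge0// mulr_ge0.
Qed.

Lemma nrm_ofR (a : R) : nrm (ofR a) = `|a|.
Proof.
apply/eqP; rewrite -(@eqrXn2 _ 2)// ?nrm_ge0// nrm_sqr !cE.
by rewrite real_normK ?num_real// expr0n addr0.
Qed.

Lemma ofRM (a b : R) : ofR (a * b) = ofR a * ofR b :> C.
Proof. by apply: cplxP; rewrite !cE; ring. Qed.

Lemma ofRD (a b : R) : ofR (a + b) = ofR a + ofR b :> C.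
Proof. by apply: cplxP; rewrite !cE; ring. Qed.

Lemma nrm_iC : nrm (iC R) = 1.
Proof.
by apply/eqP; rewrite -(@eqrXn2 _ 2)// ?nrm_ge0// nrm_sqr !cE expr0n add0r.
Qed.

(** Compactness of the square [[-r, r]^2] of the real plane is enough: points of
    the square outside the disk have a neighbourhood that misses it. *)
Lemma disk_unif_cont (r : R) (f : C -> C) :
  (forall x, nrm x <= r -> forall e : R, 0 < e -> exists2 d : R, 0 < d &
    forall y, nrm y <= r -> nrm (y - x) < d -> nrm (f y - f x) < e) ->
  forall e : R, 0 < e -> exists2 d : R, 0 < d &
    forall x y, nrm x <= r -> nrm y <= r -> nrm (y - x) < d ->
      nrm (f y - f x) < e.
Proof.
move=> cf e e0.
pose K := `[- r, r]%classic `*` `[- r, r]%classic : set (R * R).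
have cK : compact K by apply: compact_setX; exact: segment_compact.
pose toC (p : R * R) : C := ofR p.1 + iC R * ofR p.2.
pose P (d : R) (p : R * R) := nrm (toC p) <= r -> forall y, nrm y <= r ->
  nrm (y - toC p) < d -> nrm (f y - f (toC p)) < e.
have toC_near p (d : R) : 0 < d -> \forall q \near p, nrm (toC q - toC p) < d.
  move=> d0; have d20 : 0 < d / 2 by rewrite divr_gt0.
  exists (ball p.1 (d / 2), ball p.2 (d / 2)).
    by split; exact: nbhsx_ballx.
  move=> q [/= q1 q2]; rewrite (le_lt_trans (nrm_le_reim _))//.
  rewrite /toC !cE !(mul0r, mul1r, add0r, subr0, addr0, mulr0).
  move: q1 q2; rewrite /ball/= => q1 q2.
  by rewrite (splitr d) distrC ltrD// distrC.
have loc p : K p -> \forall p' \near p & d \near (0 : R)^'+, P d p'.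
  move=> _; have [pr|pr] := leP (nrm (toC p)) r.
    have e20 : 0 < e / 2 by rewrite divr_gt0.
    have [d d0 Hd] := cf _ pr _ e20.
    have d20 : 0 < d / 2 by rewrite divr_gt0.
    near=> p' d' => p'r y yr yp'.
    have pp' : nrm (toC p' - toC p) < d / 2 by near: p'; exact: toC_near.
    have d'd : d' <= d / 2 by near: d'; exact: nbhs_right_le.
    have -> : f y - f (toC p') = (f y - f (toC p)) - (f (toC p') - f (toC p)).
      by rewrite opprB addrA subrK.
    rewrite (le_lt_trans (nrm_le_sub _ _))// (splitr e) ltrD// Hd//.
      have -> : y - toC p = (y - toC p') + (toC p' - toC p).
        by rewrite addrA subrK.
      rewrite (le_lt_trans (nrm_le_add _ _))// (splitr d) ltrD//.
      exact: lt_le_trans d'd.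
    by rewrite (lt_trans pp')// ltr_pdivrMr// ltr_pMr// ltr1n.
  have d0 : 0 < nrm (toC p) - r by rewrite subr_gt0.
  near=> p' d' => p'r.
  exfalso.
  have : nrm (toC p' - toC p) < nrm (toC p) - r by near: p'; exact: toC_near.
  rewrite nrmB => h; have := nrm_lerB (toC p) (toC p').
  by move: h p'r; clear; lra.
have [d [d0 Hd]] : exists d : R, 0 < d /\ K `<=` P d.
  near (0 : R)^'+ => d; exists d; split; first by near: d; exact: nbhs_right_gt.
  by near: d; exact: ((compact_near_coveringP K).1 cK R (0 : R)^'+ P _ loc).
exists d => // x y xr yr yx.
have xE : x = toC (re x, im x) by apply: cplxP; rewrite /toC !cE /=; ring.
have Kx : K (re x, im x).
  split => /=; rewrite in_itv/= -ler_norml (le_trans _ xr)//.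
    exact: re_le_nrm.
  exact: im_le_nrm.
by rewrite xE; apply: (Hd _ Kx) => //; rewrite -xE.
Unshelve. all: by end_near. Qed.

(** Complex differentiability at [z], with real-valued error bounds. *)
Definition cdiff (f : C -> C) (z : C) := exists c : C, forall e : R, 0 < e ->
  exists2 d : R, 0 < d & forall h : C, nrm h < d ->
    nrm (f (z + h) - f z - c * h) <= e * nrm h.

Lemma derivable_cdiff (f : C -> C) z : derivable f z 1 -> cdiff f z.
Proof.
move=> /cvg_ex[l fl]; exists l => e e0.
have eC : 0 < (ofR e : C) by rewrite ltcR.
have := @cvgr_dist_le _ _ _ _ _ _ _ fl _ eC.
rewrite near_withinE => H.
have [d /= d0 Hd] := (@nbhs_ballP C C _ _).1 (H _).
have [r r0 dE] := posC_ofR d0.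
exists r => // h hd.
have [->|h0] := eqVneq h 0.
  by rewrite mulr0 addr0 subrr subr0 nrm0 mulr0.
have := Hd h; rewrite /ball/= sub0r normrN dE normr_lt_nrm => /(_ hd h0).
rewrite -[X in `|X|]/(l - h^-1 * (f (h * 1 + z) - f z)) normr_le_nrm.
rewrite mulr1 (addrC h z) => H1.
have -> : f (z + h) - f z - l * h = - (h * (l - h^-1 * (f (z + h) - f z))).
  by rewrite mulrBr mulrA divff// mul1r opprB (mulrC l).
by rewrite nrmN nrmM mulrC ler_wpM2r ?nrm_ge0.
Qed.

Definition ccont_on (A : C -> Prop) (f : C -> C) :=
  forall x, A x -> forall e : R, 0 < e -> exists2 d : R, 0 < d &
    forall y, A y -> nrm (y - x) < d -> nrm (f y - f x) < e.

Lemma within_ccont_on (A : set C) (f : C -> C) :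
  {within A, continuous f} -> ccont_on A f.
Proof.
move=> /subspace_continuousP cf x Ax e e0.
have eC : 0 < (ofR e : C) by rewrite ltcR.
have := @cvgr_dist_lt _ _ _ _ _ _ _ (cf x Ax) _ eC.
rewrite near_withinE => H.
have [d /= d0 Hd] := (@nbhs_ballP C C _ _).1 (H _).
have [r r0 dE] := posC_ofR d0.
exists r => // y Ay yx; rewrite nrmB -normr_lt_nrm; apply: Hd => //.
by rewrite /ball/= distrC dE normr_lt_nrm.
Qed.

End Cplx.

(** * Goursat's theorem by dyadic sums *)

Section Goursat.
Variable R : realType.
Local Notation C := (cplx R).

(** Dyadic left-endpoint Riemann sums stand for integrals: halving the interval
    splits them exactly, and on opposite sides of a rectangle their errors on
    affine functions cancel exactly, so Goursat's argument needs no limit. *)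
Definition rsum (n : nat) (g : R -> C) (L : R) : C :=
  ofR (L / 2 ^+ n) * \sum_(k < 2 ^ n) g (k%:R * (L / 2 ^+ n)).

Lemma rsumS n g L :
  rsum n.+1 g L = rsum n g (L / 2) + rsum n (fun x => g (L / 2 + x)) (L / 2).
Proof.
have hE : L / 2 ^+ n.+1 = L / 2 / 2 ^+ n by rewrite exprS invfM mulrA.
have h2 : 2 ^+ n != 0 :> R by rewrite expf_neq0.
have e2 : (2 ^ n.+1 = 2 ^ n + 2 ^ n)%N by rewrite expnS mul2n addnn.
rewrite /rsum hE -mulrDr; congr (_ * _).
rewrite e2 big_split_ord /=; congr (_ + _); apply: eq_bigr => i _.
rewrite natrD natrX; congr g; rewrite mulrDl; congr (_ + _).
by rewrite [LHS]mulrC divfK.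
Qed.

Lemma rsumD n f g L :
  rsum n (fun x => f x + g x) L = rsum n f L + rsum n g L.
Proof. by rewrite /rsum big_split mulrDr. Qed.

Lemma rsum_cst n c L : rsum n (fun=> c) L = ofR L * c.
Proof.
rewrite /rsum sumr_const card_ord -[_ *+ (2 ^ n)]mulr_natl mulrA; congr (_ * _).
have -> : ((2 ^ n)%:R : C) = ofR (2 ^+ n).
  by rewrite /ofR -natrX rmorph_nat.
by rewrite -ofRM divfK// expf_neq0.
Qed.

Lemma rsum_bound n g L M : 0 <= L -> 0 <= M ->
  (forall x, 0 <= x <= L -> nrm (g x) <= M) -> nrm (rsum n g L) <= L * M.
Proof.
move=> L0 M0 gM; have h2 : 0 < 2 ^+ n :> R by rewrite exprn_gt0.
rewrite /rsum nrmM nrm_ofR ger0_norm ?divr_ge0 ?(ltW h2)//.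
apply: (@le_trans _ _ (L / 2 ^+ n * \sum_(k < 2 ^ n) M)).
  rewrite ler_wpM2l// ?divr_ge0 ?(ltW h2)//.
  rewrite (le_trans (nrm_sum _ _ _))// ler_sum// => i _; apply: gM.
  rewrite mulr_ge0 ?divr_ge0 ?(ltW h2)//= mulrCA ler_piMr//.
  by rewrite ler_pdivrMr// mul1r -natrX ler_nat ltnW.
by rewrite sumr_const card_ord -[_ *+ (2 ^ n)]mulr_natl natrX mulrA divfK// lt0r_neq0.
Qed.

(** Riemann sum of the contour integral of [G] around the rectangle
    [[a, a + W] x [c, c + H]], opposite sides being paired. *)
Definition contour (n : nat) (G : R -> R -> C) (a c W H : R) : C :=
  rsum n (fun x => G (a + x) c - G (a + x) (c + H)) W +
  iC R * rsum n (fun y => G (a + W) (c + y) - G a (c + y)) H.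

Lemma contourS n G a c W H : contour n.+1 G a c W H =
  contour n G a c (W / 2) (H / 2) +
  contour n G (a + W / 2) c (W / 2) (H / 2) +
  (contour n G a (c + H / 2) (W / 2) (H / 2) +
   contour n G (a + W / 2) (c + H / 2) (W / 2) (H / 2)).
Proof.
rewrite /contour !rsumS.
have aW : a + W / 2 + W / 2 = a + W by rewrite -addrA -splitr.
have cH : c + H / 2 + H / 2 = c + H by rewrite -addrA -splitr.
rewrite !aW !cH.
have X (f g : R -> C) L : rsum n (fun x => f x - g x) L = rsum n f L - rsum n g L.
  rewrite rsumD; congr (_ + _); rewrite /rsum -mulrN; congr (_ * _).
  by rewrite sumrN.
rewrite !X.
have Y b t : rsum n (fun x => G (a + (W / 2 + x)) t) b =
  rsum n (fun x => G (a + W / 2 + x) t) b.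
  by congr rsum; apply/funext => x; rewrite addrA.
have Z s b : rsum n (fun x => G s (c + (H / 2 + x))) b =
  rsum n (fun x => G s (c + H / 2 + x)) b.
  by congr rsum; apply/funext => x; rewrite addrA.
rewrite ?Y ?Z; ring.
Qed.

(** The contour sum of an affine function of [s + i t] vanishes exactly, so only
    the deviation from affine counts. *)
Lemma contour_affine_bound n G a c W H g0 k p q (e : R) :
  0 <= W -> 0 <= H -> 0 <= e ->
  (forall s t, a <= s <= a + W -> c <= t <= c + H ->
     nrm (G s t - g0 - k * (ofR (s - p) + iC R * ofR (t - q))) <= e) ->
  nrm (contour n G a c W H) <= 2 * e * (W + H).
Proof.
move=> W0 H0 e0 GE.
pose E s t := G s t - g0 - k * (ofR (s - p) + iC R * ofR (t - q)).
have GEE s t : G s t = E s t + g0 + k * (ofR (s - p) + iC R * ofR (t - q)).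
  by rewrite /E; ring.
have -> : contour n G a c W H =
  rsum n (fun x => E (a + x) c - E (a + x) (c + H)) W +
  iC R * rsum n (fun y => E (a + W) (c + y) - E a (c + y)) H.
  rewrite /contour.
  have HX : (fun x => G (a + x) c - G (a + x) (c + H)) =
    (fun x => (E (a + x) c - E (a + x) (c + H)) + - (k * iC R * ofR H)).
    apply/funext => x; rewrite !GEE.
    by rewrite (_ : c + H - q = c - q + H) ?ofRD; ring.
  have HY : (fun y => G (a + W) (c + y) - G a (c + y)) =
    (fun y => (E (a + W) (c + y) - E a (c + y)) + k * ofR W).
    apply/funext => y; rewrite !GEE.
    by rewrite (_ : a + W - p = a - p + W) ?ofRD; ring.
  rewrite HX HY.
  rewrite (@rsumD n (fun x => E (a + x) c - E (a + x) (c + H)) (fun=> _)).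
  rewrite (@rsumD n (fun y => E (a + W) (c + y) - E a (c + y)) (fun=> _)).
  by rewrite !rsum_cst; ring.
rewrite (le_trans (nrm_le_add _ _))// nrmM nrm_iC mul1r mulrDr (mulrC _ W) (mulrC _ H).
have e2 (x y : C) : nrm x <= e -> nrm y <= e -> nrm (x - y) <= 2 * e.
  move=> xe ye; rewrite (le_trans (nrm_le_sub _ _))//; lra.
rewrite lerD//; apply: rsum_bound => //; rewrite ?mulr_ge0// => x /andP[x0 xL];
  by apply: e2; apply: GE; rewrite ?lerD2l ?lerDl ?lexx ?x0 ?xL ?H0 ?W0.
Qed.

(** Complex differentiability of [G], seen as a function of [s + i t]. *)
Definition sdiff (G : R -> R -> C) (p q : R) := exists k : C,
  forall e : R, 0 < e -> exists2 d : R, 0 < d &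
    forall x y : R, `|x| < d -> `|y| < d ->
      nrm (G (p + x) (q + y) - G p q - k * (ofR x + iC R * ofR y)) <=
        e * (`|x| + `|y|).

(** Required for all large [n] only, because halving a rectangle costs one level
    of the dyadic sums. *)
Definition smallc G a c W H (eta : R) :=
  exists n0, forall n, (n0 <= n)%N -> nrm (contour n G a c W H) <= eta.

Lemma smallc_split G a c W H eta :
  smallc G a c (W / 2) (H / 2) (eta / 4) ->
  smallc G (a + W / 2) c (W / 2) (H / 2) (eta / 4) ->
  smallc G a (c + H / 2) (W / 2) (H / 2) (eta / 4) ->
  smallc G (a + W / 2) (c + H / 2) (W / 2) (H / 2) (eta / 4) ->
  smallc G a c W H eta.
Proof.
move=> [n1 h1] [n2 h2] [n3 h3] [n4 h4].
exists (maxn (maxn n1 n2) (maxn n3 n4)).+1 => -[//|n]; rewrite ltnS !geq_max.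
move=> /andP[/andP[/h1 i1 /h2 i2] /andP[/h3 i3 /h4 i4]].
rewrite contourS (le_trans (nrm_le_add _ _))//.
have := nrm_le_add (contour n G a c (W / 2) (H / 2))
  (contour n G (a + W / 2) c (W / 2) (H / 2)).
have := nrm_le_add (contour n G a (c + H / 2) (W / 2) (H / 2))
   (contour n G (a + W / 2) (c + H / 2) (W / 2) (H / 2)).
lra.
Qed.

Lemma nested_point (a : nat -> R) (W : R) : 0 <= W ->
  (forall k, a k <= a k.+1 <= a k + W / 2 ^+ k.+1) ->
  exists p, forall k, a k <= p <= a k + W / 2 ^+ k.
Proof.
move=> W0 aS.
have amono k m : (k <= m)%N -> a k <= a m.
  move=> /subnK <-; elim: (m - k)%N => [//|j ih].
  by rewrite addSn (le_trans ih)//; have /andP[] := aS (j + k)%N.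
have bmono k m : (k <= m)%N -> a m + W / 2 ^+ m <= a k + W / 2 ^+ k.
  move=> /subnK <-; elim: (m - k)%N => [//|j ih].
  rewrite addSn (le_trans _ ih)//; have /andP[_ h] := aS (j + k)%N.
  have hh : W / 2 ^+ (j + k) = W / 2 ^+ (j + k).+1 + W / 2 ^+ (j + k).+1.
    by rewrite exprSr invfM mulrA -splitr.
  by rewrite hh addrA lerD2r.
have ab k m : a m <= a k + W / 2 ^+ k.
  rewrite (le_trans (amono _ _ (leq_maxr k m)))//.
  rewrite (le_trans _ (bmono _ _ (leq_maxl k m)))// lerDl divr_ge0// exprn_ge0.

exists (sup (range a)) => k; apply/andP; split.
  apply: ub_le_sup; last by exists k.
  by exists (a 0 + W / 2 ^+ 0) => _ [m _ <-]; exact: ab.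
by apply: ge_sup; [exists (a 0); exists 0%N|move=> _ [m _ <-]; exact: ab].
Qed.

(** Goursat's bisection: a rectangle whose contour sums stay above [eta] would
    contain, at every scale [2 ^ - k], a sub-rectangle whose sums stay above
    [eta / 4 ^ k], against the first-order expansion at their common point. *)
Lemma goursat G a c W H : 0 <= W -> 0 <= H ->
  (forall s t, a <= s <= a + W -> c <= t <= c + H -> sdiff G s t) ->
  forall eta, 0 < eta -> smallc G a c W H eta.
Proof.
move=> W0 H0 dG eta eta0; apply: contrapT => bad0.
pose bad (k : nat) (u : R * R) :=
  ~ smallc G u.1 u.2 (W / 2 ^+ k) (H / 2 ^+ k) (eta / 4 ^+ k).
have half (x : R) k : x / 2 ^+ k.+1 = x / 2 ^+ k / 2.
  by rewrite exprSr invfM mulrA.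
have quart (x : R) k : x / 4 ^+ k.+1 = x / 4 ^+ k / 4.
  by rewrite exprSr invfM mulrA.
have step (ku : nat * (R * R)) : exists u' : R * R, bad ku.1 ku.2 ->
    [/\ bad ku.1.+1 u', ku.2.1 <= u'.1 <= ku.2.1 + W / 2 ^+ ku.1.+1 &
      ku.2.2 <= u'.2 <= ku.2.2 + H / 2 ^+ ku.1.+1].
  case: ku => k u /=.
  have Wk : 0 <= W / 2 ^+ k.+1 by rewrite divr_ge0 ?exprn_ge0.
  have Hk : 0 <= H / 2 ^+ k.+1 by rewrite divr_ge0 ?exprn_ge0.
  apply: contrapT => /forallNP no.
  have [bu|nbu] := pselect (bad k u); last by apply: (no u).
  have sm v : u.1 <= v.1 <= u.1 + W / 2 ^+ k.+1 ->
      u.2 <= v.2 <= u.2 + H / 2 ^+ k.+1 ->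
      smallc G v.1 v.2 (W / 2 ^+ k.+1) (H / 2 ^+ k.+1) (eta / 4 ^+ k.+1).
    by move=> h1 h2; apply: contrapT => nsm; apply: (no v) => _; split.
  apply: bu; apply: smallc_split; rewrite -!half -!quart.
  - by apply: (sm u); rewrite lexx lerDl.
  - by apply: (sm (u.1 + W / 2 ^+ k.+1, u.2)); rewrite /= ?lexx !lerDl ?Wk.
  - by apply: (sm (u.1, u.2 + H / 2 ^+ k.+1)); rewrite /= ?lexx !lerDl ?Hk.
  - by apply: (sm (u.1 + W / 2 ^+ k.+1, u.2 + H / 2 ^+ k.+1));
      rewrite /= ?lexx !lerDl ?Hk ?Wk.
have [nxt Hnxt] := choice step.
pose u := fix u (k : nat) := if k is k'.+1 then nxt (k', u k') else (a, c).
have badu k : bad k (u k).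
  elim: k => [|k ih] /=; last by case: (Hnxt (k, u k) ih).
  by rewrite /bad /= !expr0 !divr1.
have [p Hp] : exists p, forall k, (u k).1 <= p <= (u k).1 + W / 2 ^+ k.
  by apply: nested_point => // k; case: (Hnxt (k, u k) (badu k)).
have [q Hq] : exists q, forall k, (u k).2 <= q <= (u k).2 + H / 2 ^+ k.
  by apply: nested_point => // k; case: (Hnxt (k, u k) (badu k)).
have [||k0 Hk0] := dG p q.
  by have := Hp 0; rewrite /= expr0 divr1.
  by have := Hq 0; rewrite /= expr0 divr1.
(* With this [e], the affine bound at scale [k] is exactly [eta / 4 ^ k]. *)
pose L := W + H + 1.
have L0 : 0 < L by rewrite /L; lra.
pose e := eta / (2 * L ^+ 2).
have e0 : 0 < e by rewrite divr_gt0// mulr_gt0// exprn_gt0.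
have [d d0 Hd] := Hk0 _ e0.
have [k kd] : exists k, L / 2 ^+ k < d.
  have Ld0 : 0 <= L / d by rewrite divr_ge0 ?ltW.
  exists (Num.bound (L / d)); rewrite ltr_pdivrMr ?exprn_gt0// mulrC -ltr_pdivrMr//.
  rewrite (lt_trans (archi_boundP Ld0))// -natrX ltr_nat.
  exact: ltn_expl.
apply: (badu k); exists 0%N => n _.
have k2 : 0 < 2 ^+ k :> R by rewrite exprn_gt0.
have Wk : 0 <= W / 2 ^+ k by rewrite divr_ge0 ?exprn_ge0.
have Hk : 0 <= H / 2 ^+ k by rewrite divr_ge0 ?exprn_ge0.
have WL : W / 2 ^+ k < d.
  by rewrite (le_lt_trans _ kd)// ler_pM2r ?invr_gt0// /L; lra.
have HL : H / 2 ^+ k < d.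
  by rewrite (le_lt_trans _ kd)// ler_pM2r ?invr_gt0// /L; lra.
apply: (@le_trans _ _ (2 * (e * (L / 2 ^+ k)) * (W / 2 ^+ k + H / 2 ^+ k))).
  apply: (@contour_affine_bound _ _ _ _ _ _ (G p q) k0 p q) => //.
    by rewrite mulr_ge0 ?(ltW e0)// divr_ge0 ?(ltW L0)// ltW.
  move=> s t sI tI.
  have sp : `|s - p| <= W / 2 ^+ k.
    by have := Hp k; move: sI; rewrite ler_norml; clear; lra.
  have tq : `|t - q| <= H / 2 ^+ k.
    by have := Hq k; move: tI; rewrite ler_norml; clear; lra.
  have := Hd (s - p) (t - q) (le_lt_trans sp WL) (le_lt_trans tq HL).
  rewrite !(addrC _ (_ - _)) !subrK => h; apply: (le_trans h).
  rewrite ler_wpM2l ?(ltW e0)// (le_trans (lerD sp tq))//.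
  rewrite -mulrDl ler_pM2r ?invr_gt0// /L; lra.
have -> : 4 ^+ k = 2 ^+ k * 2 ^+ k :> R by rewrite -exprMn -natrM.
rewrite -mulrDl.
have WHL : W + H <= L by rewrite /L; lra.
have -> : eta / (2 ^+ k * 2 ^+ k) = 2 * (e * (L / 2 ^+ k)) * (L / 2 ^+ k).
  rewrite /e; field; rewrite ?lt0r_neq0//.
have eL0 : 0 <= 2 * (e * (L / 2 ^+ k)).
  by rewrite mulr_ge0// mulr_ge0 ?(ltW e0)// divr_ge0 ?(ltW L0) ?(ltW k2).
by rewrite ler_wpM2l// ler_pM2r ?invr_gt0.
Qed.

End Goursat.

(** * Circle averages and the mean value property *)

Section Averages.
Variable R : realType.
Local Notation C := (cplx R).

Definition cis (t : R) : C := ofR (cos t) + iC R * ofR (sin t).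
(** [exp (s + i t)]. *)
Definition polar (s t : R) : C := ofR (expR s) * cis t.

Lemma cisD a b : cis (a + b) = cis a * cis b.
Proof. by rewrite /cis; apply: cplxP; rewrite !cE ?cosD ?sinD; ring. Qed.

Lemma nrm_cis t : nrm (cis t) = 1.
Proof.
apply/eqP; rewrite -(@eqrXn2 _ 2)// ?nrm_ge0// nrm_sqr /cis !cE.
by rewrite !(mul0r, mul1r, add0r, subr0, addr0, mulr0) cos2Dsin2 expr1n.
Qed.

Lemma cis0 : cis 0 = 1.
Proof. by apply: cplxP; rewrite /cis !cE ?cos0 ?sin0; ring. Qed.

Lemma cis_2pi : cis (2 * pi) = 1.
Proof.
by apply: cplxP; rewrite /cis !cE (mulr_natl pi 2) ?cos2pi ?sin2pi; ring.
Qed.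

Lemma polarD s t x y : polar (s + x) (t + y) = polar s t * polar x y.
Proof. by rewrite /polar expRD ofRM cisD; ring. Qed.

Lemma real_first_order (f : R -> R) (l : R) : is_derive (0 : R) (1 : R) f l ->
  forall e, 0 < e -> exists2 d : R, 0 < d & forall h, `|h| < d ->
    `|f h - f 0 - l * h| <= e * `|h|.
Proof.
move=> [/cvg_ex[l' fl] fE] e e0.
have l'E : l' = l by rewrite -fE; apply/esym/cvg_lim.
rewrite {}l'E {l' fE} in fl.
have := @cvgr_dist_le _ _ _ _ _ _ _ fl _ e0.
rewrite near_withinE => H.
have [d /= d0 Hd] := (@nbhs_ballP R R _ _).1 (H _).
exists d => // h hd; have [->|h0] := eqVneq h 0.
  by rewrite mulr0 subrr subr0 normr0 mulr0.
have := Hd h; rewrite /ball/= sub0r normrN => /(_ hd h0).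
rewrite -[X in `|X|]/(l - h^-1 * (f (h * 1 + 0) - f 0)) mulr1 addr0 => H1.
have -> : f h - f 0 - l * h = - (h * (l - h^-1 * (f h - f 0))).
  by rewrite mulrBr mulrA divff// mul1r opprB (mulrC l).
by rewrite normrN normrM mulrC ler_wpM2r.
Qed.

Lemma polar_first_order (e : R) : 0 < e ->
  exists2 d : R, 0 < d & forall x y, `|x| < d -> `|y| < d ->
    nrm (polar x y - 1 - (ofR x + iC R * ofR y)) <= e * (`|x| + `|y|).
Proof.
move=> e0; have e40 : 0 < e / 6 by rewrite divr_gt0.
have [d1 d10 H1] := real_first_order (is_derive_expR 0) e40.
have [d2 d20 H2] := real_first_order (is_derive_cos 0) e40.
have [d3 d30 H3] := real_first_order (is_derive_sin 0) e40.
exists (Num.min 1 (Num.min (e / 6) (Num.min d1 (Num.min d2 d3)))).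
  by rewrite !lt_min ltr01 e40 d10 d20 d30.
move=> x y; rewrite !lt_min.
move=> /andP[x1 /andP[xe /andP[xd1 /andP[xd2 xd3]]]].
move=> /andP[y1 /andP[ye /andP[yd1 /andP[yd2 yd3]]]].
have hx := H1 _ xd1; have hc := H2 _ yd2; have hs := H3 _ yd3.
rewrite expR0 mul1r in hx; rewrite cos0 sin0 oppr0 mul0r subr0 in hc.
rewrite sin0 cos0 mul1r subr0 in hs.
have -> : polar x y - 1 - (ofR x + iC R * ofR y) =
   ofR (expR x - 1 - x) * cis y +
   (1 + ofR x) * (cis y - 1 - iC R * ofR y) + iC R * (ofR x * ofR y).
  by rewrite /polar; apply: cplxP; rewrite !cE; ring.
rewrite (le_trans (nrm_le_add _ _))//.
have hcis : nrm (cis y - 1 - iC R * ofR y) <= e / 6 * `|y| + e / 6 * `|y|.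
  rewrite (le_trans (nrm_le_reim _))// lerD//.
    by rewrite /cis !cE !(mul0r, mul1r, subr0, addr0).
  by rewrite /cis !cE !(mul0r, mul1r, subr0, addr0, add0r).
have h1x : nrm (1 + ofR x : C) <= 2.
  rewrite (le_trans (nrm_le_add _ _))// nrm1 nrm_ofR; lra.
have A1 : nrm (ofR (expR x - 1 - x) * cis y) <= e / 6 * `|x|.
  by rewrite nrmM nrm_cis mulr1 nrm_ofR.
have A2 : nrm ((1 + ofR x) * (cis y - 1 - iC R * ofR y)) <=
    2 * (e / 6 * `|y| + e / 6 * `|y|).
  by rewrite nrmM ler_pM// nrm_ge0.
have A3 : nrm (iC R * (ofR x * ofR y)) <= e / 6 * `|y|.
  by rewrite nrmM nrm_iC mul1r -ofRM nrm_ofR normrM ler_wpM2r// ltW.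
have := nrm_le_add (ofR (expR x - 1 - x) * cis y)
  ((1 + ofR x) * (cis y - 1 - iC R * ofR y)).
have := mulr_ge0 (ltW e0) (normr_ge0 x).
have := mulr_ge0 (ltW e0) (normr_ge0 y).
rewrite (mulrDr e `|x|); lra.
Qed.

Lemma nrm_polar s t : nrm (polar s t) = expR s.
Proof. by rewrite /polar nrmM nrm_cis mulr1 nrm_ofR ger0_norm// expR_ge0. Qed.

Lemma sdiff_polar (g : C -> C) s t : cdiff g (polar s t) ->
  sdiff (fun s t => g (polar s t)) s t.
Proof.
move=> [c gc]; set z := polar s t in gc *.
exists (c * z) => e e0.
have z0 := nrm_ge0 z; have c0 := nrm_ge0 c.
pose e1 := e / (6 * (nrm z + 1)).
have e10 : 0 < e1 by rewrite divr_gt0//; lra.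
have cz0 := mulr_ge0 c0 z0.
pose e2 := e / (2 * (nrm c * nrm z + 1)).
have e20 : 0 < e2 by rewrite divr_gt0//; lra.
have [d1 d10 H1] := gc _ e10.
have [d2 d20 H2] := polar_first_order e20.
have [d3 d30 H3] := polar_first_order (@ltr01 R).
pose d4 := d1 / (6 * (nrm z + 1)).
have d40 : 0 < d4 by rewrite divr_gt0//; lra.
exists (Num.min d2 (Num.min d3 d4)); first by rewrite !lt_min d20 d30 d40.
move=> x y; rewrite !lt_min.
move=> /andP[x2 /andP[x3 x4]] /andP[y2 /andP[y3 y4]].
pose h := z * (polar x y - 1).
have -> : polar (s + x) (t + y) = z + h by rewrite polarD /h /z; ring.
have -> : g (z + h) - g z - c * z * (ofR x + iC R * ofR y) =
  (g (z + h) - g z - c * h) +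
  c * z * (polar x y - 1 - (ofR x + iC R * ofR y)) by rewrite /h; ring.
have xy0 : 0 <= `|x| + `|y| by rewrite addr_ge0.
have p3 : nrm (polar x y - 1) <= 3 * (`|x| + `|y|).
  have -> : polar x y - 1 = (polar x y - 1 - (ofR x + iC R * ofR y)) +
    (ofR x + iC R * ofR y) by rewrite subrK.
  rewrite (le_trans (nrm_le_add _ _))//.
  have := H3 _ _ x3 y3.
  have : nrm (ofR x + iC R * ofR y : C) <= `|x| + `|y|.
    by rewrite (le_trans (nrm_le_add _ _))// nrmM nrm_iC !nrm_ofR mul1r.
  lra.
have hz : nrm h <= (nrm z + 1) * (3 * (`|x| + `|y|)).
  rewrite /h nrmM ler_pM ?nrm_ge0//; lra.
have hd : nrm h < d1.
  rewrite (le_lt_trans hz)// mulrA -ltr_pdivlMl; last by lra.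
  have -> : ((nrm z + 1) * 3)^-1 * d1 = d4 + d4.
    by rewrite /d4; field; lra.
  by rewrite ltrD.
rewrite (le_trans (nrm_le_add _ _))//.
have B1 : nrm (g (z + h) - g z - c * h) <= e / 2 * (`|x| + `|y|).
  rewrite (le_trans (H1 _ hd))// (le_trans (ler_wpM2l (ltW e10) hz))//.
  rewrite le_eqVlt; apply/orP; left; apply/eqP; rewrite /e1; field; lra.
have B2 : nrm (c * z * (polar x y - 1 - (ofR x + iC R * ofR y))) <=
    e / 2 * (`|x| + `|y|).
  rewrite (nrmM (c * z)) (nrmM c) (le_trans (ler_wpM2l cz0 (H2 _ _ x2 y2)))// mulrA.
  rewrite ler_wpM2r// /e2 mulrA ler_pdivrMr; last by lra.
  rewrite (_ : e / 2 * _ = e * (nrm c * nrm z) + e); last by field.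
  lra.
lra.
Qed.

(** Discrete form of the mean of [g] over the circle of radius [r]. *)
Definition avg (n : nat) (g : C -> C) (r : R) : C :=
  ofR ((2 ^+ n)^-1) * \sum_(k < 2 ^ n) g (ofR r * cis (k%:R * (2 * pi / 2 ^+ n))).

Lemma rsum_avg n (g : C -> C) s :
  rsum n (fun t => g (polar s t)) (2 * pi) = ofR (2 * pi) * avg n g (expR s).
Proof. by rewrite /rsum /avg ofRM mulrA. Qed.

Lemma avgD n f g r : avg n (fun z => f z + g z) r = avg n f r + avg n g r.
Proof. by rewrite /avg big_split mulrDr. Qed.

Lemma avgZ n c g r : avg n (fun z => c * g z) r = c * avg n g r.
Proof. by rewrite /avg mulrCA [in RHS]mulr_sumr. Qed.

Lemma avg_sum n m (F : 'I_m -> C -> C) r :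
  avg n (fun z => \sum_(i < m) F i z) r = \sum_(i < m) avg n (F i) r.
Proof. by rewrite /avg exchange_big mulr_sumr. Qed.

Lemma nrm_circle (r t : R) : 0 <= r -> nrm (ofR r * cis t) = r.
Proof. by move=> r0; rewrite nrmM nrm_cis mulr1 nrm_ofR ger0_norm. Qed.

Lemma eq_avg n f g r : 0 <= r -> (forall z, nrm z = r -> f z = g z) ->
  avg n f r = avg n g r.
Proof.
move=> r0 fg; rewrite /avg; congr (_ * _); apply: eq_bigr => k _.
by apply: fg; exact: nrm_circle.
Qed.

Lemma nrm_sum_avg n (F : 'I_(2 ^ n) -> C) M : (forall k, nrm (F k) <= M) ->
  nrm (ofR ((2 ^+ n)^-1) * \sum_k F k) <= M.
Proof.
move=> FM; have h2 : 0 < 2 ^+ n :> R by rewrite exprn_gt0.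
rewrite nrmM nrm_ofR ger0_norm ?invr_ge0 ?(ltW h2)//.
rewrite ler_pdivrMl// (le_trans (nrm_sum _ _ _))//.
rewrite (@le_trans _ _ (\sum_(k < 2 ^ n) M))//; first exact: ler_sum.
by rewrite sumr_const card_ord -[_ *+ (2 ^ n)]mulr_natl natrX.
Qed.

Lemma avg_bound n g r M : 0 <= r -> (forall z, nrm z = r -> nrm (g z) <= M) ->
  nrm (avg n g r) <= M.
Proof. by move=> r0 gM; apply: nrm_sum_avg => k; apply/gM/nrm_circle. Qed.

Lemma avg0 n g : avg n g 0 = g 0.
Proof.
rewrite /avg; under eq_bigr do rewrite [ofR 0](_ : _ = 0)// mul0r.
rewrite sumr_const card_ord -[_ *+ (2 ^ n)]mulr_natl mulrA.
have -> : ((2 ^ n)%:R : C) = ofR (2 ^+ n).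
  by rewrite /ofR -natrX rmorph_nat.
by rewrite -ofRM mulVf ?mul1r// expf_neq0.
Qed.

(** Goursat on the rectangle [[ln r1, ln r2] x [0, 2 pi]]: the two horizontal
    sides cancel by periodicity. *)
Lemma avg_annulus g r1 r2 : 0 < r1 -> r1 <= r2 ->
  (forall z, r1 <= nrm z <= r2 -> cdiff g z) ->
  forall e, 0 < e -> exists n0, forall n, (n0 <= n)%N ->
    nrm (avg n g r2 - avg n g r1) <= e.
Proof.
move=> r10 r12 dg e e0.
have r20 : 0 < r2 by exact: lt_le_trans r12.
have pi2 : 0 < 2 * pi :> R by rewrite mulr_gt0// pi_gt0.
have W0 : 0 <= ln r2 - ln r1 by rewrite subr_ge0 ler_ln.
have [|n0 H] := @goursat R (fun s t => g (polar s t)) (ln r1) 0 _ _ W0 (ltW pi2) _ _ (mulr_gt0 pi2 e0).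
  move=> s t /andP[s1 s2] _; apply: sdiff_polar; apply: dg.
  rewrite nrm_polar; apply/andP; split.
    by rewrite -(lnK r10) ler_expR.
  by rewrite -(lnK r20) ler_expR; move: s2; rewrite addrC subrK.
exists n0 => n /H; rewrite /contour addrC.
have -> : (fun x => g (polar (ln r1 + x) 0) - g (polar (ln r1 + x) (0 + 2 * pi))) =
  fun=> 0.
  by apply/funext => x; rewrite add0r /polar cis0 cis_2pi subrr.
rewrite rsum_cst mulr0 addr0 nrmM nrm_iC mul1r addrC subrK.
have -> : (fun y => g (polar (ln r2) (0 + y)) - g (polar (ln r1) (0 + y))) =
  (fun y => g (polar (ln r2) y) + -1 * g (polar (ln r1) y)).
  by apply/funext => y; rewrite add0r mulN1r.
rewrite rsumD (rsum_avg n (fun z => g z)) (rsum_avg n (fun z => -1 * g z)).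
rewrite !lnK ?posrE// avgZ -mulrDr nrmM nrm_ofR gtr0_norm// ler_pM2l//.
by rewrite mulN1r.
Qed.

Lemma cdiff_cont g z : cdiff g z -> forall e : R, 0 < e ->
  exists2 d : R, 0 < d & forall y, nrm (y - z) < d -> nrm (g y - g z) < e.
Proof.
move=> [c gc] e e0; have [d d0 H] := gc 1 ltr01.
have c0 := nrm_ge0 c.
exists (Num.min d (e / (nrm c + 2))).
  by rewrite lt_min d0 divr_gt0//; lra.
move=> y; rewrite lt_min => /andP[yd ye].
have := H _ yd; rewrite (addrC z) subrK mul1r => h.
have -> : g y - g z = (g y - g z - c * (y - z)) + c * (y - z) by rewrite subrK.
rewrite (le_lt_trans (nrm_le_add _ _))// nrmM.
move: ye; rewrite ltr_pdivlMr; last by lra.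
have := nrm_ge0 (y - z).
rewrite mulrDr (mulrC (nrm c)); lra.
Qed.

(** The averages are asymptotically constant on each of the two annuli cut out by
    the circle through [w]; uniform continuity carries them across that circle
    and down to the centre. *)
Lemma avg_mean_value g (w : C) r : nrm w < r ->
  (forall z, nrm z <= r -> z != w -> cdiff g z) ->
  (forall e : R, 0 < e -> exists2 d : R, 0 < d &
    forall y, nrm (y - w) < d -> nrm (g y - g w) < e) ->
  forall e, 0 < e -> exists n0, forall n, (n0 <= n)%N ->
    nrm (avg n g r - g 0) <= e.
Proof.
move=> wr dg cg e e0.
have r0 : 0 < r by exact: le_lt_trans (nrm_ge0 _) wr.
pose rho := if w == 0 then r / 2 else nrm w.
have rho0 : 0 < rho.
  by rewrite /rho; have [_|w0] := eqVneq; [rewrite divr_gt0|exact: nrm_gt0].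
have rhor : rho < r by rewrite /rho; case: ifP => // _; lra.
have nw z : 0 < nrm z -> nrm z != rho -> z != w.
  move=> z0; apply: contra => /eqP zw; rewrite zw /rho ifN//.
  by apply/eqP => w0; rewrite zw w0 nrm0 ltxx in z0.
have e50 : 0 < e / 5 by rewrite divr_gt0.
have [|d d0 Hd] := @disk_unif_cont R r g _ _ e50.
  move=> x xr e' e'0.
  have [->|xw] := eqVneq x w.
    by have [d d0 H] := cg _ e'0; exists d => // y _; exact: H.
  by have [d d0 H] := cdiff_cont (dg x xr xw) e'0; exists d => // y _; exact: H.
have near_avg n r1 r2 : 0 <= r1 -> r1 <= r2 -> r2 <= r -> r2 - r1 < d ->
    nrm (avg n g r2 - avg n g r1) <= e / 5.
  move=> r10 r12 r2r rd.
  rewrite /avg -mulrBr -sumrB; apply: nrm_sum_avg => k; apply/ltW/Hd.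
  - by rewrite nrm_circle// (le_trans r12).
  - by rewrite nrm_circle// (le_trans r10).
  - rewrite -mulrBl nrmM nrm_cis mulr1.
    have -> : ofR r2 - ofR r1 = ofR (r2 - r1) :> C by apply: cplxP; rewrite !cE; ring.
    by rewrite nrm_ofR ger0_norm// subr_ge0.
(* Radii [m / 2 < rho - m / 2] and [rho + m' / 2 < r - m' / 2] bound the annuli;
   the three gaps that they leave are shorter than [d]. *)
pose m := Num.min d rho / 2; pose m' := Num.min d (r - rho) / 2.
have m0 : 0 < m by rewrite divr_gt0// lt_min d0.
have m'0 : 0 < m' by rewrite divr_gt0// lt_min d0 subr_gt0.
have md : m <= d / 2 by rewrite ler_pM2r ?invr_gt0// ge_min lexx.
have m'd : m' <= d / 2 by rewrite ler_pM2r ?invr_gt0// ge_min lexx.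
have mrho : m <= rho / 2 by rewrite ler_pM2r ?invr_gt0// ge_min lexx orbT.
have m'r : m' <= (r - rho) / 2 by rewrite ler_pM2r ?invr_gt0// ge_min lexx orbT.
have [|||n1 H1] := @avg_annulus g (m / 2) (rho - m / 2) _ _ _ _ e50; [lra|lra| |].
  move=> z /andP[z1 z2]; apply: dg; first lra.
  by apply: nw; [lra|rewrite lt_eqF//; lra].
have [|||n2 H2] := @avg_annulus g (rho + m' / 2) (r - m' / 2) _ _ _ _ e50; [lra|lra| |].
  move=> z /andP[z1 z2]; apply: dg; first lra.
  by apply: nw; [lra|rewrite gt_eqF//; lra].
exists (maxn n1 n2) => n; rewrite geq_max => /andP[/H1 h1 /H2 h2].
have h3 : nrm (avg n g (m / 2) - avg n g 0) <= e / 5.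
  apply: near_avg; move: r0 rho0 rhor m0 m'0 md m'd mrho m'r d0; clear; lra.
have h4 : nrm (avg n g (rho + m' / 2) - avg n g (rho - m / 2)) <= e / 5.
  apply: near_avg; move: r0 rho0 rhor m0 m'0 md m'd mrho m'r d0; clear; lra.
have h5 : nrm (avg n g r - avg n g (r - m' / 2)) <= e / 5.
  apply: near_avg; move: r0 rho0 rhor m0 m'0 md m'd mrho m'r d0; clear; lra.
rewrite avg0 in h3.
have -> : avg n g r - g 0 = (avg n g r - avg n g (r - m' / 2)) +
  (avg n g (r - m' / 2) - avg n g (rho + m' / 2)) +
  (avg n g (rho + m' / 2) - avg n g (rho - m / 2)) +
  (avg n g (rho - m / 2) - avg n g (m / 2)) +
  (avg n g (m / 2) - g 0) by ring.
rewrite (_ : e = e / 5 + e / 5 + e / 5 + e / 5 + e / 5); last by field.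
by do 4![rewrite (le_trans (nrm_le_add _ _))// lerD//].
Qed.

End Averages.

(** * Cauchy's formula and roots of unity *)

Section Cauchy.
Variable R : realType.
Local Notation C := (cplx R).

Lemma cdiff_derivable (f : C -> C) z : cdiff f z -> derivable f z 1.
Proof.
move=> [c fc]; apply/cvg_ex; exists c; apply/cvgrPdist_le => _ /posC_ofR[e re0 ->].
have [d d0 H] := fc _ re0.
rewrite near_withinE; apply/(@nbhs_ballP C C); exists (ofR d) => /=.
  by rewrite ltcR.
move=> h; rewrite /ball/= sub0r normrN normr_lt_nrm => hd h0.
rewrite -[X in `|X|]/(c - h^-1 * (f (h * 1 + z) - f z)) normr_le_nrm.
have -> : c - h^-1 * (f (h * 1 + z) - f z) = - (h^-1 * (f (z + h) - f z - c * h)).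
  by rewrite mulr1 (addrC h); field.
rewrite nrmN nrmM nrmV ler_pdivrMl ?nrm_gt0// [leRHS]mulrC.
exact: H.
Qed.

Lemma eq_cdiff (f g : C -> C) z (d : R) : 0 < d ->
  (forall y, nrm (y - z) < d -> f y = g y) -> cdiff f z -> cdiff g z.
Proof.
move=> d0 fg [c H]; exists c => e /H[d' d'0 H'].
exists (Num.min d d'); first by rewrite lt_min d0.
move=> h; rewrite lt_min => /andP[hd hd']; rewrite -!fg ?subrr ?nrm0//.
  exact: H'.
by rewrite addrC addKr.
Qed.

Lemma cdiff_scale (f : C -> C) (a z : C) : a != 0 -> cdiff f (a * z) ->
  cdiff (fun z => f (a * z)) z.
Proof.
move=> a0 [c H]; exists (c * a) => e e0.
have na := nrm_gt0 a0.
have [d d0 H'] := H _ (divr_gt0 e0 na).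
exists (d / nrm a); first by rewrite divr_gt0.
move=> h hd; rewrite mulrDr -mulrA.
have ahd : nrm (a * h) < d by rewrite nrmM mulrC -ltr_pdivlMr.
by rewrite (le_trans (H' _ ahd))// nrmM mulrA divfK// lt0r_neq0.
Qed.

(** The function whose mean value property is Cauchy's formula for [f]. *)
Definition cauchy_quot (f : C -> C) (w z : C) : C := z * (f z - f w) / (z - w).

(** The quotient extends continuously to [w] by the derivative of [f], so the
    mean value property applies, and its value at the centre is zero. *)
Lemma avg_cauchy_quot (f : C -> C) (w : C) (r : R) :
  (forall z, nrm z <= r -> cdiff f z) -> nrm w < r ->
  forall e, 0 < e -> exists n0, forall n, (n0 <= n)%N ->
    nrm (avg n (cauchy_quot f w) r) <= e.
Proof.
move=> df wr e e0.
have [c Hc] := df w (ltW wr).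
pose g z := if z == w then w * c else cauchy_quot f w z.
have [| |n0 H] := @avg_mean_value R g w r wr _ _ _ e0.
- move=> z zr zw; apply: (@eq_cdiff (cauchy_quot f w) g z (nrm (z - w))).
  + by rewrite nrm_gt0// subr_eq0.
  + by move=> y yz; rewrite /g ifN//; apply/eqP => yw; rewrite yw nrmB ltxx in yz.
  apply: derivable_cdiff.
  have did : derivable (@id C) z (1 : C) by exact: derivable_id.
  have dcst (k : C) : derivable (cst k : C -> C) z (1 : C) by exact: derivable_cst.
  have dnum := derivableM did (derivableB (cdiff_derivable (df z zr)) (dcst (f w))).
  have dden := derivableB did (dcst w).
  have zw0 : (fun y : C => y - w) z != 0 by rewrite subr_eq0.
  have dinv := @derivableV _ _ (fun y : C => y - w) z 1 zw0 dden.
  exact: (derivableM dnum dinv).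
- move=> e' e'0; have w0 := nrm_ge0 w; have c0 := nrm_ge0 c.
  pose e1 := e' / (2 * (nrm w + 2)).
  have e10 : 0 < e1 by rewrite divr_gt0//; lra.
  have [d d0 H] := Hc _ e10.
  pose d1 := e' / (2 * (nrm c + 1)).
  have d10 : 0 < d1 by rewrite divr_gt0//; lra.
  exists (Num.min 1 (Num.min d d1)); first by rewrite !lt_min ltr01 d0 d10.
  move=> y; rewrite !lt_min => /andP[y1 /andP[yd yd1]].
  rewrite /g eqxx; case: (eqVneq y w) => [_|yw]; first by rewrite subrr nrm0.
  have yw0 : y - w != 0 by rewrite subr_eq0.
  have nyw := nrm_gt0 yw0.
  have := H _ yd; rewrite (addrC w) subrK => h.
  have -> : cauchy_quot f w y - w * c =
     y * ((f y - f w - c * (y - w)) / (y - w)) + (y - w) * c.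
    by rewrite /cauchy_quot; field.
  rewrite (le_lt_trans (nrm_le_add _ _))// (splitr e'); apply: ler_ltD.
    rewrite !nrmM nrmV.
    have ny : nrm y <= nrm w + 2.
      have := nrm_le_add (y - w) w; rewrite subrK; lra.
    have h1 : nrm (f y - f w - c * (y - w)) / nrm (y - w) <= e1.
      by rewrite ler_pdivrMr.
    apply: (@le_trans _ _ ((nrm w + 2) * e1)).
      by rewrite ler_pM ?nrm_ge0// divr_ge0 ?nrm_ge0.
    rewrite le_eqVlt; apply/orP; left; apply/eqP; rewrite /e1; field; lra.
  rewrite nrmM; have : d1 * (nrm c + 1) = e' / 2 by rewrite /d1; field; lra.
  have : nrm (y - w) * nrm c <= nrm (y - w) * (nrm c + 1).
    by rewrite ler_wpM2l ?nrm_ge0// lerDl.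
  have : nrm (y - w) * (nrm c + 1) < d1 * (nrm c + 1).
    by rewrite ltr_pM2r//; lra.
  by move=> a b <-; exact: le_lt_trans b a.
exists n0 => n /H; have g0 : g 0 = 0.
  rewrite /g; case: eqVneq => [<-|_]; first by rewrite mul0r.
  by rewrite /cauchy_quot !mul0r.
rewrite g0 subr0; rewrite (@eq_avg _ n g (cauchy_quot f w))//.
  by rewrite (le_trans (nrm_ge0 _) (ltW wr)).
move=> z zr; rewrite /g ifN//; apply/eqP => zw.
by rewrite -zr zw ltxx in wr.
Qed.

(** The [2 ^ n]-th roots of unity. *)
Definition zeta (n k : nat) : C := cis (k%:R * (2 * pi / 2 ^+ n)).

Lemma nrm_zeta n k : nrm (zeta n k) = 1.
Proof. exact: nrm_cis. Qed.

Lemma nrm1_conj (z : C) : nrm z = 1 -> z * Num.conj z = 1.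
Proof. by move=> z1; rewrite mulCconj z1 expr1n. Qed.

Lemma cis_natmul x k : cis (k%:R * x) = cis x ^+ k :> C.
Proof.
elim: k => [|k ih]; first by rewrite mul0r cis0.
by rewrite -addn1 natrD mulrDl mul1r cisD ih exprD expr1.
Qed.

Lemma cis_eq1 (x : R) : 0 < x < 2 * pi -> cis x != 1.
Proof.
move=> /andP[x0 x2]; apply/eqP => x1.
have := congr1 (@re R) x1; have := congr1 (@im R) x1.
rewrite /cis !cE !(mul0r, mul1r, subr0, addr0, add0r) => s0 c1.
have [xpi|pix|xpi] := ltgtP x pi.
- have : 0 < sin x by apply: sin_gt0_pi; rewrite x0.
  by rewrite s0 ltxx.
- have : 0 < sin (x - pi) by apply: sin_gt0_pi; rewrite subr_gt0 pix; lra.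
  by rewrite sinB cospi sinpi s0 mulr0 mul0r subr0 ltxx.
- by move: c1; rewrite xpi cospi; lra.
Qed.

Lemma zeta_sum n j : (0 < j < 2 ^ n)%N -> \sum_(k < 2 ^ n) zeta n k ^+ j = 0.
Proof.
move=> /andP[j0 jn]; set w : C := cis (j%:R * (2 * pi / 2 ^+ n)).
have h2 : 0 < 2 ^+ n :> R by rewrite exprn_gt0.
have pi2 : 0 < 2 * pi :> R by rewrite mulr_gt0// pi_gt0.
have -> : \sum_(k < 2 ^ n) zeta n k ^+ j = \sum_(k < 2 ^ n) w ^+ k.
  apply: eq_bigr => k _; rewrite /zeta /w !cis_natmul -!exprM; congr (_ ^+ _).
  by rewrite mulnC.
have w1 : w != 1.
  apply: cis_eq1; apply/andP; split.
    by rewrite mulr_gt0 ?ltr0n// divr_gt0.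
  by rewrite mulrCA gtr_pMr// ltr_pdivrMr// mul1r -natrX ltr_nat.
have wn : w ^+ (2 ^ n) = 1.
  rewrite /w -cis_natmul natrX mulrCA (mulrC (2 ^+ n)) divfK ?lt0r_neq0//.
  by rewrite cis_natmul cis_2pi expr1n.
have := subrX1 w (2 ^ n); rewrite wn subrr => /esym/eqP.
by rewrite mulf_eq0 subr_eq0 (negbTE w1) /= => /eqP.
Qed.

Lemma zeta_orth n i j : (i < 2 ^ n)%N -> (j < 2 ^ n)%N ->
  \sum_(k < 2 ^ n) zeta n k ^+ i * Num.conj (zeta n k) ^+ j =
  if i == j then ofR (2 ^+ n) else 0.
Proof.
have le_case i' j' : (i' < 2 ^ n)%N -> (j' <= i')%N ->
    \sum_(k < 2 ^ n) zeta n k ^+ i' * Num.conj (zeta n k) ^+ j' =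
    if i' == j' then ofR (2 ^+ n) else 0.
  move=> in' ji.
  have -> : \sum_(k < 2 ^ n) zeta n k ^+ i' * Num.conj (zeta n k) ^+ j' =
      \sum_(k < 2 ^ n) zeta n k ^+ (i' - j').
    apply: eq_bigr => k _; rewrite -{1}(subnK ji) exprD -mulrA -exprMn.
    by rewrite nrm1_conj ?nrm_zeta// expr1n mulr1.
  case: eqVneq => [->|ij].
    rewrite subnn; under eq_bigr do rewrite expr0.
    by rewrite sumr_const card_ord /ofR -natrX rmorph_nat.
  apply: zeta_sum; rewrite subn_gt0 ltn_neqAle eq_sym ij ji /=.
  by rewrite (leq_ltn_trans (leq_subr _ _)).
move=> ilt jlt; case: (leqP j i) => [|/ltnW] ij; first exact: le_case.
have := congr1 (@Num.conj C) (le_case _ _ jlt ij).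
rewrite rmorph_sum /= => h; rewrite eq_sym.
transitivity (if j == i then Num.conj (ofR (2 ^+ n) : C) else Num.conj (0 : C)).
  rewrite -(fun_if (@Num.conj C)) -h; apply: eq_bigr => k _.
  by rewrite rmorphM !rmorphXn /= conjCK mulrC.
rewrite rmorph0; case: ifP => // _.
by apply: cplxP; rewrite !cE ?oppr0.
Qed.

Lemma avg_invX n k (r : R) : 0 < r -> (k < 2 ^ n)%N ->
  avg n (fun z : C => z^-1 ^+ k) r = (k == 0%N)%:R.
Proof.
move=> r0 kn; have h2 : 0 < 2 ^+ n :> R by rewrite exprn_gt0.
have zr0 : ofR r != 0 :> C.
  by apply/eqP => /(congr1 (@re R)); rewrite !cE => r00; rewrite r00 ltxx in r0.
have -> : avg n (fun z : C => z^-1 ^+ k) r = (ofR r)^-1 ^+ k * ofR ((2 ^+ n)^-1) *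
   \sum_(i < 2 ^ n) zeta n i ^+ 0 * Num.conj (zeta n i) ^+ k.
  rewrite /avg -[RHS]mulrA [RHS]mulrCA; congr (_ * _); rewrite mulr_sumr.
  apply: eq_bigr => i _; rewrite expr0 mul1r -exprMn; congr (_ ^+ _).
  rewrite invfM; congr (_ * _).
  apply: (@mulfI _ (zeta n i)).
    by apply/eqP => z0; have := nrm_zeta n i; rewrite z0 nrm0; lra.
  rewrite nrm1_conj ?nrm_zeta// /zeta divff//.
  by apply/eqP => z0; have := nrm_zeta n i; rewrite /zeta z0 nrm0; lra.
rewrite zeta_orth ?expn_gt0//; case: k {kn} => [|k] /=; last by rewrite mulr0.
by rewrite expr0 mul1r -ofRM mulVf// lt0r_neq0.
Qed.

End Cauchy.

(** * Polynomial approximation of holomorphic functions *)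

Lemma exprn_unbounded (R : realType) (c r : R) : 1 < r ->
  exists2 M, (0 < M)%N & c <= r ^+ M.
Proof.
move=> r1; pose b := `|c| / (r - 1).
have b0 : 0 <= b by rewrite divr_ge0//; lra.
exists (Num.bound b).+1 => //; set M := _.+1.
have bM : b <= M%:R.
  by rewrite (le_trans (ltW (archi_boundP b0)))// ler_nat.
have bern : 1 + M%:R * (r - 1) <= r ^+ M.
  elim: M {bM} => [|m ih]; first by rewrite mul0r addr0 expr0.
  rewrite exprS -natr1; have : r * (1 + m%:R * (r - 1)) <= r * r ^+ m.
    by rewrite ler_wpM2l//; lra.
  have : 0 <= m%:R * (r - 1) * (r - 1) by rewrite !mulr_ge0//; lra.
  nra.
rewrite (le_trans _ bern)// (le_trans (ler_norm c))//.
have : b * (r - 1) <= M%:R * (r - 1) by rewrite ler_wpM2r//; lra.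
rewrite /b divfK; first lra.
by rewrite subr_eq0 gt_eqF.
Qed.

Section Density.
Variable R : realType.
Local Notation C := (cplx R).

Lemma ultra_lim (U : set_system nat) (x : nat -> C) (S : R) : UltraFilter U ->
  (forall n, nrm (x n) <= S) ->
  exists a : C, forall e : R, 0 < e -> U [set n | nrm (x n - a) <= e].
Proof.
move=> UU xS.
have lim (y : nat -> R) : (forall n, `|y n| <= S) ->
    exists b : R, forall e : R, 0 < e -> U [set n | `|y n - b| <= e].
  move=> yS.
  have yI : (y @ U) `[- S, S]%classic.
    by apply: (@filterE _ U) => n /=; rewrite in_itv/= -ler_norml; exact: yS.
  have [b [_ yb]] := @segment_compact R (- S) S (y @ U) (fmap_proper_filter y _) yI.
  exists b => e e0.
  have [//|nU] := in_ultra_setVsetC [set n | `|y n - b| <= e] UU.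
  have yA : (y @ U) (~` [set c | `|c - b| <= e]) by exact: nU.
  have yB : nbhs b (ball b e) by exact: nbhsx_ballx.
  have [c [ce cb]] := yb _ _ yA yB.
  by exfalso; apply: ce => /=; apply: ltW; rewrite distrC; exact: cb.
have [a Ha] := lim (fun n => re (x n)) (fun n => le_trans (re_le_nrm _) (xS n)).
have [b Hb] := lim (fun n => im (x n)) (fun n => le_trans (im_le_nrm _) (xS n)).
exists (ofR a + iC R * ofR b) => e e0; have e20 : 0 < e / 2 by rewrite divr_gt0.
apply: filterS (filterI (Ha _ e20) (Hb _ e20)) => n [/= h1 h2].
rewrite (le_trans (nrm_le_reim _))// (splitr e) lerD// !cE.
  by rewrite !(mul0r, mul1r, subr0, addr0, add0r).
by rewrite !(mul0r, mul1r, subr0, addr0, add0r).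
Qed.

Lemma disk_bounded (f : C -> C) (r : R) : 0 <= r ->
  (forall e : R, 0 < e -> exists2 d : R, 0 < d &
    forall x y, nrm x <= r -> nrm y <= r -> nrm (y - x) < d ->
      nrm (f y - f x) < e) ->
  exists2 S, 0 <= S & forall z, nrm z <= r -> nrm (f z) <= S.
Proof.
move=> r0 uf; have [d d0 H] := uf 1 ltr01.
pose m := (Num.bound (r / d)).+1.
have m0 : 0 < m%:R :> R by rewrite ltr0n.
have rm : r / m%:R < d.
  rewrite ltr_pdivrMr// mulrC -ltr_pdivrMr//.
  have rd : 0 <= r / d by rewrite divr_ge0// ltW.
  by rewrite (lt_le_trans (archi_boundP rd))// ler_nat.
exists (nrm (f 0) + m%:R); first by rewrite addr_ge0 ?nrm_ge0.
move=> z zr.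
have seg j : (j <= m)%N -> nrm (ofR (j%:R / m%:R) * z) <= r.
  move=> jm; rewrite nrmM nrm_ofR ger0_norm ?divr_ge0//.
  rewrite (le_trans _ zr)// ler_piMl ?nrm_ge0// ler_pdivrMr// mul1r ler_nat//.
have steps j : (j <= m)%N -> nrm (f (ofR (j%:R / m%:R) * z)) <= nrm (f 0) + j%:R.
  elim: j => [|j ih] jm.
    by rewrite mul0r [ofR 0](_ : _ = 0)// mul0r addr0.
  have h := ih (ltnW jm).
  have : nrm (f (ofR (j.+1%:R / m%:R) * z) - f (ofR (j%:R / m%:R) * z)) < 1.
    apply: H; [exact/seg/ltnW|exact: seg|].
    have -> : ofR (j.+1%:R / m%:R) * z - ofR (j%:R / m%:R) * z =
      ofR (m%:R^-1) * z.
      rewrite -natr1 mulrDl mul1r ofRD; ring.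
    rewrite nrmM nrm_ofR ger0_norm ?invr_ge0//.
    by rewrite (le_lt_trans _ rm)// mulrC ler_pM2r ?invr_gt0.
  have := nrm_lerB (f (ofR (j.+1%:R / m%:R) * z)) (f (ofR (j%:R / m%:R) * z)).
  rewrite -natr1; lra.
have := steps m (leqnn m); rewrite divff ?lt0r_neq0//.
by rewrite [ofR 1](_ : _ = 1)// mul1r.
Qed.

Lemma geom_kernel (w z : C) M : z != 0 -> z != w ->
  z / (z - w) = \sum_(k < M) w ^+ k * z^-1 ^+ k + (w / z) ^+ M * (z / (z - w)).
Proof.
move=> z0 zw; have zw0 : z - w != 0 by rewrite subr_eq0.
elim: M => [|M ih]; first by rewrite big_ord0 add0r expr0 mul1r.
rewrite big_ord_recr /= {1}ih -addrA; congr (_ + _).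
by rewrite -exprMn exprS; field; rewrite zw0.
Qed.

Lemma nrm_avg_fzk (f : C -> C) (r S : R) n k : 1 <= r ->
  (forall z, nrm z <= r -> nrm (f z) <= S) ->
  nrm (avg n (fun z => f z * z^-1 ^+ k) r) <= S.
Proof.
move=> r1 fS; have r0 : 0 <= r by lra.
apply: avg_bound => // z zr; rewrite nrmM nrmX nrmV zr.
have := fS z; rewrite zr lexx => /(_ isT) h.
rewrite (le_trans _ h)// ler_piMr ?nrm_ge0//.
by rewrite exprn_ile1 ?invr_ge0// invf_le1//; lra.
Qed.

(** Truncating the expansion of Cauchy's kernel approximates [f] on the closed
    unit disk by polynomials whose coefficients are averages of [f z / z ^ k]. *)
Lemma cauchy_truncation (f : C -> C) (r S : R) (w : C) M : 1 < r ->
  (forall z, nrm z <= r -> cdiff f z) ->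
  (forall z, nrm z <= r -> nrm (f z) <= S) -> nrm w <= 1 -> (0 < M)%N ->
  forall e : R, 0 < e -> exists n0, forall n, (n0 <= n)%N ->
    nrm (\sum_(k < M) w ^+ k * avg n (fun z => f z * z^-1 ^+ k) r - f w) <=
      r^-1 ^+ M * (r / (r - 1)) * (2 * S) + e.
Proof.
move=> r1 df fS w1 M0 e e0; have r0 : 0 < r by lra.
have wr : nrm w < r by lra.
have [n1 H1] := avg_cauchy_quot df wr e0.
exists (maxn n1 M) => n; rewrite geq_max => /andP[/H1 h1 Mn].
have M2n : (M <= 2 ^ n)%N by rewrite (leq_trans Mn)// ltnW// ltn_expl.
pose rem z := (w / z) ^+ M * (z / (z - w)) * (f z - f w).
have zr_neq z : nrm z = r -> z != 0 /\ z != w.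
  move=> zr; split; apply/eqP => zE; last by rewrite -zr zE ltxx in wr.
  by rewrite -zr zE nrm0 ltxx in r0.
have qE : avg n (cauchy_quot f w) r =
    \sum_(k < M) w ^+ k * avg n (fun z => f z * z^-1 ^+ k) r - f w + avg n rem r.
  rewrite (@eq_avg _ n _ (fun z => (\sum_(k < M) (w ^+ k * (f z * z^-1 ^+ k) +
     - (f w * w ^+ k) * z^-1 ^+ k)) + rem z)) ?(ltW r0)//; last first.
    move=> z /zr_neq[z0 zw]; rewrite /cauchy_quot mulrAC.
    rewrite (geom_kernel M z0 zw) mulrDl; congr (_ + _).
    rewrite mulr_suml; apply: eq_bigr => k _; ring.
  rewrite avgD; congr (_ + _); rewrite avg_sum.
  under eq_bigr do rewrite avgD !avgZ.
  rewrite big_split /=; congr (_ + _).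
  under eq_bigr => k _ do rewrite avg_invX// ?(leq_trans (ltn_ord k))//.
  rewrite (bigD1 (Ordinal M0))//= expr0 !mulr1 big1 ?addr0//.
  by move=> k; rewrite -val_eqE /= => /negbTE ->; rewrite mulr0.
have remE : nrm (avg n rem r) <= r^-1 ^+ M * (r / (r - 1)) * (2 * S).
  apply: avg_bound => [|z zr]; first exact: ltW.
  have [z0 zw] := zr_neq z zr.
  have a1 : nrm ((w / z) ^+ M) <= r^-1 ^+ M.
    rewrite nrmX nrmM nrmV zr lerXn2r ?nnegrE ?mulr_ge0 ?nrm_ge0 ?invr_ge0 ?(ltW r0)//.
    by rewrite ler_piMl// invr_ge0 ltW.
  have a2 : nrm (z / (z - w)) <= r / (r - 1).
    rewrite nrmM nrmV zr ler_pM2l// lef_pV2 ?posrE ?subr_gt0//.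
      by have := nrm_lerB z w; rewrite zr; lra.
    by have := nrm_lerB z w; rewrite zr; lra.
  have a3 : nrm (f z - f w) <= 2 * S.
    rewrite (le_trans (nrm_le_sub _ _))//.
    have := fS z; rewrite zr lexx => /(_ isT).
    have := fS w (ltW wr); lra.
  rewrite /rem (nrmM (_ * (z / (z - w)))) (nrmM (_ ^+ M)).
  by apply: ler_pM a3; rewrite ?mulr_ge0 ?nrm_ge0 ?ler_pM ?nrm_ge0.
have -> : \sum_(k < M) w ^+ k * avg n (fun z => f z * z^-1 ^+ k) r - f w =
   avg n (cauchy_quot f w) r - avg n rem r by rewrite qE addrK.
rewrite (le_trans (nrm_le_sub _ _))//; lra.
Qed.

(** The coefficients of the truncations depend on the number of sample points; an
    ultrafilter limit fixes them, simultaneously for all [w]. *)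
Lemma cdiff_poly_approx (f : C -> C) (r : R) : 1 < r ->
  (forall z, nrm z <= r -> cdiff f z) ->
  forall e : R, 0 < e -> exists p : {poly C}, forall w, nrm w <= 1 ->
    nrm (f w - p.[w]) <= e.
Proof.
move=> r1 df e e0; have r0 : 0 <= r by lra.
have uf := disk_unif_cont (fun x xr e e0 =>
  let: ex_intro2 d d0 H := cdiff_cont (df x xr) e0 in
  ex_intro2 _ _ d d0 (fun y _ h => H y h)).
have [S S0 fS] := disk_bounded r0 uf.
have e20 : 0 < e / 2 by rewrite divr_gt0.
have [M M0 HM] : exists2 M, (0 < M)%N &
    r^-1 ^+ M * (r / (r - 1)) * (2 * S) <= e / 2.
  pose c := r / (r - 1) * (2 * S) / (e / 2).
  have c0 : 0 <= c by rewrite /c !mulr_ge0 ?invr_ge0//; lra.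
  have [M M0 cM] := exprn_unbounded c r1.
  exists M => //; have rM0 : 0 < r ^+ M by rewrite exprn_gt0//; lra.
  rewrite -mulrA exprVn ler_pdivrMl//.
  rewrite /c ler_pdivrMr// in cM.
have [U [UU Uoo]] := @ultraFilterLemma nat \oo _.
have coef k : exists a : C, forall e : R, 0 < e ->
    U [set n | nrm (avg n (fun z => f z * z^-1 ^+ k) r - a) <= e].
  by apply: ultra_lim => n; apply: nrm_avg_fzk fS; exact: ltW.
have [a Ha] := choice coef.
exists (\poly_(k < M) a k) => w w1; rewrite nrmB horner_poly.
apply/ler_addgt0Pr => e1 e10.
have e120 : 0 < e1 / 2 by rewrite divr_gt0.
have Mgt0 : 0 < M%:R :> R by rewrite ltr0n.
pose e2 := e1 / 2 / M%:R.
have e20' : 0 < e2 by rewrite divr_gt0.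
have UF := @ultra_proper _ U UU.
have [n0 Hn0] := cauchy_truncation r1 df fS w1 M0 e20.
have allk : U [set n | forall k, (k < M)%N ->
    nrm (avg n (fun z => f z * z^-1 ^+ k) r - a k) <= e2].
  elim: (M) => [|m ih]; first by apply: filterE.
  apply: filterS (filterI ih (Ha m _ e20')) => n [h1 h2] k.
  by rewrite ltnS leq_eqVlt => /predU1P[-> //|]; exact: h1.
have tr : U [set n | (n0 <= n)%N].
  by apply: Uoo; exists n0.
have [n [nk nn0]] := filter_ex (filterI allk tr).
have h1 := Hn0 n nn0.
have -> : \sum_(k < M) a k * w ^+ k - f w =
  (\sum_(k < M) w ^+ k * avg n (fun z => f z * z^-1 ^+ k) r - f w) -
  \sum_(k < M) w ^+ k * (avg n (fun z => f z * z^-1 ^+ k) r - a k).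
  rewrite addrAC -sumrB; congr (_ - _); apply: eq_bigr => k _; ring.
rewrite (le_trans (nrm_le_sub _ _))//.
have : nrm (\sum_(k < M) w ^+ k * (avg n (fun z => f z * z^-1 ^+ k) r - a k)) <= e1 / 2.
  rewrite (le_trans (nrm_sum _ _ _))//.
  rewrite (@le_trans _ _ (\sum_(k < M) e2))//.
    apply: ler_sum => k _; rewrite nrmM nrmX.
    rewrite (le_trans _ (nk k (ltn_ord k)))// ler_piMl ?nrm_ge0//.
    by rewrite exprn_ile1 ?nrm_ge0.
  by rewrite sumr_const card_ord -[_ *+ M]mulr_natl /e2 mulrC divfK ?lt0r_neq0.
lra.
Qed.

End Density.

(** * Density of polynomials in the disk algebra and the maximum principle *)

Lemma sq_bound_ge0 (R : realType) (S t e x n : R) : 0 < t ->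
  2 * t * e = S ^+ 2 + 1 -> t ^+ 2 - 2 * t * x + n ^+ 2 <= t ^+ 2 + S ^+ 2 ->
  0 <= x + e.
Proof.
move=> t0 te h; have n0 := sqr_ge0 n.
by rewrite -(pmulr_rge0 _ t0) mulrDr; lra.
Qed.

Section DiskAlgebraTheory.
Variable R : realType.
Local Notation C := (cplx R).

(** Dilating [F] to [z |-> F (rho z)] with [rho < 1] makes it differentiable
    beyond the closed disk; uniform continuity controls the dilation error. *)
Lemma disk_algebra_poly_approx (f : cdisk R -> C) :
  f \in disk_algebra (R := R) -> forall e : R, 0 < e ->
  exists p : {poly C}, forall z : cdisk R, nrm (f z - p.[val z]) <= e.
Proof.
move=> /asboolP[F [fF cF dF]] e e0.
have cF' : forall x : C, nrm x <= 1 -> forall e : R, 0 < e ->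
    exists2 d : R, 0 < d & forall y, nrm y <= 1 -> nrm (y - x) < d ->
    nrm (F y - F x) < e.
  move=> x x1 e' e'0; have [|d d0 H] := within_ccont_on cF (x := x) _ e'0.
    by rewrite /= normC1_nrm.
  by exists d => // y y1; apply: H; rewrite /= normC1_nrm.
have e20 : 0 < e / 2 by rewrite divr_gt0.
have [d d0 Hd] := disk_unif_cont cF' e20.
pose m := Num.min d 1.
have m0 : 0 < m by rewrite lt_min d0 ltr01.
have m1 : m <= 1 by rewrite ge_min lexx orbT.
have md : m <= d by rewrite ge_min lexx.
pose rho := 1 - m / 2.
have rho0 : 0 < rho by rewrite /rho; lra.
have rho1 : rho < 1 by rewrite /rho; lra.
have rhoC : ofR rho != 0 :> C.
  by apply/eqP => /(congr1 (@re R)); rewrite !cE => r0; rewrite r0 ltxx in rho0.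
pose r := (1 + rho^-1) / 2.
have rhoV : 1 < rho^-1 by rewrite invf_gt1.
have r1 : 1 < r by rewrite /r; lra.
have rrho : rho * r < 1.
  have : rho * r = (rho + 1) / 2 by rewrite /r; field; lra.
  by move=> ->; lra.
have [|p Hp] := @cdiff_poly_approx R (fun z => F (ofR rho * z)) r r1 _ _ e20.
  move=> z zr; apply: cdiff_scale => //; apply: derivable_cdiff; apply: dF.
  rewrite normC1_nrm_lt nrmM nrm_ofR gtr0_norm//.
  by rewrite (le_lt_trans _ rrho)// ler_pM2l.
exists p => z; rewrite fF.
have z1 : nrm (val z) <= 1 by rewrite -normC1_nrm; exact: (valP z).
have -> : F (val z) - p.[val z] = (F (val z) - F (ofR rho * val z)) +
  (F (ofR rho * val z) - p.[val z]) by rewrite addrA subrK.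
rewrite (le_trans (nrm_le_add _ _))// (splitr e) lerD//; last exact: Hp.
apply/ltW/Hd => //.
  by rewrite nrmM nrm_ofR gtr0_norm// mulr_ile1 ?nrm_ge0// ltW.
have -> : val z - ofR rho * val z = ofR (1 - rho) * val z.
  by rewrite (_ : ofR (1 - rho) = 1 - ofR rho :> C); [ring|apply: cplxP; rewrite !cE; ring].
rewrite nrmM nrm_ofR gtr0_norm ?subr_gt0//.
apply: (@le_lt_trans _ _ (1 - rho)); last by rewrite /rho; lra.
by rewrite ler_piMr// subr_ge0 ltW.
Qed.

Lemma poly_disk_bounded (p : {poly C}) (z : C) : nrm z <= 1 ->
  nrm p.[z] <= \sum_(i < size p) nrm p`_i.
Proof.
move=> z1; rewrite horner_coef (le_trans (nrm_sum _ _ _))//; apply: ler_sum => i _.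
by rewrite nrmM nrmX ler_piMr ?nrm_ge0// exprn_ile1 ?nrm_ge0.
Qed.

Lemma poly_coef_bound (p : {poly C}) (M : R) j :
  (forall z, nrm z = 1 -> nrm p.[z] <= M) -> nrm p`_j <= M.
Proof.
move=> pM; pose n := maxn (size p) j.
have sn : (size p < 2 ^ n)%N.
  by apply: leq_ltn_trans (ltn_expl n (isT : (1 < 2)%N)); exact: leq_maxl.
have jn : (j < 2 ^ n)%N.
  by apply: leq_ltn_trans (ltn_expl n (isT : (1 < 2)%N)); exact: leq_maxr.
have -> : p`_j = ofR ((2 ^+ n)^-1) *
    \sum_(k < 2 ^ n) p.[zeta R n k] * Num.conj (zeta R n k) ^+ j.
  under eq_bigr do rewrite (@horner_coef_wide _ (2 ^ n)) ?(ltnW sn)// mulr_suml.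
  rewrite exchange_big /=.
  under eq_bigr => i _.
    under eq_bigr do rewrite -mulrA.
    rewrite -mulr_sumr zeta_orth//.
    over.
  rewrite (bigD1 (Ordinal jn))//= eqxx big1 => [|i].
    by rewrite addr0 mulrCA -ofRM mulVf ?expf_neq0// mulr1.
  by rewrite -val_eqE /= => /negbTE ->; rewrite mulr0.
apply: nrm_sum_avg => k.
by rewrite nrmM nrmX nrm_conj nrm_zeta expr1n mulr1 pM// nrm_zeta.
Qed.

(** Maximum principle: the coefficient bound gives [|p(w)| <= M / (1 - |w|)],
    and applying it to the powers of [p] removes the factor. *)
Lemma poly_max_modulus (p : {poly C}) (M : R) w :
  (forall z, nrm z = 1 -> nrm p.[z] <= M) -> nrm w < 1 -> nrm p.[w] <= M.
Proof.
move=> pM w1; have w0 := nrm_ge0 w.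
have bnd (q : {poly C}) (K : R) : (forall z, nrm z = 1 -> nrm q.[z] <= K) ->
    nrm q.[w] <= K / (1 - nrm w).
  move=> qK; have K0 : 0 <= K by rewrite (le_trans (nrm_ge0 _) (qK 1 (nrm1 R))).
  rewrite horner_coef (le_trans (nrm_sum _ _ _))//.
  apply: (@le_trans _ _ (\sum_(i < size q) K * nrm w ^+ i)).
    apply: ler_sum => i _; rewrite nrmM nrmX ler_wpM2r ?exprn_ge0//.
    exact: poly_coef_bound.
  rewrite -mulr_sumr ler_wpM2l// -[_^-1]mul1r ler_pdivlMr ?subr_gt0// mulrC.
  have := subrX1 (nrm w) (size q).
  have : 0 <= nrm w ^+ size q by rewrite exprn_ge0.
  have -> : (1 - nrm w) * \sum_(i < size q) nrm w ^+ i =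
    - ((nrm w - 1) * \sum_(i < size q) nrm w ^+ i) by rewrite -mulNr opprB.
  move=> h <-; lra.
have M0 : 0 <= M by rewrite (le_trans (nrm_ge0 _) (pM 1 (nrm1 R))).
have [//|Mp] := leP (nrm p.[w]) M.
have [M00|Mpos] := eqVneq M 0.
  by have := bnd _ _ pM; rewrite M00 mul0r leNgt -M00 Mp.
have Mgt0 : 0 < M by rewrite lt_def Mpos.
have t1 : 1 < nrm p.[w] / M by rewrite ltr_pdivlMr// mul1r.
have [m m0 Hm] := exprn_unbounded ((1 - nrm w)^-1 + 1) t1.
have := bnd (p ^+ m) (M ^+ m); rewrite horner_exp nrmX => H.
have : nrm p.[w] ^+ m <= M ^+ m / (1 - nrm w).
  by apply: H => z /pM h; rewrite horner_exp nrmX lerXn2r ?nnegrE ?nrm_ge0.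
rewrite -ler_pdivrMl ?exprn_gt0// mulrC -expr_div_n; lra.
Qed.

(** The maximum principle for real parts follows from that for moduli applied
    to [t - f] with [t] large. *)
Lemma disk_algebra_re_ge0 (f : cdisk R -> C) : f \in disk_algebra (R := R) ->
  (forall z : cdisk R, nrm (val z) = 1 -> 0 <= re (f z)) ->
  forall z : cdisk R, 0 <= re (f z).
Proof.
move=> fA f0 w.
have w1 : nrm (val w) <= 1 by rewrite -normC1_nrm; exact: (valP w).
have [w1'|] := ltP (nrm (val w)) 1; last first.
  by move=> w1'; apply: f0; apply/eqP; rewrite eq_le w1.
apply/ler_addgt0Pr => e e0; have e20 : 0 < e / 2 by rewrite divr_gt0.
have [p Hp] := disk_algebra_poly_approx fA e20.
have rep (z : cdisk R) : `|re (f z) - re p.[val z]| <= e / 2.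
  have -> : re (f z) - re p.[val z] = re (f z - p.[val z]) by rewrite !cE.
  by rewrite (le_trans (re_le_nrm _)).
pose q := p + (ofR (e / 2))%:P.
have qE z : q.[z] = p.[z] + ofR (e / 2) by rewrite hornerD hornerC.
have q0 z : nrm z = 1 -> 0 <= re q.[z].
  move=> z1; have z1' : (`|z| : C) <= 1 by rewrite normC1_nrm z1.
  have := f0 (exist _ z z1') z1; have := rep (exist _ z z1').
  by rewrite qE !cE /= ler_norml; lra.
suff : 0 <= re q.[val w].
  have := rep w; rewrite qE !cE ler_norml; lra.
clearbody q.
pose S := \sum_(i < size q) nrm q`_i.
apply/ler_addgt0Pr => e1 e10.
pose t := (S ^+ 2 + 1) / (2 * e1).
have S0 : 0 <= S ^+ 2 by rewrite sqr_ge0.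
have t0 : 0 < t by rewrite divr_gt0//; lra.
have sq0 : 0 <= t ^+ 2 + S ^+ 2 by rewrite addr_ge0// sqr_ge0.
have tq z : nrm (ofR t - q.[z]) ^+ 2 = t ^+ 2 - 2 * t * re q.[z] + nrm q.[z] ^+ 2.
  rewrite !nrm_sqr !cE; ring.
have := @poly_max_modulus ((ofR t)%:P - q) (Num.sqrt (t ^+ 2 + S ^+ 2)) _ _ w1'.
rewrite !hornerE => H.
have {}H : nrm (ofR t - q.[val w]) <= Num.sqrt (t ^+ 2 + S ^+ 2).
  apply: H => z z1; rewrite !hornerE -ler_sqr ?nnegrE ?nrm_ge0 ?sqrtr_ge0//.
  rewrite sqr_sqrtr// tq.
  have : nrm q.[z] ^+ 2 <= S ^+ 2.
    rewrite lerXn2r ?nnegrE ?nrm_ge0//; first by apply: sumr_ge0 => i _; exact: nrm_ge0.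
    by apply: poly_disk_bounded; rewrite z1.
  have : 0 <= t * re q.[z] by rewrite mulr_ge0 ?q0// ltW.
  by clear; lra.
move: H; rewrite -ler_sqr ?nnegrE ?nrm_ge0 ?sqrtr_ge0//.
rewrite sqr_sqrtr// tq.
apply: sq_bound_ge0 t0 _; rewrite /t; field; lra.
Qed.

End DiskAlgebraTheory.

(** * Hilbert spaces *)

Section HilbertTheory.
Variables (R : realType) (H : hilbertType R).
Local Notation C := (cplx R).
Implicit Types x y z : H.

Lemma innerC x y : inner x y = Num.conj (inner y x).
Proof. by rewrite (hermitian_subproof (s := inner) x y) expr0 mul1r. Qed.

Lemma innerDl x y z : inner (x + y) z = inner x z + inner y z.
Proof. exact: linearDl. Qed.

Lemma innerZl (a : C) x z : inner (a *: x) z = a * inner x z.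
Proof. exact: linearZl_LR. Qed.

Lemma innerDr z x y : inner z (x + y) = inner z x + inner z y.
Proof. by rewrite innerC innerDl rmorphD /= -!innerC. Qed.

Lemma innerZr (a : C) z x : inner z (a *: x) = Num.conj a * inner z x.
Proof. by rewrite innerC innerZl rmorphM /= -!innerC. Qed.

Lemma innerNl x z : inner (- x) z = - inner x z.
Proof. by rewrite -scaleN1r innerZl mulN1r. Qed.

Lemma innerNr z x : inner z (- x) = - inner z x.
Proof. by rewrite innerC innerNl rmorphN /= -innerC. Qed.

Lemma inner0l z : inner 0 z = 0.
Proof. by rewrite -(scale0r 0) innerZl mul0r. Qed.

Lemma inner0r z : inner z 0 = 0.
Proof. by rewrite innerC inner0l rmorph0. Qed.

Lemma inner_suml (I : Type) (r : seq I) (P : pred I) (F : I -> H) z :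
  inner (\sum_(i <- r | P i) F i) z = \sum_(i <- r | P i) inner (F i) z.
Proof.
elim/big_rec2 : _ => [|i a b _ <-]; first exact: inner0l.
by rewrite innerDl.
Qed.

Lemma inner_sumr (I : Type) (r : seq I) (P : pred I) (F : I -> H) z :
  inner z (\sum_(i <- r | P i) F i) = \sum_(i <- r | P i) inner z (F i).
Proof.
elim/big_rec2 : _ => [|i a b _ <-]; first exact: inner0r.
by rewrite innerDr.
Qed.

Lemma inner_nrm x : inner x x = ofR (nrm x ^+ 2).
Proof.
by rewrite -inner_norm nrmE; apply: cplxP; rewrite !expr2 !cE /=; ring.
Qed.

Lemma nrm_sqrD x y : nrm (x + y) ^+ 2 = nrm x ^+ 2 + nrm y ^+ 2 + 2 * re (inner x y).
Proof.
have := congr1 (@re R) (inner_nrm (x + y)); rewrite re_ofR => <-.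
rewrite innerDl !innerDr !inner_nrm (innerC y x) !cE; ring.
Qed.

Lemma nrm_sqrB x y : nrm (x - y) ^+ 2 = nrm x ^+ 2 + nrm y ^+ 2 - 2 * re (inner x y).
Proof. by rewrite nrm_sqrD nrmN innerNr !cE mulrN. Qed.

Lemma parallelogram x y :
  nrm (x + y) ^+ 2 + nrm (x - y) ^+ 2 = 2 * (nrm x ^+ 2 + nrm y ^+ 2).
Proof. by rewrite nrm_sqrD nrm_sqrB; ring. Qed.

Lemma seq_complete (u : nat -> H) :
  (forall e : R, 0 < e -> exists n0, forall m n, (n0 <= m)%N -> (n0 <= n)%N ->
     nrm (u m - u n) <= e) ->
  exists l, forall e : R, 0 < e -> exists n0, forall n, (n0 <= n)%N ->
     nrm (u n - l) <= e.
Proof.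
move=> uC.
have /cauchy_cvg/cvg_ex[l ul] : cauchy (u @ \oo).
  apply: cauchy_exP => _ /posC_ofR[e e0 ->].
  have e20 : 0 < e / 2 by rewrite divr_gt0.
  have [n0 Hn0] := uC _ e20.
  exists (u n0); exists n0 => // n /= n0n.
  rewrite -ball_normE /= normr_lt_nrm.
  by rewrite (le_lt_trans (Hn0 _ _ (leqnn _) n0n))// ltr_pdivrMr//; lra.
exists l => e e0; have eC : 0 < (ofR e : C) by rewrite ltcR.
have /cvgrPdist_le/(_ _ eC)[n0 _ Hn0] := ul.
by exists n0 => n n0n; have := Hn0 n n0n; rewrite /= normr_le_nrm nrmB.
Qed.

Lemma gram_schmidt (s : seq H) : exists n (e : 'I_n -> H),
  (forall i j, inner (e i) (e j) = (i == j)%:R) /\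
  forall x, x \in s -> exists c : 'I_n -> C, x = \sum_i c i *: e i.
Proof.
elim: s => [|x s [n [e [eo es]]]].
  by exists 0%N, (fun=> 0); split => // -[].
pose x' := x - \sum_i inner x (e i) *: e i.
have x'e i : inner x' (e i) = 0.
  rewrite /x' innerDl innerNl inner_suml (bigD1 i)//= innerZl eo eqxx mulr1.
  rewrite big1 ?addr0 ?subrr// => j ji.
  by rewrite innerZl eo (negbTE ji) mulr0.
have [x'0|x'0] := eqVneq x' 0.
  exists n, e; split=> // y; rewrite inE => /predU1P[->|/es//].
  by exists (fun i => inner x (e i)); apply/eqP; rewrite -subr_eq0 -/x' x'0.
have nx' : nrm x' != 0 by apply: contra x'0 => /eqP h; apply/eqP; exact: nrm_eq0.
pose e' (i : 'I_n.+1) := oapp e (ofR (nrm x')^-1 *: x') (unlift ord0 i).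
have e'0 : e' ord0 = ofR (nrm x')^-1 *: x' by rewrite /e' unlift_none.
have e'S i : e' (lift ord0 i) = e i by rewrite /e' liftK.
exists n.+1, e'; split.
  have cR (a : R) : Num.conj (ofR a : C) = ofR a by apply: cplxP; rewrite !cE ?oppr0.
  move=> i j; case: (unliftP ord0 i) => [i'|] ->; case: (unliftP ord0 j) => [j'|] ->.
  - by rewrite !e'S eo (inj_eq (lift_inj (h := ord0))).
  - by rewrite e'S e'0 innerZr innerC x'e rmorph0 mulr0.
  - by rewrite e'S e'0 innerZl x'e mulr0.
  - rewrite e'0 innerZl innerZr cR inner_nrm -!ofRM eqxx.
    by apply: cplxP; rewrite !cE // expr2 mulKf// mulVf.
move=> y; rewrite inE => /predU1P[->|/es[c ->]]; last first.
  exists (fun i => oapp c 0 (unlift ord0 i)).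
  rewrite big_ord_recl unlift_none scale0r add0r; apply: eq_bigr => i _.
  by rewrite liftK e'S.
exists (fun i => oapp (fun i => inner x (e i)) (ofR (nrm x')) (unlift ord0 i)).
rewrite big_ord_recl unlift_none e'0 /= scalerA -ofRM divff// scale1r.
under eq_bigr do rewrite liftK e'S /=.
by rewrite /x' subrK.
Qed.

Lemma nrm_orthonormal n (e : 'I_n -> H) (c : 'I_n -> C) :
  (forall i j, inner (e i) (e j) = (i == j)%:R) ->
  nrm (\sum_i c i *: e i) ^+ 2 = \sum_i nrm (c i) ^+ 2.
Proof.
move=> eo; have := congr1 (@re R) (inner_nrm (\sum_i c i *: e i)).
rewrite re_ofR => <-; rewrite inner_suml re_sum; apply: eq_bigr => i _.
rewrite innerZl inner_sumr (bigD1 i)//= big1 ?addr0.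
  by rewrite innerZr eo eqxx mulr1 mulCconj.
by move=> j ji; rewrite innerZr eo eq_sym (negbTE ji) mulr0.
Qed.

(** In the coordinates of an orthonormal family that carries [y], the action on
    [H ^ r] is a direct sum of copies of the action on [C ^ r]. *)
Lemma matrix_ampliation r (A : 'I_r -> 'I_r -> C) (M : R) :
  (forall c : 'I_r -> C,
     \sum_i nrm (\sum_j A i j * c j) ^+ 2 <= M * \sum_j nrm (c j) ^+ 2) ->
  forall y : 'I_r -> H,
     \sum_i nrm (\sum_j A i j *: y j) ^+ 2 <= M * \sum_j nrm (y j) ^+ 2.
Proof.
move=> AM y; have [n [e [eo es]]] := gram_schmidt [seq y j | j <- enum 'I_r].
have /choice[c yc] j : exists c : 'I_n -> C, y j = \sum_i c i *: e i.
  by apply: es; apply: map_f; rewrite mem_enum.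
have -> : \sum_j nrm (y j) ^+ 2 = \sum_k \sum_j nrm (c j k) ^+ 2.
  by rewrite exchange_big; apply: eq_bigr => j _; rewrite yc nrm_orthonormal.
have -> : \sum_i nrm (\sum_j A i j *: y j) ^+ 2 =
    \sum_k \sum_i nrm (\sum_j A i j * c j k) ^+ 2.
  rewrite exchange_big; apply: eq_bigr => i _.
  have -> : \sum_j A i j *: y j = \sum_k (\sum_j A i j * c j k) *: e k.
    under [RHS]eq_bigr do rewrite scaler_suml.
    rewrite exchange_big; apply: eq_bigr => j _; rewrite yc scaler_sumr.
    by apply: eq_bigr => k _; rewrite scalerA.
  by rewrite nrm_orthonormal.
by rewrite mulr_sumr; apply: ler_sum => k _; exact: AM.
Qed.

End HilbertTheory.

Lemma isometry_nrm (R : realType) (H K : hilbertType R) (T : H -> K) :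
  (forall x y : H, inner (T x) (T y) = inner x y) -> forall h, nrm (T h) = nrm h.
Proof.
move=> TI h; apply/eqP; rewrite -(@eqrXn2 _ 2)// ?nrm_ge0//.
by have := TI h h; rewrite !inner_nrm => /(congr1 (@re R)); rewrite !re_ofR => ->.
Qed.

(** The projection theorem for the range of an isometry: a minimizing sequence
    for the distance is Cauchy by the parallelogram law. *)
Lemma orth_proj_range (R : realType) (H K : hilbertType R) (iota : {linear H -> K}) :
  (forall x y : H, inner (iota x) (iota y) = inner x y) ->
  forall x : K, exists h, orth_proj (range iota) x = iota h /\
    forall m, inner (x - iota h) (iota m) = 0.
Proof.
move=> iotaI x.
have iotaN := isometry_nrm iotaI.
have lZ a h : iota (a *: h) = a *: iota h by rewrite linearZ.
have lD h h' : iota (h + h') = iota h + iota h' by rewrite linearD.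
suff [h hP] : exists h, forall m, inner (x - iota h) (iota m) = 0.
  have := @xgetI K 0 [set y | range iota y /\
    forall m, range iota m -> inner (x - y) m = 0] (iota h).
  rewrite -/(orth_proj _ _) => -[|[h' _ h'E] H'].
    by split; [exists h|move=> _ [m _ <-]].
  by exists h'; split => // m; rewrite h'E; apply: H'; exists m.
pose D := [set nrm (x - iota h) ^+ 2 | h in [set: H]].
have Dlb : has_inf D.
  split; first by exists (nrm (x - iota 0) ^+ 2), 0.
  by exists 0 => _ [h _ <-]; rewrite sqr_ge0.
pose d := inf D.
have dle h : d <= nrm (x - iota h) ^+ 2 by apply: ge_inf Dlb.2 _ _; exists h.
have /choice[u ud] n : exists h, nrm (x - iota h) ^+ 2 <= d + n.+1%:R^-1.
  have n0 : 0 < n.+1%:R^-1 :> R by rewrite invr_gt0.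
  have [_ [h _ <-] hd] := inf_adherent n0 Dlb.
  by exists h; exact: ltW.
have uC m n : nrm (u m - u n) ^+ 2 <= 2 * (m.+1%:R^-1 + n.+1%:R^-1).
  have := parallelogram (x - iota (u m)) (x - iota (u n)).
  have -> : x - iota (u m) - (x - iota (u n)) = - iota (u m - u n).
    by rewrite (raddfB iota) !opprB addrC addrA subrK.
  have -> : x - iota (u m) + (x - iota (u n)) =
      (2 : cplx R) *: (x - iota ((2^-1 : cplx R) *: (u m + u n))).
    rewrite scalerBr lZ scalerA mulfV ?pnatr_eq0// scale1r lD.
    by rewrite scaler_nat mulr2n opprD addrACA.
  rewrite nrmN iotaN nrmZ.
  have -> : nrm (2 : cplx R) = 2.
    by rewrite (_ : 2 = ofR 2 :> cplx R) ?nrm_ofR ?ger0_norm//; apply: cplxP; rewrite !cE; ring.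
  have := dle ((2^-1 : cplx R) *: (u m + u n)); have := ud m; have := ud n.
  rewrite exprMn; move: (m.+1%:R^-1) (n.+1%:R^-1) => p q; lra.
have [|l ul] := @seq_complete _ _ u.
  move=> e e0; have e2 : 0 < e ^+ 2 / 4 by rewrite divr_gt0// exprn_gt0.
  exists (Num.bound (e ^+ 2 / 4)^-1) => m n.
  have small k : (Num.bound (e ^+ 2 / 4)^-1 <= k)%N -> k.+1%:R^-1 <= e ^+ 2 / 4.
    move=> hk; rewrite invf_ple ?posrE//.
    have b0 : 0 <= (e ^+ 2 / 4)^-1 by rewrite invr_ge0 ltW.
    by rewrite (le_trans (ltW (archi_boundP b0)))// ler_nat leqW.
  move=> /small m0 /small n0; rewrite -ler_sqr ?nnegrE ?nrm_ge0 ?(ltW e0)//.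
  have := uC m n; move: m0 n0; move: (m.+1%:R^-1) (n.+1%:R^-1) => p q; lra.
exists l.
have dl : nrm (x - iota l) ^+ 2 <= d.
  apply/ler_addgt0Pr => e e0.
  pose a := nrm (x - iota l).
  have a0 : 0 <= a by exact: nrm_ge0.
  pose e1 := Num.min 1 (e / (4 * (a + 1))).
  have e10 : 0 < e1 by rewrite lt_min ltr01 divr_gt0//; lra.
  have [n1 Hn1] := ul _ e10.
  pose n2 := Num.bound (e / 2)^-1.
  pose n := maxn n1 n2.
  have n2s : n.+1%:R^-1 <= e / 2.
    rewrite invf_ple ?posrE ?divr_gt0//.
    have b0 : 0 <= (e / 2)^-1 by rewrite invr_ge0 ltW// divr_gt0.
    by rewrite (le_trans (ltW (archi_boundP b0)))// ler_nat leqW// leq_maxr.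
  have h1 := Hn1 n (leq_maxl _ _).
  have h2 : a - e1 <= nrm (x - iota (u n)).
    have := nrm_lerB (x - iota l) (iota (u n) - iota l).
    rewrite -(raddfB iota) iotaN (raddfB iota) opprB addrA subrK => h; rewrite /a; lra.
  have h3 := ud n.
  have e1e : e1 * (4 * (a + 1)) <= e.
    rewrite -ler_pdivlMr; first by rewrite ge_min lexx orbT.
    lra.
  have [ae|ae] := leP a e1.
    have e11 : e1 <= 1 by rewrite ge_min lexx.
    have : 0 <= d by apply: lb_le_inf; [exact: Dlb.1|move=> _ [h _ <-]; rewrite sqr_ge0].
    have h4 : a * a <= 1 * e1 by apply: ler_pM => //; exact: le_trans ae e11.
    have h5 := mulr_ge0 (ltW e10) a0.
    by rewrite -/a expr2; lra.
  have : (a - e1) ^+ 2 <= nrm (x - iota (u n)) ^+ 2.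
    by rewrite lerXn2r ?nnegrE ?nrm_ge0//; lra.
  have h5 := sqr_ge0 e1; rewrite -/a; move: h3 n2s.
  by move: (n.+1%:R^-1) => p; lra.
have real0 m : re (inner (x - iota l) (iota m)) = 0.
  set b := re _; pose N := nrm m ^+ 2.
  have N0 : 0 <= N by rewrite sqr_ge0.
  have q (t : R) : 0 <= t ^+ 2 * N - 2 * t * b.
    have := dle (l + ofR t *: m).
    have -> : x - iota (l + ofR t *: m) = (x - iota l) - ofR t *: iota m.
      by rewrite lD lZ opprD addrA.
    rewrite nrm_sqrB innerZr !cE oppr0 mul0r subr0 nrmZ nrm_ofR iotaN.
    rewrite exprMn real_normK ?num_real// -/b -/N; lra.
  have := q (b / (N + 1)).
  have N1 : N + 1 != 0 by lra.
  have -> : (b / (N + 1)) ^+ 2 * N - 2 * (b / (N + 1)) * b =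
     - (b ^+ 2 * ((N + 2) / (N + 1) ^+ 2)) by field.
  rewrite oppr_ge0 pmulr_lle0; last by rewrite divr_gt0 ?exprn_gt0//; lra.
  by move=> h; apply/eqP; rewrite -sqrf_eq0 eq_le h sqr_ge0.
have reim0 (y : cplx R) : re y = 0 -> re (y * iC R) = 0 -> y = 0.
  by move=> r0 i0; apply: cplxP; rewrite ?cE// in r0 i0 *; lra.
move=> m; apply: reim0; first exact: real0.
have := real0 (- iC R *: m); rewrite lZ innerZr => h.
by rewrite mulrC -[RHS]h; congr (re (_ * _)); apply: cplxP; rewrite !cE; ring.
Qed.

(** * A matrix von Neumann inequality for isometries *)

Section PolynomialAction.
Variables (R : realType) (K : hilbertType R) (U : bop K).
Local Notation C := (cplx R).
Implicit Types (p q : {poly C}) (x y : K).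

(** The vector [p(U) y]. *)
Definition pact p y : K := \sum_(n < size p) p`_n *: iter n U y.

Lemma pact_wide m p y : (size p <= m)%N ->
  pact p y = \sum_(n < m) p`_n *: iter n U y.
Proof.
move=> pm; rewrite /pact (big_ord_widen _ (fun n => p`_n *: iter n U y) pm).
rewrite big_mkcond; apply: eq_bigr => n _.
by case: ltnP => // h; rewrite nth_default ?scale0r.
Qed.

Lemma pactD p q y : pact (p + q) y = pact p y + pact q y.
Proof.
pose m := maxn (size p) (size q).
rewrite !(@pact_wide m) ?leq_maxl ?leq_maxr ?size_polyD//.
by rewrite -big_split; apply: eq_bigr => n _; rewrite coefD scalerDl.
Qed.

Lemma pactC (c : C) y : pact c%:P y = c *: y.
Proof. by rewrite (@pact_wide 1) ?size_polyC_leq1// big_ord1 coefC. Qed.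

Lemma pactMX p y : pact (p * 'X) y = U (pact p y).
Proof.
rewrite (@pact_wide (size p).+1); last first.
  by have [->|p0] := eqVneq p 0; [rewrite mul0r size_poly0|rewrite size_mulX].
rewrite big_ord_recl coefMX scale0r add0r /pact raddf_sum.
by apply: eq_bigr => n _; rewrite coefMX /= linearZ.
Qed.

Lemma pactM p q y : pact (p * q) y = pact p (pact q y).
Proof.
elim/poly_ind: p => [|p c ih]; first by rewrite mul0r -polyC0 !pactC !scale0r.
rewrite mulrDl pactD pactD pactC [p * 'X * q]mulrAC !pactMX ih; congr (_ + _).
rewrite mul_polyC (@pact_wide (size q)); last exact: size_scale_leq.
rewrite [in RHS]/pact scaler_sumr; apply: eq_bigr => n _.
by rewrite coefZ scalerA.
Qed.

Lemma pactN p y : pact (- p) y = - pact p y.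
Proof. by rewrite -[- p]mulN1r -polyC1 -polyCN pactM pactC scaleN1r. Qed.

Lemma pactX y : pact 'X y = U y.
Proof. by rewrite -['X]mul1r pactMX -polyC1 pactC scale1r. Qed.

Lemma pact_iter p n y : pact p (iter n U y) = iter n U (pact p y).
Proof.
elim: n => //= n <-; rewrite /pact raddf_sum; apply: eq_bigr => k _.
by rewrite -iterSr /= linearZ.
Qed.

Lemma iter_sum n (I : finType) (x : I -> K) :
  iter n U (\sum_i x i) = \sum_i iter n U (x i).
Proof. by elim: n => //= n ->; rewrite raddf_sum. Qed.

(** Padding by zero keeps the convolutions below from wrapping around the finite
    grid of roots of unity, so that Parseval's identity applies to them. *)
Definition shift1 (a : nat -> K) (m : nat) : K := if m is m'.+1 then a m' else 0.

Lemma iter_shift1 n a m : iter n shift1 a m = if (n <= m)%N then a (m - n)%N else 0.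
Proof.
by elim: n m => [|n ih] [|m] //=.
Qed.

Lemma shift1_sum N (z : C) (a : nat -> K) : (forall m, (N <= m.+1)%N -> a m = 0) ->
  z *: (\sum_(m < N) z ^+ m *: a m) = \sum_(m < N) z ^+ m *: shift1 a m.
Proof.
case: N => [|N] aN; first by rewrite !big_ord0 scaler0.
rewrite big_ord_recr aN//= scaler0 addr0 big_ord_recl /= scaler0 add0r.
by rewrite scaler_sumr; apply: eq_bigr => m _; rewrite scalerA -exprS.
Qed.

Lemma iter_shift_sum N D n (z : C) (a : nat -> K) : (n <= D)%N ->
  (forall m, (N <= m + D)%N -> a m = 0) ->
  z ^+ n *: (\sum_(m < N) z ^+ m *: a m) =
    \sum_(m < N) z ^+ m *: iter n shift1 a m.
Proof.
move=> + aN; elim: n => [|n ih] nD; first by rewrite expr0 scale1r.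
rewrite exprS -scalerA ih ?(ltnW nD)// shift1_sum// => m Nm.
rewrite iter_shift1; case: leqP => // nm; apply: aN.
lia.
Qed.

Lemma parseval s (a : nat -> K) :
  \sum_(k < 2 ^ s) nrm (\sum_(m < 2 ^ s) zeta R s k ^+ m *: a m) ^+ 2 =
  2 ^+ s * \sum_(m < 2 ^ s) nrm (a m) ^+ 2.
Proof.
have E : \sum_(k < 2 ^ s) inner (\sum_(m < 2 ^ s) zeta R s k ^+ m *: a m)
    (\sum_(m < 2 ^ s) zeta R s k ^+ m *: a m) =
    \sum_(m < 2 ^ s) ofR (2 ^+ s) * inner (a m) (a m).
  under eq_bigr => k _.
    rewrite inner_suml.
    under eq_bigr => m _.
      rewrite inner_sumr.
      under eq_bigr do rewrite innerZl innerZr mulrA rmorphXn.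
      over.
    over.
  rewrite exchange_big; apply: eq_bigr => m _ /=.
  rewrite exchange_big /= (bigD1 m)//= -mulr_suml zeta_orth// eqxx.
  rewrite big1 ?addr0// => l lm; rewrite -mulr_suml zeta_orth//.
  by rewrite val_eqE eq_sym (negbTE lm) mul0r.
have := congr1 (@re R) E; rewrite !re_sum.
under eq_bigr do rewrite inner_nrm re_ofR.
move=> ->; rewrite mulr_sumr; apply: eq_bigr => m _.
by rewrite inner_nrm -ofRM re_ofR.
Qed.

Hypothesis U_isom : forall x, nrm (U x) = nrm x.

Lemma nrm_iter n x : nrm (iter n U x) = nrm x.
Proof. by elim: n => //= n ih; rewrite U_isom. Qed.

(** Cut-off orbit of [y], in reverse time so that multiplying its transform by
    [p(z)] acts as [p(U)] away from the ends. *)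
Definition orbit N D (y : K) (m : nat) : K :=
  if (m + D < N)%N then iter (N - D - m.+1) U y else 0.

Definition conv D p (a : nat -> K) (m : nat) : K :=
  \sum_(n < D) p`_n *: iter n shift1 a m.

Lemma conv_transform N D p (z : C) (y : K) : (size p <= D)%N ->
  p.[z] *: (\sum_(m < N) z ^+ m *: orbit N D y m) =
  \sum_(m < N) z ^+ m *: conv D p (orbit N D y) m.
Proof.
move=> pD; rewrite (horner_coef_wide _ pD) scaler_suml.
under [RHS]eq_bigr do rewrite scaler_sumr.
rewrite exchange_big; apply: eq_bigr => n _ /=.
rewrite -scalerA (@iter_shift_sum N D) ?(ltnW (ltn_ord n))//.
  by rewrite scaler_sumr; apply: eq_bigr => m _; rewrite !scalerA mulrC.
by move=> m Nm; rewrite /orbit ltnNge Nm.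
Qed.

Lemma conv_middle N D p y m : (size p <= D)%N -> (D <= m)%N -> (m + D < N)%N ->
  conv D p (orbit N D y) m = iter (N - D - m.+1) U (pact p y).
Proof.
move=> pD Dm mN; rewrite -pact_iter (pact_wide _ pD); apply: eq_bigr => n _.
have nm : (n <= m)%N by rewrite (leq_trans (ltnW (ltn_ord n))).
congr (_ *: _); rewrite iter_shift1 nm /orbit ifT; last first.
  by rewrite (leq_ltn_trans _ mN)// leq_add2r leq_subr.
by rewrite -iterD; congr iter; lia.
Qed.

Lemma conv_bound N D p y m : nrm (conv D p (orbit N D y) m) <=
  (\sum_(n < D) nrm p`_n) * nrm y.
Proof.
rewrite (le_trans (nrm_sum _ _ _))// mulr_suml; apply: ler_sum => n _.
rewrite nrmZ ler_wpM2l ?nrm_ge0// iter_shift1 /orbit.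
by do 2?case: ifP => _; rewrite ?nrm0 ?nrm_ge0// nrm_iter.
Qed.

End PolynomialAction.

(** Matrix von Neumann inequality for an isometry, with a scalar denominator.
    Parseval turns the pointwise bound on the circle into a bound for the
    convolutions with a long piece of an orbit, whose terms are, except for
    boundedly many, images under [U ^ n] of [G(U) y] and [q(U) y]. *)
Lemma isometry_poly_bound (R : realType) (K : hilbertType R) (U : bop K) r
    (G : 'I_r -> 'I_r -> {poly cplx R}) (q : {poly cplx R}) (M : R) :
  (forall x, nrm (U x) = nrm x) -> 0 <= M ->
  (forall (z : cplx R) (c : 'I_r -> cplx R), nrm z = 1 ->
     \sum_i nrm (\sum_j (G i j).[z] * c j) ^+ 2 <=
       M * nrm q.[z] ^+ 2 * \sum_j nrm (c j) ^+ 2) ->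
  forall y : 'I_r -> K,
    \sum_i nrm (\sum_j pact U (G i j) (y j)) ^+ 2 <=
      M * \sum_j nrm (pact U q (y j)) ^+ 2.
Proof.
move=> UI M0 GM y.
(* [D] bounds the degrees; [main] compares the [T] terms of the orbit that are
   at distance at least [D] from both ends, and [T] is sent to infinity. *)
pose D := (size q + \sum_i \sum_j size (G i j))%N.
have qD : (size q <= D)%N by exact: leq_addr.
have GD i j : (size (G i j) <= D)%N.
  by rewrite /D (bigD1 i)//= (bigD1 j)//= addnCA -addnA leq_addr.
pose cq := \sum_(n < D) nrm q`_n.
pose X := \sum_i nrm (\sum_j pact U (G i j) (y j)) ^+ 2.
pose Q := \sum_j nrm (pact U q (y j)) ^+ 2.
pose E := \sum_j (cq * nrm (y j)) ^+ 2.
have X0 : 0 <= X by apply: sumr_ge0 => i _; rewrite sqr_ge0.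
have Q0 : 0 <= Q by apply: sumr_ge0 => i _; rewrite sqr_ge0.
have E0 : 0 <= E by apply: sumr_ge0 => i _; rewrite sqr_ge0.
have main s T : (2 ^ s = D + (T + D))%N ->
    T%:R * X <= M * (T%:R * Q + (2 * D)%:R * E).
  move=> sT; pose N := (2 ^ s)%N.
  pose u j := orbit U N D (y j).
  pose W i m := \sum_j conv D (G i j) (u j) m.
  pose V j m := conv D q (u j) m.
  have N0 : 0 < 2 ^+ s :> R by rewrite exprn_gt0.
  have WV : \sum_i \sum_(m < N) nrm (W i m) ^+ 2 <=
      M * \sum_j \sum_(m < N) nrm (V j m) ^+ 2.
    rewrite -(ler_pM2l N0) mulrCA !mulr_sumr.
    under eq_bigr do rewrite -parseval.
    under [X in _ <= X]eq_bigr do rewrite -parseval.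
    rewrite exchange_big -[X in _ <= X]mulr_sumr.
    rewrite [X in _ <= M * X]exchange_big mulr_sumr; apply: ler_sum => k _.
    set z := zeta R s k; have z1 : nrm z = 1 by exact: nrm_zeta.
    pose h j := \sum_(m < N) z ^+ m *: u j m.
    have -> : \sum_i nrm (\sum_(m < N) z ^+ m *: W i m) ^+ 2 =
        \sum_i nrm (\sum_j (G i j).[z] *: h j) ^+ 2.
      apply: eq_bigr => i _; congr (nrm _ ^+ 2).
      under [RHS]eq_bigr do rewrite conv_transform//.
      by rewrite exchange_big; apply: eq_bigr => m _ /=; rewrite scaler_sumr.
    have -> : \sum_j nrm (\sum_(m < N) z ^+ m *: V j m) ^+ 2 =
        nrm q.[z] ^+ 2 * \sum_j nrm (h j) ^+ 2.
      rewrite mulr_sumr; apply: eq_bigr => j _.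
      by rewrite -exprMn -nrmZ conv_transform.
    by rewrite mulrA; apply: matrix_ampliation => c; exact: GM.
  have mid (m : 'I_T) : (D <= D + m)%N /\ (D + m + D < N)%N.
    by rewrite leq_addr /N sT -addnA ltn_add2l addnC [X in (_ < X)%N]addnC ltn_add2l.
  have splitN (f : nat -> R) : \sum_(m < N) f m =
      \sum_(m < D) f m + (\sum_(m < T) f (D + m)%N + \sum_(m < D) f (D + (T + m))%N).
    by rewrite /N sT big_split_ord big_split_ord.
  have left : T%:R * X <= \sum_i \sum_(m < N) nrm (W i m) ^+ 2.
    rewrite exchange_big (splitN (fun m => \sum_i nrm (W i m) ^+ 2)).
    have -> : \sum_(m < T) \sum_i nrm (W i (D + m)%N) ^+ 2 = T%:R * X.
      rewrite mulr_natl -[T in _ *+ T]card_ord -sumr_const.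
      apply: eq_bigr => m _; apply: eq_bigr => i _; congr (_ ^+ 2).
      have [m1 m2] := mid m.
      rewrite /W; under eq_bigr do rewrite conv_middle//.
      rewrite -[RHS](nrm_iter UI (N - D - (D + m).+1)); congr nrm.
      by rewrite iter_sum.
    have s0 n (f : 'I_n -> nat) : 0 <= \sum_m \sum_i nrm (W i (f m)) ^+ 2.
      by apply: sumr_ge0 => m _; apply: sumr_ge0 => i _; rewrite sqr_ge0.
    by rewrite addrCA lerDl addr_ge0.
  apply: (le_trans left); apply: (le_trans WV); rewrite ler_wpM2l//.
  rewrite exchange_big (splitN (fun m => \sum_j nrm (V j m) ^+ 2)).
  have edge m : \sum_j nrm (V j m) ^+ 2 <= E.
    apply: ler_sum => j _; rewrite lerXn2r ?nnegrE ?nrm_ge0//.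
      by rewrite mulr_ge0 ?nrm_ge0// sumr_ge0// => n _; exact: nrm_ge0.
    exact: conv_bound.
  have -> : \sum_(m < T) \sum_j nrm (V j (D + m)%N) ^+ 2 = T%:R * Q.
    rewrite mulr_natl -[T in _ *+ T]card_ord -sumr_const.
    apply: eq_bigr => m _; apply: eq_bigr => j _; congr (_ ^+ 2).
    have [m1 m2] := mid m.
    by rewrite /V conv_middle// nrm_iter.
  have -> : (2 * D)%:R * E = D%:R * E + D%:R * E by rewrite natrM; ring.
  have sumE (f : 'I_D -> R) : (forall m, f m <= E) -> \sum_m f m <= D%:R * E.
    move=> fE; apply: (@le_trans _ _ (\sum_(m < D) E)); first exact: ler_sum.
    by rewrite sumr_const card_ord mulr_natl.
  rewrite addrCA lerD2l lerD//; exact: sumE.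
rewrite -/X -/Q; apply: contrapT => /negP; rewrite -ltNge => XQ.
pose B := M * ((2 * D)%:R * E) / (X - M * Q).
have B0 : 0 <= B by rewrite divr_ge0 ?subr_ge0 ?mulr_ge0 // ltW.
pose T0 := Num.bound B; pose s := (D + T0 + D)%N.
pose T := (2 ^ s - (D + D))%N.
have sT : (2 ^ s = D + (T + D))%N.
  have : (s < 2 ^ s)%N by exact: ltn_expl.
  rewrite /T /s; lia.
have TT0 : (T0 <= T)%N.
  have : (s < 2 ^ s)%N by exact: ltn_expl.
  rewrite /T /s; lia.
have := main s T sT.
have : B < T%:R by rewrite (lt_le_trans (archi_boundP B0))// ler_nat.
rewrite ltr_pdivrMr ?subr_gt0//; lra.
Qed.

(** * Inverses, the Blaschke product of an operator, and matrix norms *)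

Section BopTheory.
Variables (R : realType) (K : hilbertType R).
Local Notation C := (cplx R).
Implicit Types (S T U : bop K) (x y : K).

Lemma bop1E x : (1 : bop K) x = x. Proof. by []. Qed.
Lemma bopME S T x : (S * T) x = S (T x). Proof. by []. Qed.
Lemma bopDE S T x : (S + T) x = S x + T x. Proof. by []. Qed.
Lemma bopNE S x : (- S) x = - S x. Proof. by []. Qed.
Lemma bopZE (a : C) S x : (a *: S) x = a *: S x. Proof. by []. Qed.
Lemma bop0E x : (0 : bop K) x = 0. Proof. by []. Qed.
Definition bopE := (bop1E, bopME, bopDE, bopNE, bopZE, bop0E).

Lemma bopXE T n x : (T ^+ n) x = iter n T x.
Proof. by elim: n => [|n ih]; rewrite ?expr0// exprS bopME ih. Qed.

Lemma bop_sumE (I : Type) (r : seq I) (P : pred I) (F : I -> bop K) x :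
  (\sum_(i <- r | P i) F i) x = \sum_(i <- r | P i) F i x.
Proof. by elim/big_rec2 : _ => // i a b _ <-. Qed.

Lemma bop_inv_eq S T : S * T = 1 -> T * S = 1 -> bop_inv T = S.
Proof.
move=> ST TS; have [IT TI] : (bop_inv T) * T = 1 /\ T * (bop_inv T) = 1.
  exact: (@xgetI _ 0 [set S | S * T = 1 /\ T * S = 1] S).
by rewrite -[LHS]mul1r -ST -mulrA TI mulr1.
Qed.

Lemma unitary_isom U : unitary_op U -> forall x, nrm (U x) = nrm x.
Proof.
move=> [V [UV VU _]]; apply: isometry_nrm => x y.
by rewrite UV -bopME VU bop1E.
Qed.

Lemma exprn_small (t e : R) : 0 <= t -> t < 1 -> 0 < e ->
  exists n0, forall n, (n0 <= n)%N -> t ^+ n <= e.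
Proof.
move=> t0 t1 e0; have [t00|tp] := eqVneq t 0.
  by exists 1%N => -[//|n] _; rewrite t00 expr0n ltW.
have tgt : 0 < t by rewrite lt_def tp.
have tV : 1 < t^-1 by rewrite invf_gt1.
have [m _ hm] := exprn_unbounded e^-1 tV.
exists m => n mn; rewrite (@le_trans _ _ (t ^+ m))//.
  by rewrite ler_wiXn2l// ltW.
by rewrite -[leLHS]invrK -[leRHS]invrK lef_pV2 ?posrE ?invr_gt0 ?exprn_gt0// -exprVn.
Qed.

(** Neumann series: the partial sums are Cauchy because [1 - a U] is bounded
    below and maps them to [y - (a U) ^ n y]. *)
Lemma one_sub_isom_inv U (a : C) : (forall x, nrm (U x) = nrm x) -> nrm a < 1 ->
  exists S : bop K, S * (1 - a *: U) = 1 /\ (1 - a *: U) * S = 1.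
Proof.
move=> UI a1; pose D : bop K := 1 - a *: U; pose T : bop K := a *: U.
have a0 := nrm_ge0 a; have a1' : 0 < 1 - nrm a by lra.
have DE x : D x = x - T x by [].
have DB x y : D (x - y) = D x - D y by exact: raddfB.
have DD x y : D (x + y) = D x + D y by exact: raddfD.
have D0 : D 0 = 0 by exact: raddf0.
have DZ (b : C) x y : D (b *: x + y) = b *: D x + D y by exact: linearP.
have TN x : nrm (T x) = nrm a * nrm x by rewrite /T bopZE nrmZ UI.
have TnN n x : nrm (iter n T x) = nrm a ^+ n * nrm x.
  by elim: n => [|n ih]; rewrite ?expr0 ?mul1r//= TN ih exprS mulrA.
have Dlow x : (1 - nrm a) * nrm x <= nrm (D x).
  by have := nrm_lerB x (T x); rewrite TN -DE; lra.
have Dhigh x : nrm (D x) <= 2 * nrm x.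
  have := nrm_le_sub x (T x); rewrite TN -DE; have := nrm_ge0 x.
  move=> x0; have : nrm a * nrm x <= nrm x by rewrite ler_piMl// ltW.
  lra.
have Dinj x y : D x = D y -> x = y.
  move=> Dxy; apply/eqP; rewrite -subr_eq0; apply/eqP/nrm_eq0.
  have := Dlow (x - y); rewrite DB Dxy subrr nrm0 => h.
  by apply/eqP; rewrite eq_le nrm_ge0 andbT -(pmulr_rle0 _ a1').
have Dsurj y : exists x, D x = y.
  pose u n := \sum_(k < n) iter k T y.
  have Du n : D (u n) = y - iter n T y.
    elim: n => [|n ih]; first by rewrite /u big_ord0 D0 subrr.
    by rewrite /u big_ord_recr DD -/(u n) ih DE addrA subrK.
  have N1 : 0 < nrm y + 1 by have := nrm_ge0 y; lra.
  have small (e : R) : 0 < e -> exists n0, forall n, (n0 <= n)%N ->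
      nrm (iter n T y) <= e.
    move=> e0; have [n0 H] := exprn_small a0 a1 (divr_gt0 e0 N1).
    exists n0 => n /H h; rewrite TnN.
    rewrite ler_pdivlMr// in h; rewrite (le_trans _ h)//.
    by rewrite ler_wpM2l ?exprn_ge0// lerDl.
  have [|l ul] := @seq_complete _ _ u.
    move=> e e0; have e1 : 0 < e * (1 - nrm a) / 2 by rewrite divr_gt0// mulr_gt0.
    have [n0 H] := small _ e1; exists n0 => m n /H hm /H hn.
    rewrite -(ler_pM2l a1') (le_trans (Dlow _))// DB !Du.
    have -> : y - iter m T y - (y - iter n T y) = iter n T y - iter m T y.
      by rewrite opprB addrC addrA subrK.
    rewrite (le_trans (nrm_le_sub _ _))//; lra.
  exists l; apply/eqP; rewrite -subr_eq0; apply/eqP/nrm_eq0/eqP.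
  rewrite eq_le nrm_ge0 andbT; apply/ler_addgt0Pr => e e0; rewrite add0r.
  have e4 : 0 < e / 4 by rewrite divr_gt0.
  have [n1 H1] := ul _ e4; have [n2 H2] := small _ e4.
  have h1 := H1 _ (leq_maxl n1 n2); have h2 := H2 _ (leq_maxr n1 n2).
  move: (maxn n1 n2) h1 h2 => n h1 h2.
  have -> : D l - y = - iter n T y - D (u n - l).
    rewrite DB Du; move: (D l) (iter n T y) => p t.
    by rewrite opprB opprB addrCA addKr.
  rewrite (le_trans (nrm_le_sub _ _))// nrmN.
  have := Dhigh (u n - l); lra.
have [S SP] := choice Dsurj.
have Sbop : S \in @is_bop R K.
  apply/asboolP; split.
    by move=> b x y; apply: Dinj; rewrite DZ !SP.
  by exists (1 - nrm a)^-1 => x; rewrite ler_pdivlMl//; have := Dlow (S x); rewrite SP.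
exists (Bop Sbop); split; apply: bopP => x; last exact: SP.
by apply: Dinj; exact: SP.
Qed.

End BopTheory.

Section BlaschkeOperator.
Variables (R : realType) (N : nat) (B : finite_blaschke R N) (K : hilbertType R).
Variable U : bop K.
Local Notation C := (cplx R).
Hypothesis U_isom : forall x, nrm (U x) = nrm x.

Definition fb_num : {poly C} :=
  (fb_const B)%:P * \prod_(i < N) ('X - (fb_zeros B i)%:P).
Definition fb_den : {poly C} :=
  \prod_(i < N) (1 - (Num.conj (fb_zeros B i))%:P * 'X).

Lemma fb_den_horner (z : C) :
  fb_den.[z] = \prod_(i < N) (1 - Num.conj (fb_zeros B i) * z).
Proof. by rewrite horner_prod; apply: eq_bigr => i _; rewrite !hornerE. Qed.

Lemma fb_fun_horner (z : C) : nrm z <= 1 -> fb_den.[z] * fb_fun B z = fb_num.[z].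
Proof.
move=> z1; rewrite fb_den_horner /fb_fun /fb_num hornerM hornerC mulrCA; congr (_ * _).
rewrite -big_split horner_prod; apply: eq_bigr => i _ /=.
by rewrite mulrCA divff ?mulr1 ?hornerXsubC// fb_den_neq0// normC1_nrm.
Qed.

Let den i := 1 - (Num.conj (fb_zeros B i))%:P * 'X : {poly C}.

Lemma pact_den i y : pact U (den i) y = (1 - Num.conj (fb_zeros B i) *: U) y.
Proof.
rewrite /den pactD -polyC1 pactC scale1r pactN pactM pactX pactC.
by rewrite !bopE.
Qed.

Lemma fb_zeros_nrm i : nrm (Num.conj (fb_zeros B i)) < 1.
Proof. by rewrite nrm_conj -normC1_nrm_lt fb_zeros_disk. Qed.

Lemma fb_den_surj x : exists y, pact U fb_den y = x.
Proof.
rewrite /fb_den; elim: (index_enum _) x => [|i s ih] x.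
  by exists x; rewrite big_nil -polyC1 pactC scale1r.
have [S [_ DS]] := one_sub_isom_inv U_isom (fb_zeros_nrm i).
have [y yE] := ih (S x); exists y.
by rewrite big_cons pactM yE pact_den -bopME DS.
Qed.

(** With [B = b / q], the identity [B(U) q(U) = b(U)] reduces the rational
    functional calculus to polynomials in [U]. *)
Lemma fb_op_den y : fb_op B U (pact U fb_den y) = pact U fb_num y.
Proof.
rewrite /fb_op bopZE /fb_num pactM pactC; congr (_ *: _); rewrite /fb_den.
elim: (index_enum _) y => [|i s ih] y.
  by rewrite !big_nil -polyC1.
rewrite !big_cons bopME [in LHS]mulrC pactM ih -pactM mulrC pactM pact_den.
have [S [SD DS]] := one_sub_isom_inv U_isom (fb_zeros_nrm i).
rewrite (bop_inv_eq SD DS) bopME -(bopME S) SD bop1E pactM.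
by rewrite pactD -polyCN pactC pactX scaleNr !bopE.
Qed.

End BlaschkeOperator.

Section MatrixNormTheory.
Variable R : realType.
Local Notation C := (cplx R).
Variable V : normedModType C.

Lemma sqr_l2norm r (h : 'I_r -> V) : l2norm h ^+ 2 = \sum_(i < r) nrm (h i) ^+ 2.
Proof. by rewrite sqr_sqrtr// sumr_ge0// => i _; rewrite sqr_ge0. Qed.

Lemma l2norm_ge0 r (h : 'I_r -> V) : 0 <= l2norm h.
Proof. exact: sqrtr_ge0. Qed.

Lemma l2norm_le r (h : 'I_r -> V) (a : R) : 0 <= a ->
  (l2norm h <= a) = (\sum_(i < r) nrm (h i) ^+ 2 <= a ^+ 2).
Proof. by move=> a0; rewrite -sqr_l2norm ler_sqr// nnegrE l2norm_ge0. Qed.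

Lemma mx_opnorm_ge0 r (T : 'I_r -> 'I_r -> V -> V) : 0 <= mx_opnorm T.
Proof.
rewrite /mx_opnorm; set A := [set _ | _ in _].
have [[[a Aa] ubA]|noA] := pselect (has_sup A); last by rewrite sup_out.
apply: le_trans (ub_le_sup ubA Aa).
by case: Aa => h _ <-; exact: l2norm_ge0.
Qed.

Lemma mx_opnorm_le r (T : 'I_r -> 'I_r -> V -> V) (M : R) : 0 <= M ->
  (forall i j, T i j 0 = 0) ->
  (forall h, \sum_i nrm (\sum_j T i j (h j)) ^+ 2 <= M ^+ 2 * \sum_j nrm (h j) ^+ 2) ->
  mx_opnorm T <= M.
Proof.
move=> M0 T0 TM; apply: ge_sup.
  exists (l2norm (fun i => \sum_(j < r) T i j 0)), (fun=> 0) => //=.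
  rewrite l2norm_le// big1 ?expr1n// => i _.
  by rewrite nrm0 expr0n.
move=> _ [h /= h1 <-]; rewrite l2norm_le// (le_trans (TM h))//.
by rewrite ler_piMr ?sqr_ge0// -[leRHS](expr1n R 2) -l2norm_le.
Qed.

Lemma sum_sqr_le r (x : 'I_r -> R) : (forall i, 0 <= x i) ->
  (\sum_i x i) ^+ 2 <= r%:R * r%:R * \sum_i x i ^+ 2.
Proof.
move=> x0; have h i : x i <= Num.sqrt (\sum_i x i ^+ 2).
  rewrite -ler_sqr ?nnegrE ?sqrtr_ge0// sqr_sqrtr.
    by rewrite (bigD1 i)//= lerDl sumr_ge0// => j _; rewrite sqr_ge0.
  by rewrite sumr_ge0// => j _; rewrite sqr_ge0.
have : \sum_i x i <= r%:R * Num.sqrt (\sum_i x i ^+ 2).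
  by rewrite (le_trans (ler_sum _ (fun i _ => h i)))// sumr_const card_ord mulr_natl.
rewrite -ler_sqr ?nnegrE ?mulr_ge0 ?sqrtr_ge0 ?sumr_ge0// exprMn sqr_sqrtr.
  by rewrite expr2.
by rewrite sumr_ge0// => j _; rewrite sqr_ge0.
Qed.

Lemma entry_bound r (T : 'I_r -> 'I_r -> V -> V) (k : R) : 0 <= k ->
  (forall i j x, nrm (T i j x) <= k * nrm x) ->
  forall h, \sum_i nrm (\sum_j T i j (h j)) ^+ 2 <=
    (r%:R * r%:R * r%:R * k ^+ 2) * \sum_j nrm (h j) ^+ 2.
Proof.
move=> k0 Tk h.
have row i : nrm (\sum_j T i j (h j)) ^+ 2 <=
    k ^+ 2 * (r%:R * r%:R * \sum_j nrm (h j) ^+ 2).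
  apply: (@le_trans _ _ ((k * \sum_j nrm (h j)) ^+ 2)).
    rewrite lerXn2r ?nnegrE ?nrm_ge0 ?mulr_ge0 ?sumr_ge0//.
      by move=> j _; exact: nrm_ge0.
    rewrite (le_trans (nrm_sum _ _ _))// mulr_sumr; exact: ler_sum.
  rewrite exprMn ler_wpM2l ?sqr_ge0// sum_sqr_le// => j; exact: nrm_ge0.
apply: (le_trans (ler_sum _ (fun i _ => row i))).
by rewrite sumr_const card_ord -[_ *+ r]mulr_natl le_eqVlt; apply/orP; left; apply/eqP; ring.
Qed.

Lemma mx_opnorm_bound r (T : 'I_r -> 'I_r -> V -> V) (k : R) : 0 <= k ->
  (forall i j (a : C) x, T i j (a *: x) = a *: T i j x) ->
  (forall i j x, nrm (T i j x) <= k * nrm x) ->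
  forall h, \sum_i nrm (\sum_j T i j (h j)) ^+ 2 <=
    mx_opnorm T ^+ 2 * \sum_j nrm (h j) ^+ 2.
Proof.
move=> k0 TZ Tk h.
have eb := entry_bound k0 Tk; set c := _ * k ^+ 2 in eb.
have c0 : 0 <= c by rewrite /c !mulr_ge0// sqr_ge0.
have ub : has_ubound [set l2norm (fun i => \sum_(j < r) T i j (h j)) |
       h in [set h : 'I_r -> V | l2norm h <= 1]].
  exists (Num.sqrt c) => _ [g /= g1 <-]; rewrite l2norm_le ?sqrtr_ge0//.
  rewrite sqr_sqrtr// (le_trans (eb g))// ler_piMr//.
  by rewrite -[leRHS](expr1n R 2) -l2norm_le.
have [l0|lp] := eqVneq (l2norm h) 0.
  have := eb h; rewrite -!sqr_l2norm l0 expr0n /= !mulr0 => h'.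
  by rewrite (le_trans h').
have l0 : 0 < l2norm h by rewrite lt_def lp l2norm_ge0.
pose a : C := ofR (l2norm h)^-1.
have na : nrm a = (l2norm h)^-1 by rewrite nrm_ofR ger0_norm// invr_ge0 ltW.
have sc (x : 'I_r -> V) : l2norm (fun i => a *: x i) = nrm a * l2norm x.
  apply/eqP; rewrite -(@eqrXn2 _ 2)// ?mulr_ge0 ?nrm_ge0 ?sqrtr_ge0//.
  rewrite exprMn !sqr_l2norm mulr_sumr.
  by apply/eqP; apply: eq_bigr => i _; rewrite nrmZ exprMn.
have : l2norm (fun i => \sum_j T i j (a *: h j)) <= mx_opnorm T.
  apply: ub_le_sup => //; exists (fun j => a *: h j) => //=.
  by rewrite sc na mulVf.
have -> : (fun i => \sum_j T i j (a *: h j)) = (fun i => a *: \sum_j T i j (h j)).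
  by apply/funext => i; rewrite scaler_sumr; apply: eq_bigr => j _.
rewrite sc na ler_pdivrMl// mulrC -!sqr_l2norm -exprMn => H.
rewrite lerXn2r ?nnegrE ?l2norm_ge0//.
by rewrite (le_trans (l2norm_ge0 _) H).
Qed.

End MatrixNormTheory.

(** * A dilation makes the representation completely contractive *)

Lemma cdisk0_subproof (R : realType) : (`|0 : cplx R| : cplx R) <= 1.
Proof. by rewrite normC1_nrm nrm0. Qed.

Definition cdisk0 (R : realType) : cdisk R := exist _ 0 (cdisk0_subproof R).

Section FbAlgTheory.
Variables (R : realType) (N : nat) (B : finite_blaschke R N).
Local Notation C := (cplx R).
Implicit Types (f g : fbAlg B) (z : cdisk R).

Lemma fbAlgDE f g z : (f + g) z = f z + g z. Proof. by []. Qed.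
Lemma fbAlgNE f z : (- f) z = - f z. Proof. by []. Qed.
Lemma fbAlgZE (a : C) f z : (a *: f) z = a * f z. Proof. by []. Qed.
Lemma fbAlg1E z : (1 : fbAlg B) z = 1. Proof. by []. Qed.

Lemma fbAlg_sumE (I : Type) (r : seq I) (P : pred I) (F : I -> fbAlg B) z :
  (\sum_(i <- r | P i) F i) z = \sum_(i <- r | P i) F i z.
Proof. by elim/big_rec2 : _ => // i a b _ <-. Qed.

Lemma fbAlg_disk_algebra f : (f : cdisk R -> C) \in disk_algebra (R := R).
Proof.
case: f => f /= /asboolP[a [g [gA ->]]].
apply: rpredD; first exact: disk_algebra_cst.
by apply: rpredM => //; exact: fb_cdisk_disk_algebra.
Qed.

Lemma disk_algebra_bounded (f : cdisk R -> C) : f \in disk_algebra (R := R) ->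
  exists2 k, 0 <= k & forall z, nrm (f z) <= k.
Proof.
move=> fA; have [p Hp] := disk_algebra_poly_approx fA ltr01.
have p0 : 0 <= \sum_(i < size p) nrm p`_i by apply: sumr_ge0 => i _; exact: nrm_ge0.
exists (1 + \sum_(i < size p) nrm p`_i); first lra.
move=> z; rewrite -(subrK p.[val z] (f z)) (le_trans (nrm_le_add _ _))// lerD//.
by apply: poly_disk_bounded; rewrite -normC1_nrm; exact: (valP z).
Qed.

Lemma supnorm_le f (k : R) : (forall z, nrm (f z) <= k) -> supnorm f <= k.
Proof.
move=> fk; apply: ge_sup => [|_ [z _ <-]//].
by exists (nrm (f (cdisk0 R))), (cdisk0 R).
Qed.

Lemma fbAlg_matrix_bounded r (F : 'M[fbAlg B]_r) : exists2 K : R, 0 <= K &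
  forall z i j (x : C), nrm (F i j z * x) <= K * nrm x.
Proof.
have /choice[k Hk] (ij : 'I_r * 'I_r) : exists k, 0 <= k /\
    forall z, nrm (F ij.1 ij.2 z) <= k.
  by have [k k0 H] := disk_algebra_bounded (fbAlg_disk_algebra (F ij.1 ij.2)); exists k.
exists (\sum_ij k ij); first by apply: sumr_ge0 => ij _; case: (Hk ij).
move=> z i j x; rewrite nrmM ler_wpM2r ?nrm_ge0// (le_trans ((Hk (i, j)).2 z))//.
by rewrite (bigD1 (i, j))//= lerDl sumr_ge0// => ij _; case: (Hk ij).
Qed.

Lemma mx_supnorm_bound r (F : 'M[fbAlg B]_r) (z : cdisk R) (c : 'I_r -> C) :
  0 <= mx_supnorm F /\
  \sum_i nrm (\sum_j F i j z * c j) ^+ 2 <=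
    mx_supnorm F ^+ 2 * \sum_j nrm (c j) ^+ 2.
Proof.
have [K K0 FK] := fbAlg_matrix_bounded F.
have FZ w i j (a x : C) : F i j w * (a *: x) = a *: (F i j w * x).
  by rewrite /GRing.scale /= mulrCA.
have := mx_opnorm_bound K0 (fun i j => FZ z i j) (fun i j => FK z i j) c.
move=> H.
have ub : has_ubound [set mx_opnorm (fun i j (x : C) => F i j z * x) |
    z in [set: cdisk R]].
  exists (Num.sqrt (r%:R * r%:R * r%:R * K ^+ 2)) => _ [w _ <-].
  apply: mx_opnorm_le; first exact: sqrtr_ge0.
    by move=> i j; rewrite mulr0.
  move=> h; rewrite sqr_sqrtr; last by rewrite !mulr_ge0// sqr_ge0.
  exact: (entry_bound K0 (fun i j => FK w i j)).
have le1 : mx_opnorm (fun i j (x : C) => F i j z * x) <= mx_supnorm F.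
  by apply: ub_le_sup => //; exists z.
have op0 := mx_opnorm_ge0 (fun i j (x : C) => F i j z * x).
have S0 := le_trans op0 le1; split => //.
apply: (le_trans H); rewrite ler_wpM2r ?lerXn2r ?nnegrE//.
by apply: sumr_ge0 => j _; rewrite sqr_ge0.
Qed.

Definition fbpoly (c : C) (p : {poly C}) : fbAlg B :=
  (c *: (1 : fbAlg B) : fbAlg B) + (\sum_(n < size p) p`_n *: zjB B n : fbAlg B).

Lemma fbpolyE c p z : fbpoly c p z = c + p.[val z] * fb_fun B (val z).
Proof.
rewrite fbAlgDE fbAlgZE fbAlg1E mulr1 fbAlg_sumE horner_coef mulr_suml.
by congr (_ + _); apply: eq_bigr => n _; rewrite fbAlgZE /= mulrA.
Qed.

Lemma fbpoly_approx f (e : R) : 0 < e ->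
  exists c p, forall z, nrm (f z - fbpoly c p z) <= e.
Proof.
move=> e0; have := valP f => /asboolP[c [g [gA fE]]].
have [k k0 Bk] := disk_algebra_bounded (fb_cdisk_disk_algebra B).
have ek : 0 < e / (k + 1) by rewrite divr_gt0//; lra.
have [p Hp] := disk_algebra_poly_approx gA ek.
exists c, p => z; rewrite fbpolyE.
have -> : f z = c + fb_fun B (val z) * g z by have := congr1 (@^~ z) fE.
have -> : c + fb_fun B (val z) * g z - (c + p.[val z] * fb_fun B (val z)) =
  fb_fun B (val z) * (g z - p.[val z]) by ring.
rewrite nrmM (@le_trans _ _ (k * (e / (k + 1))))//.
  by rewrite ler_pM ?nrm_ge0//; exact: Bk.
by rewrite mulrCA ler_piMr ?(ltW e0)// ler_pdivrMr ?mul1r; lra.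
Qed.

End FbAlgTheory.

Lemma opnorm_bound (R : realType) (H : hilbertType R) (T : bop H) (x : H) :
  nrm (T x) <= opnorm T * nrm x.
Proof.
have [x0|xn] := eqVneq (nrm x) 0.
  by rewrite (nrm_eq0 x0) raddf0 nrm0 mulr0.
have nx : 0 < nrm x by rewrite lt_def xn nrm_ge0.
have [M [M0 TM]] := bop_bounded T.
rewrite -ler_pdivrMr//.
have -> : nrm (T x) / nrm x = nrm (T (ofR (nrm x)^-1 *: x)).
  by rewrite linearZ nrmZ nrm_ofR ger0_norm ?invr_ge0 ?nrm_ge0// mulrC.
apply: ub_le_sup.
  exists M => _ [y /= y1 <-]; rewrite (le_trans (TM y))//.
  by rewrite ler_piMr.
exists (ofR (nrm x)^-1 *: x) => //=.
by rewrite nrmZ nrm_ofR ger0_norm ?invr_ge0 ?nrm_ge0// mulVf.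
Qed.

Lemma nrm_sqr_addW (R : realType) (V : normedModType (cplx R)) (x y : V) (d : R) :
  0 < d -> nrm (x + y) ^+ 2 <= (1 + d) * nrm x ^+ 2 + (1 + d^-1) * nrm y ^+ 2.
Proof.
move=> d0; apply: (@le_trans _ _ ((nrm x + nrm y) ^+ 2)).
  by rewrite lerXn2r ?nnegrE ?addr_ge0 ?nrm_ge0// nrm_le_add.
rewrite -subr_ge0.
have -> : (1 + d) * nrm x ^+ 2 + (1 + d^-1) * nrm y ^+ 2 - (nrm x + nrm y) ^+ 2 =
  d^-1 * (d * nrm x - nrm y) ^+ 2 by field; lra.
by rewrite mulr_ge0 ?sqr_ge0// invr_ge0 ltW.
Qed.

Section Representation.
Variables (R : realType) (N : nat) (B : finite_blaschke R N) (H : hilbertType R).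
Variable pi : fbAlg B -> bop H.
Hypothesis pi_rep : unital_rep pi.

Lemma repD f g : pi (f + g) = pi f + pi g.
Proof. by have [pilin _ _] := pi_rep; rewrite -[f]scale1r pilin !scale1r. Qed.

Lemma rep0 : pi 0 = 0.
Proof. by apply: (addIr (pi 0)); rewrite -repD !add0r. Qed.

Lemma repZ a f : pi (a *: f) = a *: pi f.
Proof.
have [pilin _ _] := pi_rep.
by rewrite -[_ *: f]addr0 pilin rep0 addr0.
Qed.

Lemma rep1 : pi 1 = 1.
Proof. by have [_ [] ] := pi_rep. Qed.

Lemma rep_sum (I : Type) (r : seq I) (P : pred I) (F : I -> fbAlg B) :
  pi (\sum_(i <- r | P i) F i) = \sum_(i <- r | P i) pi (F i).
Proof. by elim/big_rec2 : _ => [|i a b _ <-]; rewrite ?rep0// repD. Qed.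

End Representation.

Section DilationImpliesCC.
Variables (R : realType) (N : nat) (B : finite_blaschke R N) (H K : hilbertType R).
Variables (pi : fbAlg B -> bop H) (iota : {linear H -> K}) (U : bop K).
Local Notation C := (cplx R).
Hypothesis pi_rep : unital_rep pi.
Hypothesis iota_isom : forall x y : H, inner (iota x) (iota y) = inner x y.
Hypothesis U_unitary : unitary_op U.
Hypothesis piE : forall (j : nat) (h : H),
  iota (pi (zjB B j) h) = orth_proj (range iota) ((U ^+ j * fb_op B U) (iota h)).

Let iotaN := isometry_nrm iota_isom.

Let UI := unitary_isom U_unitary.

Lemma pi_fbpoly_compression c p h m :
  inner (c *: iota h + pact U p (fb_op B U (iota h)) - iota (pi (fbpoly B c p) h))
    (iota m) = 0.
Proof.
rewrite /fbpoly (repD pi_rep) (repZ pi_rep) (rep1 pi_rep) (rep_sum pi_rep) bopDE (bopZE c 1) bop1E bop_sumE.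
have -> : iota (c *: h + \sum_(i < size p) pi (p`_i *: zjB B i) h) =
  c *: iota h + \sum_(i < size p) p`_i *: iota (pi (zjB B i) h).
  rewrite linearD linearZ raddf_sum; congr (_ + _); apply: eq_bigr => i _.
  by rewrite (repZ pi_rep) bopZE /= linearZ.
rewrite opprD addrACA subrr add0r /pact -sumrB inner_suml big1// => i _.
rewrite -scalerBr innerZl.
have [h' [hP hO]] := orth_proj_range iota_isom ((U ^+ i * fb_op B U) (iota h)).
by rewrite piE hP -bopXE -bopME hO mulr0.
Qed.

Lemma compression_norm (x : K) (h : H) :
  (forall m, inner (x - iota h) (iota m) = 0) -> nrm h ^+ 2 <= nrm x ^+ 2.
Proof.
move=> o; rewrite -(subrK (iota h) x) nrm_sqrD o re0 mulr0 addr0 iotaN.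
by rewrite lerDr sqr_ge0.
Qed.

(** Writing [iota (h j) = q(U) (y j)], where [q] is the denominator of [B], turns
    the compressed operators into polynomials in [U] applied to [y]. *)
Lemma pi_poly_bound r (c : 'I_r -> 'I_r -> C) (p : 'I_r -> 'I_r -> {poly C}) (M : R) :
  0 <= M ->
  (forall (z : cdisk R) (v : 'I_r -> C),
    \sum_i nrm (\sum_j fbpoly B (c i j) (p i j) z * v j) ^+ 2 <=
      M * \sum_j nrm (v j) ^+ 2) ->
  forall h : 'I_r -> H,
    \sum_i nrm (\sum_j pi (fbpoly B (c i j) (p i j)) (h j)) ^+ 2 <=
      M * \sum_j nrm (h j) ^+ 2.
Proof.
move=> M0 FM h.
have /choice[y yh] j := fb_den_surj B UI (iota (h j)).
pose G i j : {poly C} := (c i j)%:P * fb_den B + p i j * fb_num B.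
have := @isometry_poly_bound R K U r G (fb_den B) M UI M0.
have -> : \sum_j nrm (h j) ^+ 2 = \sum_j nrm (pact U (fb_den B) (y j)) ^+ 2.
  by apply: eq_bigr => j _; rewrite yh iotaN.
move=> E; apply: le_trans (E _ y).
  apply: ler_sum => i _; apply: compression_norm => m.
  rewrite raddf_sum -sumrB inner_suml big1// => j _.
  rewrite /G pactD (pactM U (c i j)%:P) (pactM U (p i j)) pactC -(fb_op_den B UI) yh.
  exact: pi_fbpoly_compression.
move=> z v z1; have z1' : (`|z| : C) <= 1 by rewrite normC1_nrm z1.
have GE i j : (G i j).[z] = (fb_den B).[z] * fbpoly B (c i j) (p i j) (exist _ z z1').
  rewrite fbpolyE /= /G hornerD (hornerM (c i j)%:P) (hornerM (p i j)) hornerC -fb_fun_horner ?z1//; ring.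
have -> : \sum_i nrm (\sum_j (G i j).[z] * v j) ^+ 2 = nrm (fb_den B).[z] ^+ 2 *
    \sum_i nrm (\sum_j fbpoly B (c i j) (p i j) (exist _ z z1') * v j) ^+ 2.
  rewrite mulr_sumr; apply: eq_bigr => i _; rewrite -exprMn -nrmM mulr_sumr.
  by congr (nrm _ ^+ 2); apply: eq_bigr => j _; rewrite GE mulrA.
rewrite [M * _]mulrC -[X in _ <= X]mulrA.
exact: ler_wpM2l (sqr_ge0 _) _ _ (FM (exist _ z z1') v).
Qed.

(** Polynomials are dense in the disk algebra and [pi] is bounded, so the bound
    for polynomial matrices passes to all of them. *)
Lemma dilation_completely_contractive : completely_contractive pi.
Proof.
move=> r _ F; have [_ _ [Mp pib]] := pi_rep.
set S := mx_supnorm F.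
have piB f g x : (pi f - pi g) x = pi (f - g) x.
  have -> : f - g = (-1) *: g + f by rewrite scaleN1r addrC.
  by rewrite (repD pi_rep) (repZ pi_rep) scaleN1r addrC.
have S0 : 0 <= S by have [] := mx_supnorm_bound F (cdisk0 R) (fun=> 0).
apply: mx_opnorm_le => // [i j|h]; first by rewrite raddf0.
pose Y := \sum_j nrm (h j) ^+ 2; rewrite -/Y; have Y0 : 0 <= Y by apply: sumr_ge0 => j _; rewrite sqr_ge0.
pose k := `|Mp|; have k0 : 0 <= k by exact: normr_ge0.
pose r3 : R := r%:R * r%:R * r%:R.
have r30 : 0 <= r3 by rewrite !mulr_ge0.
have step (d : R) : 0 < d -> d <= 1 ->
    \sum_i nrm (\sum_j map_mx pi F i j (h j)) ^+ 2 <= (S ^+ 2 + d * (3 * S ^+ 2 + 3)) * Y.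
  move=> d0 d1; have S2 : 0 <= S ^+ 2 by rewrite sqr_ge0.
  have dV0 : 0 < d^-1 by rewrite invr_gt0.
  pose A := (1 + d^-1) * r3 * (1 + k ^+ 2).
  have k2 : 0 <= k ^+ 2 by rewrite sqr_ge0.
  have A0 : 0 <= A by rewrite !mulr_ge0 ?addr_ge0// ltW.
  (* The approximation error [e] is taken so small that the terms carrying the
     large factor [1 + d^-1] stay below [d]. *)
  pose e := Num.min 1 (d / (A + 1)).
  have e0 : 0 < e by rewrite lt_min ltr01 divr_gt0//; lra.
  have e1 : e <= 1 by rewrite ge_min lexx.
  have Ae : A * e ^+ 2 <= d.
    apply: (@le_trans _ _ (A * (d / (A + 1)))).
      rewrite ler_wpM2l// (@le_trans _ _ e) ?ge_min ?lexx ?orbT//.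
      by rewrite expr2 ler_piMr// ltW.
    by rewrite mulrCA ler_piMr ?(ltW d0)// ler_pdivrMr ?mul1r; lra.
  have AE : A * e ^+ 2 =
      (1 + d^-1) * (r3 * e ^+ 2) + (1 + d^-1) * (r3 * (k * e) ^+ 2).
    by rewrite /A; ring.
  have nn (x : R) : 0 <= (1 + d^-1) * (r3 * x ^+ 2).
    by rewrite mulr_ge0 ?addr_ge0 ?(ltW dV0)// mulr_ge0 ?sqr_ge0.
  have nn1 := nn e; have nn2 := nn (k * e).
  have Ae1 : (1 + d^-1) * (r3 * e ^+ 2) <= d by lra.
  have Ae2 : (1 + d^-1) * (r3 * (k * e) ^+ 2) <= d by lra.
  have /choice[c /choice[p Hcp]] (ij : 'I_r * 'I_r) := fbpoly_approx (F ij.1 ij.2) e0.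
  pose F' i j := fbpoly B (c (i, j)) (p (i, j)).
  have FF' i j z : nrm (F i j z - F' i j z) <= e := Hcp (i, j) z.
  pose M := (1 + d) * S ^+ 2 + d.
  have M0 : 0 <= M by rewrite addr_ge0 ?mulr_ge0 ?(ltW d0)//; lra.
  have H1 (z : cdisk R) (v : 'I_r -> C) :
      \sum_i nrm (\sum_j F' i j z * v j) ^+ 2 <= M * \sum_j nrm (v j) ^+ 2.
    set V := \sum_j nrm (v j) ^+ 2.
    have V0 : 0 <= V by apply: sumr_ge0 => j _; rewrite sqr_ge0.
    have b1 := (mx_supnorm_bound F z v).2.
    have := @entry_bound R C r (fun i j x => (F' i j z - F i j z) * x) e (ltW e0) _ v.
    move=> b2; have {}b2 := b2 (fun i j x => _).
    have -> : \sum_i nrm (\sum_j F' i j z * v j) ^+ 2 =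
      \sum_i nrm (\sum_j F i j z * v j + \sum_j (F' i j z - F i j z) * v j) ^+ 2.
      apply: eq_bigr => i _; rewrite -big_split; congr (nrm _ ^+ 2).
      by apply: eq_bigr => j _ /=; ring.
    apply: le_trans (ler_sum _ (fun i _ => nrm_sqr_addW _ _ d0)) _.
    rewrite big_split -!mulr_sumr /=.
    have {}b2 : \sum_i nrm (\sum_j (F' i j z - F i j z) * v j) ^+ 2 <= r3 * e ^+ 2 * V.
      by apply: b2 => i j x; rewrite nrmM ler_wpM2r ?nrm_ge0// nrmB FF'.
    have c1 : (1 + d) * \sum_i nrm (\sum_j F i j z * v j) ^+ 2 <= (1 + d) * (S ^+ 2 * V).
      by rewrite ler_wpM2l//; lra.
    have c2 : (1 + d^-1) * \sum_i nrm (\sum_j (F' i j z - F i j z) * v j) ^+ 2 <= d * V.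
      apply: (@le_trans _ _ ((1 + d^-1) * (r3 * e ^+ 2 * V))).
        by rewrite ler_wpM2l ?addr_ge0 ?(ltW dV0).
      by rewrite mulrA ler_wpM2r.
    apply: (le_trans (lerD c1 c2)); rewrite /M; lra.
  have H2 := pi_poly_bound M0 H1 h.
  have H3 : \sum_i nrm (\sum_j (pi (F i j) - pi (F' i j)) (h j)) ^+ 2 <=
      r3 * (k * e) ^+ 2 * Y.
    have ke0 : 0 <= k * e by rewrite mulr_ge0// ltW.
    apply: (@entry_bound R H r (fun i j x => (pi (F i j) - pi (F' i j)) x) (k * e) ke0 _ h).
    move=> i j x; rewrite piB (le_trans (opnorm_bound _ _))// ler_wpM2r ?nrm_ge0//.
    apply: (le_trans (pib _)); apply: (@le_trans _ _ (k * supnorm (F i j - F' i j))).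
      rewrite ler_wpM2r ?ler_norm//.
      apply: le_trans (ub_le_sup _ _); last by exists (cdisk0 R).
        exact: nrm_ge0.
      exists e => _ [z _ <-]; exact: FF'.
    by rewrite ler_wpM2l//; apply: supnorm_le => z; exact: FF'.
  have -> : \sum_i nrm (\sum_j map_mx pi F i j (h j)) ^+ 2 =
      \sum_i nrm (\sum_j pi (F' i j) (h j) +
        \sum_j (pi (F i j) - pi (F' i j)) (h j)) ^+ 2.
    apply: eq_bigr => i _; rewrite -big_split; congr (nrm _ ^+ 2).
    by apply: eq_bigr => j _; rewrite mxE bopDE bopNE /= addrC subrK.
  apply: le_trans (ler_sum _ (fun i _ => nrm_sqr_addW _ _ d0)) _.
  rewrite big_split -!mulr_sumr /=.
  have c1 : (1 + d) * \sum_i nrm (\sum_j pi (F' i j) (h j)) ^+ 2 <= (1 + d) * (M * Y).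
    by rewrite ler_wpM2l//; lra.
  have c2 : (1 + d^-1) * \sum_i nrm (\sum_j (pi (F i j) - pi (F' i j)) (h j)) ^+ 2 <= d * Y.
    apply: (@le_trans _ _ ((1 + d^-1) * (r3 * (k * e) ^+ 2 * Y))).
      by rewrite ler_wpM2l ?addr_ge0 ?(ltW dV0).
    by rewrite mulrA ler_wpM2r.
  apply: (le_trans (lerD c1 c2)); rewrite mulrA -mulrDl ler_wpM2r// /M.
  have d2 : d * d <= d by rewrite ler_piMr// ltW.
  have d3 : d * d * S ^+ 2 <= d * S ^+ 2 by rewrite ler_wpM2r.
  rewrite -subr_ge0.
  have -> : S ^+ 2 + d * (3 * S ^+ 2 + 3) - ((1 + d) * ((1 + d) * S ^+ 2 + d) + d) =
    (d * S ^+ 2 - d * d * S ^+ 2) + (d - d * d) by ring.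
  by rewrite addr_ge0// subr_ge0.
apply/ler_addgt0Pr => e e0.
have S2 : 0 <= S ^+ 2 by rewrite sqr_ge0.
pose c := (3 * S ^+ 2 + 3) * Y.
have c0 : 0 <= c by rewrite mulr_ge0//; lra.
pose d := Num.min 1 (e / (c + 1)).
have d0 : 0 < d by rewrite lt_min ltr01 divr_gt0//; lra.
have d1 : d <= 1 by rewrite ge_min lexx.
apply: (le_trans (step d d0 d1)); rewrite mulrDl lerD2l -mulrA -/c.
apply: (@le_trans _ _ (e / (c + 1) * c)).
  by rewrite ler_wpM2r// ge_min lexx orbT.
by rewrite -mulrA ler_piMr ?(ltW e0)// ler_pdivrMl ?mulr1; lra.
Qed.

End DilationImpliesCC.

(** * The Hilbert space of bounded functionals of a semi-inner product *)

(** Real part of a semi-inner product on a complex vector space. *)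
Record semiform (R : realType) (E : lmodType (cplx R)) := Semiform {
  sform :> E -> E -> R;
  sformDl : forall x y z, sform (x + y) z = sform x z + sform y z;
  sformRl : forall (t : R) x z, sform (ofR t *: x) z = t * sform x z;
  sformC : forall x y, sform x y = sform y x;
  sform_ge0 : forall x, 0 <= sform x x;
  sform_adj : forall (a : cplx R) x y, sform (a *: x) y = sform x (Num.conj a *: y)
}.

Section DualHilbert.
Variables (R : realType) (E : lmodType (cplx R)) (rho : semiform E).
Local Notation C := (cplx R).
Implicit Types (e g : E).

Lemma sformDr z x y : rho z (x + y) = rho z x + rho z y.
Proof. by rewrite sformC sformDl !(sformC rho _ z). Qed.

Lemma sformRr (t : R) z x : rho z (ofR t *: x) = t * rho z x.
Proof. by rewrite sformC sformRl (sformC rho _ z). Qed.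

Lemma sformNl x z : rho (- x) z = - rho x z.
Proof.
rewrite -scaleN1r (_ : -1 = ofR (-1) :> C) ?sformRl ?mulN1r//.
by apply: cplxP; rewrite !cE ?oppr0.
Qed.

Lemma sformNr z x : rho z (- x) = - rho z x.
Proof. by rewrite sformC sformNl (sformC rho _ z). Qed.

Lemma sformZ (a : C) x : rho (a *: x) (a *: x) = nrm a ^+ 2 * rho x x.
Proof. by rewrite sform_adj scalerA mulrC mulCconj sformRr. Qed.

Lemma sform_sqrD x y : rho (x + y) (x + y) = rho x x + 2 * rho x y + rho y y.
Proof. by rewrite sformDl !sformDr (sformC rho y x); ring. Qed.

Lemma sform_CS x y : rho x y ^+ 2 <= rho x x * rho y y.
Proof.
have x0 := sform_ge0 rho x; have y0 := sform_ge0 rho y.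
have q (t : R) : 0 <= rho x x + 2 * t * rho x y + t ^+ 2 * rho y y.
  have := sform_ge0 rho (x + ofR t *: y).
  by rewrite sform_sqrD !sformRr sformRl; congr (_ <= _); ring.
have [y00|yn] := eqVneq (rho y y) 0.
  have [->|xy] := eqVneq (rho x y) 0; first by rewrite expr0n mulr_ge0.
  have := q (- (rho x x + 1) / (2 * rho x y)).
  rewrite y00 mulr0 addr0.
  have -> : 2 * (- (rho x x + 1) / (2 * rho x y)) * rho x y = - (rho x x + 1).
    by field.
  lra.
have yp : 0 < rho y y by rewrite lt_def yn.
have := q (- rho x y / rho y y).
have -> : rho x x + 2 * (- rho x y / rho y y) * rho x y +
    (- rho x y / rho y y) ^+ 2 * rho y y =
  rho x x - rho x y ^+ 2 / rho y y by field.
by rewrite subr_ge0 ler_pdivrMr.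
Qed.

(** Bounded real-linear functionals. Such a functional is the real part of a
    unique bounded antilinear one, so they form a complex Hilbert space, the
    completion of [E]. *)
Definition is_dual : {pred E -> R} := fun l =>
  `[< (forall x y, l (x + y) = l x + l y) /\
      (forall (t : R) x, l (ofR t *: x) = t * l x) /\
      exists M : R, 0 <= M /\ forall x, l x ^+ 2 <= M * rho x x >].

Lemma sqr_add_le (a b : R) : (a - b) ^+ 2 <= 2 * a ^+ 2 + 2 * b ^+ 2.
Proof. by have := sqr_ge0 (a + b); lra. Qed.

Lemma is_dual_zmod_closed : zmod_closed is_dual.
Proof.
split.
  apply/asboolP; split; first by move=> x y /=; rewrite addr0.
  split; first by move=> t x /=; rewrite mulr0.
  by exists 0; split => // x; rewrite mul0r expr0n.
move=> l m /asboolP[lD [lZ [M [M0 lM]]]] /asboolP[mD [mZ [M' [M'0 mM]]]].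
apply/asboolP; split; first by move=> x y; rewrite !fctE lD mD; ring.
split; first by move=> t x; rewrite !fctE lZ mZ; ring.
exists (2 * M + 2 * M'); split; first by lra.
move=> x; rewrite !fctE; apply: (le_trans (sqr_add_le _ _)).
have := lM x; have := mM x; lra.
Qed.

HB.instance Definition _ := GRing.isZmodClosed.Build (E -> R) is_dual is_dual_zmod_closed.

Record dual := Dual { dual_fun :> E -> R; _ : dual_fun \in is_dual }.

HB.instance Definition _ := [isSub for dual_fun].
HB.instance Definition _ := [Choice of dual by <:].
HB.instance Definition _ := [SubChoice_isSubZmodule of dual by <:].

Implicit Types (l m k : dual).

Lemma dualP l m : (forall x, l x = m x) -> l = m.
Proof. by move=> lm; apply: val_inj; apply/funext. Qed.

Lemma dualD l x y : l (x + y) = l x + l y.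
Proof. by case: l => l /= /asboolP[]. Qed.

Lemma dualR l (t : R) x : l (ofR t *: x) = t * l x.
Proof. by case: l => l /= /asboolP[_ []]. Qed.

Lemma dualN l x : l (- x) = - l x.
Proof.
rewrite -scaleN1r (_ : -1 = ofR (-1) :> C) ?dualR ?mulN1r//.
by apply: cplxP; rewrite !cE ?oppr0.
Qed.

Lemma dual_scale_subproof (a : C) l : (fun x => l (Num.conj a *: x)) \in is_dual.
Proof.
apply/asboolP; split; first by move=> x y; rewrite scalerDr dualD.
split; first by move=> t x; rewrite scalerA mulrC -scalerA dualR.
case: l => l /= /asboolP[_ [_ [M [M0 lM]]]].
exists (M * nrm a ^+ 2); split; first by rewrite mulr_ge0// sqr_ge0.
by move=> x; rewrite (le_trans (lM _))// sformZ nrm_conj mulrA.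
Qed.

Definition dual_scale (a : C) l : dual := Dual (dual_scale_subproof a l).

Lemma dual_scaleA a b l : dual_scale a (dual_scale b l) = dual_scale (a * b) l.
Proof. by apply: dualP => x /=; rewrite scalerA rmorphM mulrC. Qed.

Lemma dual_scale1 : left_id 1 dual_scale.
Proof. by move=> l; apply: dualP => x /=; rewrite rmorph1 scale1r. Qed.

Lemma dual_scaleDr : right_distributive dual_scale +%R.
Proof. by move=> a l m; apply: dualP. Qed.

Lemma dual_scaleDl l : {morph dual_scale^~ l : a b / a + b}.
Proof.
move=> a b; apply: dualP => x /=; rewrite rmorphD scalerDl dualD; exact: erefl.
Qed.

HB.instance Definition _ := GRing.Zmodule_isLmodule.Build C dual
  dual_scaleA dual_scale1 dual_scaleDr dual_scaleDl.

Lemma dualZE (a : C) l x : (a *: l) x = l (Num.conj a *: x). Proof. by []. Qed.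
Lemma dualDE l m x : (l + m) x = l x + m x. Proof. by []. Qed.
Lemma dualNE l x : (- l) x = - l x. Proof. by []. Qed.
Lemma dual0E x : (0 : dual) x = 0. Proof. by []. Qed.

(** The squared norm, in variational form: this is what makes the parallelogram
    law and the reproducing property mere changes of variables. *)
Definition dsq l : R := sup [set 2 * l g - rho g g | g in [set: E]].

Lemma dsq_has_sup l : has_sup [set 2 * l g - rho g g | g in [set: E]].
Proof.
split; first by exists (2 * l 0 - rho 0 0), 0.
case: l => l /= /asboolP[lD [lZ [M [M0 lM]]]].
exists (M + 1) => _ [g _ <-].
have g0 := sform_ge0 rho g; have h := lM g.
have := sqr_ge0 (M - rho g g).
have [|lt] := leP (l g) 0; first by move=> *; lra.
have : (l g - 1) ^+ 2 + (l g) ^+ 2 >= 0 by rewrite addr_ge0// sqr_ge0.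
have [lg|lg] := leP (2 * l g) (M + 1 + rho g g); first by move=> *; lra.
nra.
Qed.

Lemma dsq_ub l g : 2 * l g - rho g g <= dsq l.
Proof. by apply: ub_le_sup; [exact: (dsq_has_sup l).2|exists g]. Qed.

Lemma dsq_le l (c : R) : (forall g, 2 * l g - rho g g <= c) -> dsq l <= c.
Proof. by move=> lc; apply: ge_sup => [|_ [g _ <-]//]; exact: (dsq_has_sup l).1. Qed.

Lemma dsq_ge0 l : 0 <= dsq l.
Proof.
have := dsq_ub l (ofR 0 *: 0); rewrite dualR sformRl !mul0r mulr0 subr0; exact.
Qed.

Lemma dsq_bound l g : l g ^+ 2 <= dsq l * rho g g.
Proof.
have g0 := sform_ge0 rho g; have V0 := dsq_ge0 l.
have q (t : R) : 2 * t * l g - t ^+ 2 * rho g g <= dsq l.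
  have := dsq_ub l (ofR t *: g); rewrite dualR sformRl sformRr.
  by congr (_ <= _); ring.
have [g00|gn] := eqVneq (rho g g) 0.
  have [->|xy] := eqVneq (l g) 0; first by rewrite expr0n mulr_ge0.
  have := q ((dsq l + 1) / (2 * l g)).
  rewrite g00 mulr0 subr0.
  have -> : 2 * ((dsq l + 1) / (2 * l g)) * l g = dsq l + 1 by field.
  lra.
have gp : 0 < rho g g by rewrite lt_def gn.
have := q (l g / rho g g).
have -> : 2 * (l g / rho g g) * l g - (l g / rho g g) ^+ 2 * rho g g =
  l g ^+ 2 / rho g g by field.
by rewrite ler_pdivrMr.
Qed.

Lemma dsq_le_bound l (M : R) : 0 <= M -> (forall g, l g ^+ 2 <= M * rho g g) ->
  dsq l <= M.
Proof.
move=> M0 lM; apply: dsq_le => g; have g0 := sform_ge0 rho g; have h := lM g.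
have h2 := sqr_ge0 (M - rho g g).
have [l0|l0] := leP (2 * l g) (M + rho g g); first by lra.
exfalso; have : (M + rho g g) ^+ 2 < (2 * l g) ^+ 2.
  by rewrite ltrXn2r ?nnegrE ?addr_ge0//; lra.
lra.
Qed.

Lemma dsq_double l : 4 * dsq l <= dsq (l + l).
Proof.
rewrite -ler_pdivlMl//; apply: dsq_le => g; rewrite ler_pdivlMl//.
have := dsq_ub (l + l) (g + g).
by rewrite dualDE dualD sform_sqrD; congr (_ <= _); ring.
Qed.

(** The values of the two suprema at [g] and [g'] are values of the suprema for
    [l] and [m] at half the sum and half the difference. *)
Lemma dsq_parallelogram_le l m : dsq (l + m) + dsq (l - m) <= 2 * (dsq l + dsq m).
Proof.
rewrite -lerBrDr; apply: dsq_le => g; rewrite lerBrDr -lerBrDl.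
apply: dsq_le => g'; rewrite lerBrDl.
have := dsq_ub l (ofR 2^-1 *: (g + g')); have := dsq_ub m (ofR 2^-1 *: (g - g')).
rewrite !dualDE !dualNE !dualR !dualD !dualN !sformRl !sformRr !sform_sqrD.
rewrite !sformNl !sformNr; lra.
Qed.

Lemma dsq_parallelogram l m : dsq (l + m) + dsq (l - m) = 2 * (dsq l + dsq m).
Proof.
apply/eqP; rewrite eq_le dsq_parallelogram_le /=.
have := dsq_parallelogram_le (l + m) (l - m).
have -> : l + m + (l - m) = l + l by rewrite addrACA subrr addr0.
have -> : l + m - (l - m) = m + m by rewrite opprB addrC addrA subrK.
have := dsq_double l; have := dsq_double m; lra.
Qed.

Lemma riesz_subproof e : rho e \in is_dual.
Proof.
apply/asboolP; split; first by move=> x y; rewrite sformDr.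
split; first by move=> t x; rewrite sformRr.
by exists (rho e e); split; [exact: sform_ge0|exact: sform_CS].
Qed.

Definition riesz e : dual := Dual (riesz_subproof e).

Lemma rieszE e g : riesz e g = rho e g. Proof. by []. Qed.

Lemma riesz_linear : linear riesz.
Proof.
move=> a x y; apply: dualP => g.
by rewrite dualDE dualZE !rieszE sformDl sform_adj.
Qed.

HB.instance Definition _ := GRing.isLinear.Build C E dual _ riesz riesz_linear.

Lemma rieszZ (a : C) e : riesz (a *: e) = a *: riesz e.
Proof. exact: linearZ. Qed.

Lemma dsq_add_riesz l e : dsq (l + riesz e) = dsq l + 2 * l e + rho e e.
Proof.
apply/eqP; rewrite eq_le; apply/andP; split.
  apply: dsq_le => g; have := dsq_ub l (g - e).
  rewrite dualD dualN sform_sqrD sformNl !sformNr dualDE rieszE (sformC rho e g); lra.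
rewrite -addrA -lerBrDr; apply: dsq_le => g; rewrite lerBrDr.
have := dsq_ub (l + riesz e) (g + e).
rewrite dualDE dualD sform_sqrD rieszE sformDr (sformC rho e g); lra.
Qed.

Lemma dsq0 : dsq 0 = 0.
Proof.
apply/eqP; rewrite eq_le dsq_ge0 andbT; apply: dsq_le_bound => // g.
by rewrite dual0E expr0n mul0r.
Qed.

Lemma dsqZ_le (a : C) l : dsq (a *: l) <= nrm a ^+ 2 * dsq l.
Proof.
apply: dsq_le_bound => [|g]; first by rewrite mulr_ge0 ?sqr_ge0// dsq_ge0.
rewrite dualZE (le_trans (dsq_bound _ _))// sformZ nrm_conj.
by rewrite mulrCA mulrA.
Qed.

Lemma dsqZ (a : C) l : dsq (a *: l) = nrm a ^+ 2 * dsq l.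
Proof.
apply/eqP; rewrite eq_le dsqZ_le /=.
have [->|a0] := eqVneq a 0.
  by rewrite nrm0 expr0n mul0r dsq_ge0.
have na : 0 < nrm a ^+ 2 by rewrite exprn_gt0// nrm_gt0.
have := dsqZ_le a^-1 (a *: l); rewrite scalerA mulVf// scale1r nrmV exprVn.
by rewrite -ler_pdivlMl ?invr_gt0// invrK.
Qed.

Definition dnorm l : R := Num.sqrt (dsq l).

Lemma dnorm_ge0 l : 0 <= dnorm l. Proof. exact: sqrtr_ge0. Qed.

Lemma sqr_dnorm l : dnorm l ^+ 2 = dsq l. Proof. by rewrite sqr_sqrtr// dsq_ge0. Qed.

Lemma dnorm_bound l g : `|l g| <= dnorm l * Num.sqrt (rho g g).
Proof.
rewrite -ler_sqr ?nnegrE ?mulr_ge0 ?sqrtr_ge0// real_normK ?num_real//.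
by rewrite exprMn sqr_dnorm sqr_sqrtr ?sform_ge0// dsq_bound.
Qed.

Lemma dnorm_le l (c : R) : 0 <= c ->
  (forall g, `|l g| <= c * Num.sqrt (rho g g)) -> dnorm l <= c.
Proof.
move=> c0 lc; rewrite -ler_sqr ?nnegrE ?dnorm_ge0// sqr_dnorm.
apply: dsq_le_bound => [|g]; first by rewrite sqr_ge0.
have := lc g; rewrite -ler_sqr ?nnegrE ?mulr_ge0 ?sqrtr_ge0//.
by rewrite real_normK ?num_real// exprMn sqr_sqrtr ?sform_ge0.
Qed.

Lemma dnormD l m : dnorm (l + m) <= dnorm l + dnorm m.
Proof.
apply: dnorm_le => [|g]; first by rewrite addr_ge0 ?dnorm_ge0.
rewrite dualDE (le_trans (ler_normD _ _))// mulrDl lerD//; exact: dnorm_bound.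
Qed.

Lemma dnormZ (a : C) l : dnorm (a *: l) = nrm a * dnorm l.
Proof.
apply/eqP; rewrite -(@eqrXn2 _ 2)// ?mulr_ge0 ?nrm_ge0 ?dnorm_ge0//.
by rewrite exprMn !sqr_dnorm dsqZ.
Qed.

Lemma dnorm_eq0 l : dnorm l = 0 -> l = 0.
Proof.
move=> l0; apply: dualP => g; have := dnorm_bound l g.
by rewrite l0 mul0r normr_le0 => /eqP.
Qed.

Definition dnormC l : C := ofR (dnorm l).

Lemma dnormC_D l m : dnormC (l + m) <= dnormC l + dnormC m.
Proof. by rewrite -ofRD lecR dnormD. Qed.

Lemma dnormC_Z (a : C) l : dnormC (a *: l) = `|a| * dnormC l.
Proof. by rewrite /dnormC dnormZ ofRM nrmE. Qed.

Lemma dnormC_eq0 l : dnormC l = 0 -> l = 0.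
Proof. by move=> /(congr1 (@re R)); rewrite re_ofR => h; apply: dnorm_eq0. Qed.

HB.instance Definition _ := Lmodule_isNormed.Build C dual
  dnormC_D dnormC_Z dnormC_eq0.

Lemma nrm_dual l : nrm l = dnorm l. Proof. by []. Qed.

(** Evaluations are Lipschitz, so a Cauchy filter has a pointwise limit. *)
Lemma dual_complete (F : set_system dual) : ProperFilter F -> cauchy F -> cvg F.
Proof.
move=> FF /cauchyP FC.
have ex (e : R) : 0 < e -> exists l, F [set m | nrm (l - m) < e].
  move=> e0; have [|l Hl] := FC (ofR e); first by rewrite ltcR.
  exists l; apply: filterS Hl => m; rewrite -ball_normE /=.
  by rewrite normr_lt_nrm.
have lim g : exists c : R, forall e : R, 0 < e -> F [set l | `|l g - c| <= e].
  have s0 : 0 < Num.sqrt (rho g g) + 1 by rewrite ltr_wpDl ?sqrtr_ge0.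
  have : cauchy ((fun l : dual => l g) @ F).
    apply: cauchy_exP => e e0.
    have [l Hl] := ex (e / (Num.sqrt (rho g g) + 1)) (divr_gt0 e0 s0).
    exists (l g); suff : F [set m : dual | `|l g - m g| < e] by [].
    apply: filterS Hl => m /= h; apply: (le_lt_trans (dnorm_bound (l - m) g)).
    rewrite ltr_pdivlMr// nrm_dual in h; apply: le_lt_trans h.
    by rewrite ler_wpM2l ?dnorm_ge0// lerDl.
  move=> /cauchy_cvg/cvg_ex[c lc]; exists c => e e0.
  have /cvgrPdist_le/(_ e e0) := lc.
  by apply: filterS => l /=; rewrite distrC.
have {lim}[L HL] := choice lim.
have L_uniq g (c : R) : (forall e : R, 0 < e -> F [set l | `|l g - c| <= e]) -> c = L g.
  move=> Hc; apply/eqP; rewrite -subr_eq0 -normr_le0; apply/ler_addgt0Pr => e e0.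
  have e2 : 0 < e / 2 by rewrite divr_gt0.
  have [l [/= h1 h2]] := filter_ex (filterI (Hc _ e2) (HL g _ e2)).
  rewrite add0r (splitr e) (le_trans (ler_distD (l g) _ _))// lerD//.
  by rewrite distrC.
have LD x y : L (x + y) = L x + L y.
  apply/esym/L_uniq => e e0; have e2 : 0 < e / 2 by rewrite divr_gt0.
  apply: filterS (filterI (HL x _ e2) (HL y _ e2)) => l [/= h1 h2].
  rewrite dualD (_ : _ - _ = (l x - L x) + (l y - L y)); last by ring.
  by rewrite (le_trans (ler_normD _ _))// (splitr e) lerD.
have LR (t : R) x : L (ofR t *: x) = t * L x.
  apply/esym/L_uniq => e e0; have t0 : 0 < `|t| + 1 by rewrite ltr_wpDl.
  apply: filterS (HL x _ (divr_gt0 e0 t0)) => l /= h.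
  rewrite dualR -mulrBr normrM; rewrite ler_pdivlMr// in h; apply: le_trans h.
  by rewrite mulrC ler_wpM2l// lerDl.
have dist (e : R) l : 0 < e -> F [set m | nrm (l - m) < e] ->
    forall g, `|l g - L g| <= e * Num.sqrt (rho g g).
  move=> e0 Fl g; apply/ler_addgt0Pr => e' e'0.
  have [m [/= h1 h2]] := filter_ex (filterI Fl (HL g _ e'0)).
  rewrite (le_trans (ler_distD (m g) _ _))// lerD//.
  apply: (le_trans (dnorm_bound (l - m) g)); rewrite ler_wpM2r ?sqrtr_ge0//.
  exact: ltW.
have [l1 Hl1] := ex 1 ltr01.
have Ldual : L \in is_dual.
  apply/asboolP; split=> //; split=> //; exists (2 * dsq l1 + 2); split.
    by have := dsq_ge0 l1; lra.
  move=> g; have := dist _ _ ltr01 Hl1 g; rewrite mul1r.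
  rewrite -ler_sqr ?nnegrE ?sqrtr_ge0// real_normK ?num_real// sqr_sqrtr ?sform_ge0// => h.
  have -> : L g = l1 g - (l1 g - L g) by ring.
  apply: (le_trans (sqr_add_le _ _)); have := dsq_bound l1 g; lra.
apply/cvg_ex; exists (Dual Ldual); apply/cvgrPdist_lt => _ /posC_ofR[e e0 ->].
have re0 : 0 < e / 2 by rewrite divr_gt0.
have [l Hl] := ex _ re0.
have Hl2 := Hl; apply: filterS Hl => m /= h; rewrite normr_lt_nrm.
have -> : Dual Ldual - m = (Dual Ldual - l) + (l - m) by rewrite addrA subrK.
rewrite (le_lt_trans (nrm_le_add _ _))// (splitr e); apply: ler_ltD => //.
rewrite nrmB; apply: dnorm_le; first exact: ltW.
by move=> g; exact: (dist _ _ re0 Hl2 g).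
Qed.

HB.instance Definition _ := Uniform_isComplete.Build dual dual_complete.

(** Real part of the inner product, by polarization. *)
Definition dre l m : R := (dsq (l + m) - dsq (l - m)) / 4.

Lemma dsqN l : dsq (- l) = dsq l.
Proof. by rewrite -scaleN1r dsqZ nrmN nrm1 expr1n mul1r. Qed.

Lemma dreC l m : dre l m = dre m l.
Proof. by rewrite /dre (addrC l m) -[dsq (l - m)]dsqN opprB. Qed.

Lemma dreNr l m : dre l (- m) = - dre l m.
Proof. by rewrite /dre opprK; field. Qed.

Lemma dre0r l : dre l 0 = 0.
Proof. by rewrite /dre addr0 subr0 subrr mul0r. Qed.

(** Two instances of the parallelogram law; the case [m = 0] then removes the
    factor, as in the Jordan-von Neumann theorem. *)
Lemma dreDl_double l m k : dre l k + dre m k = dre (l + m) (k + k) / 2.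
Proof.
have p1 := dsq_parallelogram (l + k) (m + k).
have p2 := dsq_parallelogram (l - k) (m - k).
have e1 : l + k + (m + k) = l + m + (k + k) by rewrite addrACA.
have e2 : l + k - (m + k) = l - m by rewrite opprD addrACA subrr addr0.
have e3 : l - k + (m - k) = l + m - (k + k) by rewrite addrACA opprD.
have e4 : l - k - (m - k) = l - m by rewrite opprB addrA subrK.
rewrite e1 e2 in p1; rewrite e3 e4 in p2; rewrite /dre; lra.
Qed.

Lemma dreDl l m k : dre (l + m) k = dre l k + dre m k.
Proof.
have := dreDl_double (l + m) 0 k; rewrite addr0 [dre 0 k]dreC dre0r addr0 => ->.
by rewrite -dreDl_double.
Qed.

Lemma dreDr k l m : dre k (l + m) = dre k l + dre k m.
Proof. by rewrite dreC dreDl !(dreC k). Qed.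

Lemma dre_self l : dre l l = dsq l.
Proof.
have := dsq_parallelogram l l; rewrite /dre subrr dsq0; lra.
Qed.

Lemma dre_riesz l e : dre l (riesz e) = l e.
Proof.
rewrite /dre dsq_add_riesz.
have -> : l - riesz e = l + riesz (- e) by rewrite raddfN.
by rewrite dsq_add_riesz dualN sformNl sformNr; field.
Qed.

Lemma dre_CS l m : `|dre l m| <= dnorm l * dnorm m.
Proof.
have l0 := dnorm_ge0 l; have m0 := dnorm_ge0 m.
have up : dsq (l + m) <= (dnorm l + dnorm m) ^+ 2.
  by rewrite -sqr_dnorm lerXn2r ?nnegrE ?addr_ge0 ?dnorm_ge0 ?dnormD.
have := dsq_parallelogram l m; rewrite -(sqr_dnorm l) -(sqr_dnorm m) => P.
have up' : dsq (l - m) <= (dnorm l + dnorm m) ^+ 2.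
  rewrite -sqr_dnorm lerXn2r ?nnegrE ?addr_ge0 ?dnorm_ge0//.
  by rewrite (le_trans (dnormD _ _))// /dnorm dsqN.
rewrite ler_norml /dre; apply/andP; split; lra.
Qed.

(** The squared distance from [l] to [riesz g] is the amount by which [g] misses
    the supremum that defines [dsq l]. *)
Lemma riesz_dense l (d : R) : 0 < d -> exists e, dnorm (l - riesz e) <= d.
Proof.
move=> d0; have d2 : 0 < d ^+ 2 by rewrite exprn_gt0.
have [_ [g _ <-] gd] := sup_adherent d2 (dsq_has_sup l).
exists g; rewrite -ler_sqr ?nnegrE ?dnorm_ge0 ?(ltW d0)// sqr_dnorm.
have -> : l - riesz g = l + riesz (- g) by rewrite raddfN.
rewrite dsq_add_riesz dualN sformNl sformNr.
rewrite -/(dsq l) in gd; lra.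
Qed.

(** Against Riesz functionals [dre] is evaluation, so homogeneity is clear there,
    and it extends by density and the Cauchy-Schwarz inequality. *)
Lemma dre_ext l m (a : R) : (forall e, dre l (riesz e) = a * dre m (riesz e)) ->
  forall k, dre l k = a * dre m k.
Proof.
move=> lm k; apply/eqP; rewrite -subr_eq0 -normr_le0; apply/ler_addgt0Pr => d d0.
pose c := dnorm l + `|a| * dnorm m + 1.
have c0 : 0 < c by rewrite ltr_wpDl// addr_ge0 ?mulr_ge0 ?dnorm_ge0.
have [e He] := riesz_dense k (divr_gt0 d0 c0).
have kE x : dre x k = dre x (k - riesz e) + dre x (riesz e) by rewrite -dreDr subrK.
rewrite add0r !kE lm mulrDr opprD addrACA subrr addr0.
rewrite (le_trans (ler_normB _ _))// (normrM a).
rewrite (@le_trans _ _ (c * dnorm (k - riesz e)))//; last first.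
  by rewrite mulrC -ler_pdivlMr.
have := dre_CS l (k - riesz e).
have := ler_wpM2l (normr_ge0 a) (dre_CS m (k - riesz e)).
have := dnorm_ge0 (k - riesz e); rewrite /c; clear; lra.
Qed.

Lemma dreRl (t : R) l k : dre (ofR t *: l) k = t * dre l k.
Proof.
apply: dre_ext => e; rewrite !dre_riesz dualZE.
by rewrite (_ : Num.conj (ofR t) = ofR t :> C) ?dualR//; apply: cplxP; rewrite !cE ?oppr0.
Qed.

Lemma dre_iC l m : dre (iC R *: l) (iC R *: m) = dre l m.
Proof. by rewrite /dre -scalerDr -scalerBr !dsqZ nrm_iC expr1n !mul1r. Qed.

Lemma iC2 : iC R * iC R = -1.
Proof. by apply: cplxP; rewrite !cE; ring. Qed.

Lemma dre_iCl l m : dre (iC R *: l) m = - dre l (iC R *: m).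
Proof. by rewrite -[LHS]dre_iC scalerA iC2 scaleN1r dreC dreNr dreC. Qed.

Definition dinner l m : C := ofR (dre l m) + iC R * ofR (dre l (iC R *: m)).

Lemma dinnerC l m : dinner l m = Num.conj (dinner m l).
Proof.
apply: cplxP; rewrite /dinner !cE !(mul0r, mul1r, add0r, addr0, subr0, mulr0).
  exact: dreC.
by rewrite -dre_iCl dreC.
Qed.

Lemma dinnerDl l m k : dinner (l + m) k = dinner l k + dinner m k.
Proof.
rewrite /dinner (dreDl l) (dreDl l m (iC R *: k)).
move: (dre l k) (dre m k) (dre l _) (dre m _) => a b c d.
by rewrite !ofRD; ring.
Qed.

Lemma dinnerZl (a : C) l k : dinner (a *: l) k = a * dinner l k.
Proof.
have -> : a *: l = ofR (re a) *: l + ofR (im a) *: (iC R *: l).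
  by rewrite scalerA -scalerDl; congr (_ *: _); apply: cplxP; rewrite !cE; ring.
rewrite dinnerDl /dinner !dreRl dre_iCl dre_iC.
by apply: cplxP; rewrite !cE; ring.
Qed.

Lemma dinner_bilinear :
  bilinear_for (GRing.Scale.Law.clone _ _ ( *%R ) _)
   (GRing.Scale.Law.clone _ _ (@Num.conj C \; *%R ) _) dinner.
Proof.
split=> [m a l k|l a m k]; first by rewrite dinnerDl dinnerZl.
by rewrite (dinnerC l) dinnerDl dinnerZl rmorphD rmorphM (dinnerC l m) (dinnerC l k).
Qed.

HB.instance Definition _ := @bilinear_isBilinear.Build C dual dual C _ _ dinner dinner_bilinear.

Lemma dinner_herm l m : dinner l m = (-1) ^+ false * Num.conj (dinner m l).
Proof. by rewrite expr0 mul1r -dinnerC. Qed.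

HB.instance Definition _ := @isHermitianSesquilinear.Build C dual false
  (@Num.conj C) dinner dinner_herm.

Lemma dinner_self l : dinner l l = ofR (dsq l).
Proof.
have h : dre l (iC R *: l) = 0 by have := dre_iCl l l; rewrite dreC; lra.
by rewrite /dinner h dre_self; apply: cplxP; rewrite !cE; ring.
Qed.

Lemma dinner_gt0 l : l != 0 -> 0 < dinner l l.
Proof.
move=> l0; rewrite dinner_self ltcR lt_def dsq_ge0 andbT.
apply: contra l0 => /eqP h; apply/eqP; apply: dnorm_eq0.
by rewrite /dnorm h sqrtr0.
Qed.

HB.instance Definition _ := @isDotProduct.Build C dual dinner dinner_gt0.

Lemma dinner_norm l : `|l| ^+ 2 = dinner l l.
Proof.
rewrite dinner_self nrmE nrm_dual -sqr_dnorm.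
by apply: cplxP; rewrite !expr2 !cE; ring.
Qed.

HB.instance Definition _ := @isHilbert.Build R dual dinner dinner_norm.

End DualHilbert.

(** * Positive extension and positivity of completely contractive maps *)

(** M. Riesz's theorem, for functionals given by their graphs. Positivity alone
    makes a graph single-valued; a maximal one exists by Zorn's lemma, and at a
    new function [f] the supremum of the values below [f] is admissible. *)
Lemma riesz_extension (R : realType) (X : Type) (dom : set (X -> R))
    (D : set ((X -> R) * R)) :
  D (0, 0) ->
  (forall p q, D p -> D q -> D (p.1 + q.1, p.2 + q.2)) ->
  (forall (t : R) p, D p -> D ((fun x => t * p.1 x), t * p.2)) ->
  (forall p, D p -> (forall x, 0 <= p.1 x) -> 0 <= p.2) ->
  (forall f g, dom f -> dom g -> dom (f + g)) ->
  (forall (t : R) f, dom f -> dom (fun x => t * f x)) ->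
  (forall p, D p -> dom p.1) ->
  (forall f, dom f -> exists2 p, D p & forall x, f x <= p.1 x) ->
  exists phi : (X -> R) -> R,
    [/\ forall f g, dom f -> dom g -> phi (f + g) = phi f + phi g,
        forall (t : R) f, dom f -> phi (fun x => t * f x) = t * phi f,
        forall f, dom f -> (forall x, 0 <= f x) -> 0 <= phi f &
        forall p, D p -> phi p.1 = p.2].
Proof.
move=> D0 DD DZ Dpos domD domZ Ddom major.
pose good (L : set ((X -> R) * R)) :=
  [/\ forall p q, L p -> L q -> L (p.1 + q.1, p.2 + q.2),
      forall (t : R) p, L p -> L ((fun x => t * p.1 x), t * p.2),
      forall p, L p -> (forall x, 0 <= p.1 x) -> 0 <= p.2 &
      forall p, L p -> dom p.1].
have goodD : good D by [].
have [|A [gA maxA]] := @Zorn_bigcup _ (fun A => good (A `|` D)).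
  move=> F FP Ftot.
  have pick p q : (\bigcup_(A in F) A `|` D) p -> (\bigcup_(A in F) A `|` D) q ->
      exists L, [/\ good L, L p, L q & L `<=` \bigcup_(A in F) A `|` D].
    have sub A : F A -> A `|` D `<=` \bigcup_(A in F) A `|` D.
      by move=> FA x [Ax|Dx]; [left; exists A|right].
    move=> [[A FA Ap]|Dp] [[A' FA' Aq]|Dq].
    - have [AA'|A'A] := Ftot _ _ FA FA'.
        exists (A' `|` D); split; [exact: FP|by left; exact: AA'|by left|exact: sub].
      exists (A `|` D); split; [exact: FP|by left|by left; exact: A'A|exact: sub].
    - exists (A `|` D); split; [exact: FP|by left|by right|exact: sub].
    - exists (A' `|` D); split; [exact: FP|by right|by left|exact: sub].
    - by exists D; split => // x Dx; right.
  split.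
  - by move=> p q Up Uq; have [L [[LD _ _ _] Lp Lq sub]] := pick p q Up Uq; apply/sub/LD.
  - by move=> t p Up; have [L [[_ LZ _ _] Lp _ sub]] := pick p p Up Up; apply/sub/LZ.
  - by move=> p Up; have [L [[_ _ Lpos _] Lp _ _]] := pick p p Up Up; exact: Lpos.
  - by move=> p Up; have [L [[_ _ _ Ld] Lp _ _]] := pick p p Up Up; exact: Ld.
pose L := A `|` D; have [LD LZ Lpos Ldom] : good L := gA.
have DL : D `<=` L by move=> x Dx; right.
have Lle f g s t : L (f, s) -> L (g, t) -> (forall x, f x <= g x) -> s <= t.
  move=> Lf Lg fg; rewrite -subr_ge0.
  have := LD _ _ Lg (LZ (-1) _ Lf); rewrite /= mulN1r => h.
  by apply: (Lpos _ h) => x /=; rewrite fctE mulN1r subr_ge0.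
have Luniq f s t : L (f, s) -> L (f, t) -> s = t.
  by move=> Ls Lt; apply/eqP; rewrite eq_le (Lle _ _ _ _ Ls Lt)// (Lle _ _ _ _ Lt Ls).
have total f : dom f -> exists s, L (f, s).
  move=> df; apply: contrapT => nf.
  pose lo := [set s | exists2 g, L (g, s) & forall x, g x <= f x].
  have [[g1 s1] Dg1 fg1] := major _ df.
  have [[g2 s2] Dg2 fg2] := major _ (domZ (-1) _ df).
  have lo_ub g s : L (g, s) -> (forall x, f x <= g x) -> ubound lo s.
    move=> Lg fg s' [g' Lg' g'f]; apply: Lle Lg' Lg _ => x.
    exact: le_trans (g'f x) (fg x).
  have lo_sup : has_sup lo.
    split; last by exists s1; exact: lo_ub (DL _ Dg1) fg1.
    exists (-1 * s2), (fun x => -1 * g2 x); first exact: (LZ (-1) _ (DL _ Dg2)).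
    by move=> x; have := fg2 x; rewrite /=; lra.
  pose c := sup lo.
  pose L' : set ((X -> R) * R) :=
    [set p | exists (q : (X -> R) * R) (t : R), L q /\ p = (fun x => q.1 x + t * f x, q.2 + t * c)].
  have LL' : L `<=` L'.
    move=> [q s] Lq; exists (q, s), 0; split => //=; congr (_, _); last by ring.
    by apply/funext => x; ring.
  have fL' : L' (f, c).
    exists (0, 0), 1; split; first exact: DL.
    by congr (_, _); [apply/funext => x /=|]; rewrite ?add0r mul1r.
  have L'good : good L'.
    split.
    - move=> _ _ [q [t [Lq ->]]] [q' [t' [Lq' ->]]].
      exists (q.1 + q'.1, q.2 + q'.2), (t + t'); split; first exact: LD.
      by congr (_, _) => /=; [apply/funext => x; rewrite !fctE|]; ring.
    - move=> t _ [q [t' [Lq ->]]].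
      exists ((fun x => t * q.1 x), t * q.2), (t * t'); split; first exact: LZ.
      by congr (_, _) => /=; [apply/funext => x|]; ring.
    - move=> _ [[q s] [t [Lq ->]]] /= pos.
      have [t0|t0|t0] := ltgtP t 0.
      + have tV : 0 < - t^-1 by rewrite oppr_gt0 invr_lt0.
        have : c <= - t^-1 * s.
          apply: ge_sup; first exact: lo_sup.1.
          apply: lo_ub (LZ (- t^-1) _ Lq) _ => x /=.
          have := mulr_ge0 (ltW tV) (pos x); rewrite mulrDr !mulNr mulKf ?lt_eqF//.
          lra.
        have t0' : t != 0 by rewrite lt_eqF.
        rewrite -(ler_nM2l t0); rewrite mulNr mulrN mulVKf//; lra.
      + have tV : 0 < t^-1 by rewrite invr_gt0.
        have : - t^-1 * s <= c.
          apply: ub_le_sup; first exact: lo_sup.2.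
          exists (fun x => - t^-1 * q x); first exact: (LZ (- t^-1) _ Lq).
          move=> x; have := mulr_ge0 (ltW tV) (pos x).
          rewrite mulrDr mulKf ?gt_eqF// mulNr; lra.
        have t0' : t != 0 by rewrite gt_eqF.
        rewrite -(ler_pM2l t0); rewrite mulNr mulrN mulVKf//; lra.
      + rewrite t0 mul0r addr0; apply: (Lpos _ Lq) => x /=.
        by have := pos x; rewrite t0 mul0r addr0.
    - move=> _ [q [t [Lq ->]]] /=.
      exact: (domD _ _ (Ldom _ Lq) (domZ t _ df)).
  have : A `<` L'.
    split; first by move=> x Ax; apply: LL'; left.
    by move=> L'A; apply: nf; exists c; left; exact: L'A.
  move=> /maxA; apply.
  by have -> : L' `|` D = L' by apply/setUidPl => x Dx; exact/LL'/DL.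
have /choice[phi Hphi] f : exists s, dom f -> L (f, s).
  by have [/total[s Ls]|nd] := pselect (dom f); [exists s|exists 0].
exists phi; split.
- move=> f g df dg; apply: Luniq (Hphi _ (domD _ _ df dg)) _.
  exact: (LD _ _ (Hphi _ df) (Hphi _ dg)).
- move=> t f df; apply: Luniq (Hphi _ (domZ t _ df)) _.
  exact: (LZ t _ (Hphi _ df)).
- by move=> f df f0; exact: (Lpos _ (Hphi _ df)).
- by move=> [f s] Dp; apply: Luniq (Hphi _ (Ddom _ Dp)) _; exact: DL.
Qed.

Section CompletelyContractivePositive.
Variables (R : realType) (N : nat) (B : finite_blaschke R N) (H : hilbertType R).
Variable pi : fbAlg B -> bop H.
Local Notation C := (cplx R).
Hypothesis pi_rep : unital_rep pi.
Hypothesis pi_cc : completely_contractive pi.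

(** [|1 - t F|^2 <= 1 + t^2 |F|^2] on the disk when [Re F >= 0]; complete
    contractivity transfers this bound to [1 - t pi(F)], which gives
    [2 Re pi(F) >= - t |F|^2]. *)
Lemma cc_positive r (F : 'M[fbAlg B]_r) :
  (forall (z : cdisk R) (c : 'I_r -> C), nrm (val z) = 1 ->
     0 <= re (\sum_i (\sum_j F i j z * c j) * Num.conj (c i))) ->
  forall e : 'I_r -> H, 0 <= re (\sum_i inner (\sum_j pi (F i j) (e j)) (e i)).
Proof.
case: r F => [|r] F FT e; first by rewrite big_ord0.
have FD (z : cdisk R) (c : 'I_r.+1 -> C) :
    0 <= re (\sum_i (\sum_j F i j z * c j) * Num.conj (c i)).
  pose f : fbAlg B := \sum_i \sum_j (c j * Num.conj (c i)) *: F i j.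
  have fE w : f w = \sum_i (\sum_j F i j w * c j) * Num.conj (c i).
    rewrite /f fbAlg_sumE; apply: eq_bigr => i _.
    rewrite fbAlg_sumE mulr_suml; apply: eq_bigr => j _; rewrite fbAlgZE; ring.
  rewrite -fE; apply: disk_algebra_re_ge0 (fbAlg_disk_algebra f) _ _ => w w1.
  by rewrite fE; exact: FT.
have [K K0 FK] := fbAlg_matrix_bounded F.
pose n3 : R := r.+1%:R * r.+1%:R * r.+1%:R * K ^+ 2.
have n30 : 0 <= n3 by rewrite /n3 !mulr_ge0// sqr_ge0.
pose Y := \sum_i nrm (e i) ^+ 2.
have Y0 : 0 <= Y by apply: sumr_ge0 => i _; rewrite sqr_ge0.
suff main (t : R) : 0 < t ->
    - (t * n3 * Y) <= 2 * re (\sum_i inner (\sum_j pi (F i j) (e j)) (e i)).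
  apply/ler_addgt0Pr => a a0.
  have n3Y : 0 <= n3 * Y by rewrite mulr_ge0.
  have d0 : 0 < n3 * Y + 1 by lra.
  have := main (a / (n3 * Y + 1)) (divr_gt0 a0 d0).
  have : a / (n3 * Y + 1) * n3 * Y <= a.
    have -> : a / (n3 * Y + 1) * n3 * Y = a * (n3 * Y / (n3 * Y + 1)) by ring.
    by rewrite ler_piMr ?(ltW a0)// ler_pdivrMr ?mul1r; lra.
  lra.
move=> t0.
pose G : 'M[fbAlg B]_r.+1 := \matrix_(i, j) ((i == j)%:R - ofR t *: F i j).
have GE (W : lmodType C) i (x : 'I_r.+1 -> W) (T : 'I_r.+1 -> W) (S : 'I_r.+1 -> W) :
    (forall j, S j = (i == j)%:R *: x j - ofR t *: T j) ->
    \sum_j S j = x i - ofR t *: \sum_j T j.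
  move=> ST; under eq_bigr do rewrite ST.
  rewrite sumrB -scaler_sumr; congr (_ - _).
  rewrite (bigD1 i)//= eqxx scale1r big1 ?addr0// => j.
  by rewrite eq_sym => /negbTE ->; rewrite scale0r.
have tt0 : 0 <= t ^+ 2 * n3 by rewrite mulr_ge0// sqr_ge0.
pose m := Num.sqrt (1 + t ^+ 2 * n3).
have m2 : m ^+ 2 = 1 + t ^+ 2 * n3 by rewrite sqr_sqrtr// addr_ge0.
have nrmt (V : normedModType C) (x : V) : nrm (ofR t *: x) ^+ 2 = t ^+ 2 * nrm x ^+ 2.
  by rewrite nrmZ nrm_ofR exprMn real_normK ?num_real.
have Gsup : mx_supnorm G <= m.
  apply: ge_sup.
    by exists (mx_opnorm (fun i j (x : C) => G i j (cdisk0 R) * x)), (cdisk0 R).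
  move=> _ [z _ <-]; apply: mx_opnorm_le; first exact: sqrtr_ge0.
    by move=> i j; rewrite mulr0.
  move=> c; rewrite m2.
  have -> : \sum_i nrm (\sum_j G i j z * c j) ^+ 2 = \sum_i (nrm (c i) ^+ 2 +
      t ^+ 2 * nrm (\sum_j F i j z * c j) ^+ 2 -
      2 * t * re ((\sum_j F i j z * c j) * Num.conj (c i))).
    apply: eq_bigr => i _.
    rewrite (GE C i c (fun j => F i j z * c j)); last first.
      move=> j; rewrite mxE fbAlgDE fbAlgNE fbAlgZE /GRing.scale /=.
      rewrite (_ : ((i == j)%:R : fbAlg B) z = (i == j)%:R); last by case: (i == j).
      by ring.
    rewrite -nrmt !nrm_sqr /GRing.scale /= !cE; ring.
  rewrite sumrB big_split /= -!mulr_sumr -re_sum.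
  have := entry_bound K0 (FK z) c; rewrite -/n3 => eb.
  have := FD z c; have := ler_wpM2l (sqr_ge0 t) eb.
  move=> h1 h2; have := mulr_ge0 (ltW t0) h2; lra.
have [_ _ [Mp pib]] := pi_rep.
have opG : mx_opnorm (fun i j => map_mx pi G i j : H -> H) <= m.
  exact: le_trans (pi_cc (isT : (0 < r.+1)%N) G) Gsup.
have /choice[b Hb] (ij : 'I_r.+1 * 'I_r.+1) : exists k, 0 <= k /\
    forall x, nrm (map_mx pi G ij.1 ij.2 x) <= k * nrm x.
  by have [k' [k0 Hk']] := bop_bounded (map_mx pi G ij.1 ij.2); exists k'.
pose bb := \sum_ij b ij.
have bb0 : 0 <= bb by apply: sumr_ge0 => ij _; case: (Hb ij).
have bbE i j x : nrm (map_mx pi G i j x) <= bb * nrm x.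
  rewrite (le_trans ((Hb (i, j)).2 x))// ler_wpM2r ?nrm_ge0//.
  by rewrite /bb (bigD1 (i, j))//= lerDl sumr_ge0// => ij _; case: (Hb ij).
have := @mx_opnorm_bound R H r.+1 (fun i j => map_mx pi G i j : H -> H) bb bb0
  (fun i j a x => linearZ_LR _ a x) bbE e.
rewrite -/Y => opb.
have op0 := mx_opnorm_ge0 (fun i j => map_mx pi G i j : H -> H).
have : \sum_i nrm (\sum_j map_mx pi G i j (e j)) ^+ 2 <= m ^+ 2 * Y.
  apply: (le_trans opb); rewrite ler_wpM2r// lerXn2r ?nnegrE//.
  by rewrite sqrtr_ge0.
have -> : \sum_i nrm (\sum_j map_mx pi G i j (e j)) ^+ 2 = \sum_i (nrm (e i) ^+ 2 +
      t ^+ 2 * nrm (\sum_j pi (F i j) (e j)) ^+ 2 -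
      2 * t * re (inner (\sum_j pi (F i j) (e j)) (e i))).
  apply: eq_bigr => i _.
  rewrite (GE H i e (fun j => pi (F i j) (e j))); last first.
    move=> j; rewrite !mxE (repD pi_rep) -scaleN1r -scaleN1r !(repZ pi_rep) !bopE scaleN1r; congr (_ + _).
    by case: (i == j); rewrite ?(rep1 pi_rep) ?(rep0 pi_rep) ?scale1r ?scale0r.
  rewrite nrm_sqrB nrmt innerC innerZl; rewrite !cE; ring.
rewrite sumrB big_split /= -!mulr_sumr -re_sum m2 -/Y.
set Q := re _; set P := \sum_i nrm _ ^+ 2 => h.
have P0 : 0 <= t ^+ 2 * P by rewrite mulr_ge0 ?sqr_ge0// sumr_ge0// => i _; rewrite sqr_ge0.
have : 0 <= t * (2 * Q + t * n3 * Y) by rewrite mulrDr; lra.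
by rewrite pmulr_rge0//; lra.
Qed.

(** Matrix positivity read off from a finite family [f (x) h (x) k^*], the
    vectors being expanded in an orthonormal family. *)
Lemma cc_positive_seq (s : seq (fbAlg B * H * H)) :
  (forall (z : cdisk R) (x : H), nrm (val z) = 1 ->
     0 <= \sum_(u <- s) re (u.1.1 z * inner u.1.2 x * inner x u.2)) ->
  0 <= \sum_(u <- s) re (inner (pi u.1.1 u.1.2) u.2).
Proof.
move=> sT.
have [n [e [eo es]]] := gram_schmidt ([seq u.1.2 | u <- s] ++ [seq u.2 | u <- s]).
have /choice[al Hal] (u : fbAlg B * H * H) : exists c : 'I_n -> C,
    u \in s -> u.1.2 = \sum_a c a *: e a.
  have [us|] := boolP (u \in s); last by exists (fun=> 0).
  have [|c Hc] := es u.1.2; last by exists c.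
  by rewrite mem_cat (map_f (fun u => u.1.2)).
have /choice[be Hbe] (u : fbAlg B * H * H) : exists c : 'I_n -> C,
    u \in s -> u.2 = \sum_a c a *: e a.
  have [us|] := boolP (u \in s); last by exists (fun=> 0).
  have [|c Hc] := es u.2; last by exists c.
  by rewrite mem_cat orbC (map_f (fun u => u.2)).
pose F : 'M[fbAlg B]_n :=
  \matrix_(b, a) \sum_(u <- s) (al u a * Num.conj (be u b)) *: u.1.1.
have := @cc_positive n F _ e.
have -> : \sum_i inner (\sum_j pi (F i j) (e j)) (e i) =
    \sum_(u <- s) inner (pi u.1.1 u.1.2) u.2.
  have E (u : fbAlg B * H * H) : u \in s -> inner (pi u.1.1 u.1.2) u.2 =
      \sum_i \sum_j (al u j * Num.conj (be u i)) * inner (pi u.1.1 (e j)) (e i).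
    move=> us; rewrite [u.2](Hbe u us) [X in pi _ X](Hal u us).
    rewrite inner_sumr; apply: eq_bigr => i _.
    rewrite innerZr raddf_sum inner_suml mulr_sumr; apply: eq_bigr => j _.
    by rewrite /= linearZ innerZl; ring.
  rewrite [RHS]big_seq (eq_bigr _ E) -big_seq exchange_big; apply: eq_bigr => i _.
  rewrite inner_suml exchange_big; apply: eq_bigr => j _ /=.
  rewrite mxE (rep_sum pi_rep) bop_sumE inner_suml; apply: eq_bigr => u _.
  by rewrite (repZ pi_rep) bopZE innerZl.
rewrite re_sum; apply => z c z1.
pose x := \sum_a Num.conj (c a) *: e a.
have xe a : inner x (e a) = Num.conj (c a).
  rewrite /x inner_suml (bigD1 a)//= innerZl eo eqxx mulr1 big1 ?addr0// => j ja.
  by rewrite innerZl eo (negbTE ja) mulr0.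
clearbody x; have ex a : inner (e a) x = c a by rewrite innerC xe conjCK.
have := sT z x z1; rewrite -re_sum; congr (_ <= re _).
have E (u : fbAlg B * H * H) : u \in s -> u.1.1 z * inner u.1.2 x * inner x u.2 =
    \sum_i \sum_j (al u j * Num.conj (be u i)) * u.1.1 z * c j * Num.conj (c i).
  move=> us; rewrite [u.2](Hbe u us) [X in inner X _](Hal u us).
  rewrite inner_sumr mulr_sumr; apply: eq_bigr => i _.
  rewrite innerZr xe inner_suml mulr_sumr mulr_suml; apply: eq_bigr => j _.
  by rewrite innerZl ex; ring.
rewrite [LHS]big_seq (eq_bigr _ E) -big_seq exchange_big; apply: eq_bigr => i _.
rewrite mulr_suml exchange_big; apply: eq_bigr => j _ /=.
rewrite mxE fbAlg_sumE !mulr_suml; apply: eq_bigr => u _.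
by rewrite fbAlgZE.
Qed.

End CompletelyContractivePositive.

(** * Construction of the dilation *)

Lemma reRM (R : realType) (t : R) (z : cplx R) : re (ofR t * z) = t * re z.
Proof. by rewrite reM !cE mul0r subr0. Qed.

Lemma scale_swap (S : comNzRingType) (V : lmodType S) (a b : S) (v : V) :
  a *: (b *: v) = b *: (a *: v).
Proof. by rewrite !scalerA mulrC. Qed.

Section FiniteRankDomain.
Variables (R : realType) (H : hilbertType R).
Local Notation C := (cplx R).

Definition circle := {z : cdisk R | nrm (val z) == 1}.
Definition pt (z : circle) : C := val (val z).

Lemma pt1 z : nrm (pt z) = 1. Proof. exact/eqP/(valP z). Qed.

(** A function of [(z, x)] represents the quadratic forms of an operator-valued
    function of [z]; being nonnegative at every [x] is positivity of the operator.
    The domination gives every such function a constant majorant. *)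
Definition frdom : set (circle * H -> R) :=
  [set q | exists (s : seq H) (c : R), 0 <= c /\
    forall p, `|q p| <= c * \sum_(h <- s) nrm (inner h p.2) ^+ 2].

Lemma sumsq_ge0 (s : seq H) x : 0 <= \sum_(h <- s) nrm (inner h x) ^+ 2.
Proof. by apply: sumr_ge0 => h _; rewrite sqr_ge0. Qed.

Lemma frdomD f g : frdom f -> frdom g -> frdom (f + g).
Proof.
move=> [s [c [c0 fc]]] [s' [c' [c'0 gc]]]; exists (s ++ s'), (c + c').
split=> [|p]; first by rewrite addr_ge0.
rewrite fctE (le_trans (ler_normD _ _))// (le_trans (lerD (fc p) (gc p)))//.
have a0 := sumsq_ge0 s p.2; have b0 := sumsq_ge0 s' p.2.
rewrite big_cat /=; have := mulr_ge0 c0 b0; have := mulr_ge0 c'0 a0; lra.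
Qed.

Lemma frdomZ (t : R) f : frdom f -> frdom (fun x => t * f x).
Proof.
move=> [s [c [c0 fc]]]; exists s, (`|t| * c); split=> [|p]; first by rewrite mulr_ge0.
by rewrite normrM -mulrA ler_wpM2l.
Qed.

Lemma frdom_prod (a b : circle * H -> C) (s s' : seq H) (c c' : R) :
  0 <= c -> 0 <= c' ->
  (forall p, nrm (a p) ^+ 2 <= c * \sum_(h <- s) nrm (inner h p.2) ^+ 2) ->
  (forall p, nrm (b p) ^+ 2 <= c' * \sum_(h <- s') nrm (inner h p.2) ^+ 2) ->
  frdom (fun p => re (a p * b p)).
Proof.
move=> c0 c'0 ac bc; exists (s ++ s'), (c + c'); split=> [|p]; first by rewrite addr_ge0.
rewrite (le_trans (re_le_nrm _))// nrmM.
have := ac p; have := bc p; have := sqr_ge0 (nrm (a p) - nrm (b p)).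
have a0 := sumsq_ge0 s p.2; have b0 := sumsq_ge0 s' p.2.
rewrite big_cat /=; have := mulr_ge0 c0 b0; have := mulr_ge0 c'0 a0.
have := sqr_ge0 (nrm (a p)); have := sqr_ge0 (nrm (b p)); lra.
Qed.

Definition is_efun : {pred circle -> H} := fun g =>
  `[< exists (s : seq H) (c : R), 0 <= c /\ forall p : circle * H,
       nrm (inner (g p.1) p.2) ^+ 2 <= c * \sum_(h <- s) nrm (inner h p.2) ^+ 2 >].

Lemma is_efun_submod_closed : submod_closed is_efun.
Proof.
split.
  by apply/asboolP; exists [::], 0; split => // p; rewrite inner0l nrm0 expr0n mul0r.
move=> a f g /asboolP[s [c [c0 fc]]] /asboolP[s' [c' [c'0 gc]]]; apply/asboolP.
exists (s ++ s'), (2 * nrm a ^+ 2 * c + 2 * c').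
have aa : 0 <= nrm a ^+ 2 by rewrite sqr_ge0.
have ac : 0 <= 2 * nrm a ^+ 2 * c by rewrite mulr_ge0// mulr_ge0.
split=> [|p]; first by rewrite addr_ge0// mulr_ge0 ?ler0n.
rewrite !fctE innerDl innerZl (le_trans (nrm_sqr_addW _ _ ltr01))// nrmM exprMn.
have a0 := sumsq_ge0 s p.2; have b0 := sumsq_ge0 s' p.2.
rewrite invr1 big_cat /=; have := ler_wpM2l aa (fc p); have := gc p.
have := mulr_ge0 ac b0; have := mulr_ge0 c'0 a0; lra.
Qed.

HB.instance Definition _ := GRing.isSubmodClosed.Build C (circle -> H) is_efun
  is_efun_submod_closed.

(** Bounded functions on the circle with finite-dimensional range in [H]. *)
Record efun := Efun { efun_fun :> circle -> H; _ : efun_fun \in is_efun }.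

HB.instance Definition _ := [isSub for efun_fun].
HB.instance Definition _ := [Choice of efun by <:].
HB.instance Definition _ := [SubChoice_isSubLmodule of efun by <:].

Implicit Types f g : efun.

Lemma efunP f g : (forall z, f z = g z) -> f = g.
Proof. by move=> fg; apply: val_inj; apply/funext. Qed.

Lemma efunDE f g z : (f + g) z = f z + g z. Proof. by []. Qed.
Lemma efunZE (a : C) f z : (a *: f) z = a *: f z. Proof. by []. Qed.

Lemma econst_subproof (h : H) : (fun=> h) \in is_efun.
Proof.
apply/asboolP; exists [:: h], 1; split=> // p.
by rewrite big_seq1 mul1r.
Qed.

Definition econst h : efun := Efun (econst_subproof h).

Lemma emul_subproof (u : circle -> C) (k : R) (uk : forall z, nrm (u z) <= k) g :
  (fun z => u z *: g z) \in is_efun.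
Proof.
have := valP g => /asboolP[s [c [c0 gc]]]; apply/asboolP.
exists s, (k ^+ 2 * c); split=> [|p]; first by rewrite mulr_ge0// sqr_ge0.
rewrite innerZl nrmM exprMn -mulrA ler_pM ?sqr_ge0//.
by rewrite lerXn2r ?nnegrE ?nrm_ge0// (le_trans (nrm_ge0 _) (uk p.1)).
Qed.

Definition emul (u : circle -> C) (k : R) (uk : forall z, nrm (u z) <= k) g : efun :=
  Efun (emul_subproof uk g).

Definition eform (f g : efun) (p : circle * H) : R :=
  re (inner (f p.1) p.2 * inner p.2 (g p.1)).

Lemma eform_dom f g : frdom (eform f g).
Proof.
have := valP f => /asboolP[s [c [c0 fc]]].
have := valP g => /asboolP[s' [c' [c'0 gc]]].
apply: (frdom_prod c0 c'0 fc) => p; rewrite innerC nrm_conj; exact: gc.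
Qed.

End FiniteRankDomain.

Arguments econst {R H}.

Section Extension.
Variables (R : realType) (N : nat) (B : finite_blaschke R N) (H : hilbertType R).
Variable pi : fbAlg B -> bop H.
Local Notation C := (cplx R).
Hypothesis pi_rep : unital_rep pi.
Hypothesis pi_cc : completely_contractive pi.

(** Arveson's extension, all at once: a positive functional on the functions
    dominated by finite-rank forms stands for a completely positive map from
    the bounded functions on the circle to [B(H)]. *)
Lemma cp_extension : exists phi : (circle R * H -> R) -> R,
  [/\ forall f g, frdom f -> frdom g -> phi (f + g) = phi f + phi g,
      forall (t : R) f, frdom f -> phi (fun x => t * f x) = t * phi f,
      forall f, frdom f -> (forall x, 0 <= f x) -> 0 <= phi f &
      forall (f : fbAlg B) (h k : H),
        phi (fun p => re (f (val p.1) * inner h p.2 * inner p.2 k)) =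
        re (inner (pi f h) k)].
Proof.
pose D : set ((circle R * H -> R) * R) := [set p | exists s : seq (fbAlg B * H * H),
  p = (fun p => \sum_(u <- s) re (u.1.1 (val p.1) * inner u.1.2 p.2 * inner p.2 u.2),
       \sum_(u <- s) re (inner (pi u.1.1 u.1.2) u.2))].
have [||||||||phi [phiD phiZ phi0 phiE]] := @riesz_extension R _ (@frdom R H) D.
- exists [::]; congr (_, _); last by rewrite big_nil.
  by apply/funext => p; rewrite big_nil.
- move=> _ _ [s ->] [s' ->]; exists (s ++ s'); congr (_, _) => /=.
    by apply/funext => p; rewrite fctE big_cat.
  by rewrite big_cat.
- move=> t _ [s ->]; exists [seq (ofR t *: u.1.1, u.1.2, u.2) | u <- s].
  congr (_, _) => /=.
    apply/funext => p; rewrite big_map mulr_sumr; apply: eq_bigr => u _.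
    rewrite -reRM !mulrA; exact: erefl.
  rewrite big_map mulr_sumr; apply: eq_bigr => u _.
  by rewrite -reRM -innerZl -bopZE -(repZ pi_rep).
- move=> _ [s ->] /= pos; apply: (cc_positive_seq pi_rep pi_cc) => z x z1.
  have z1' : nrm (val z) == 1 by rewrite z1.
  exact: (pos (exist _ z z1', x)).
- exact: frdomD.
- exact: frdomZ.
- move=> _ [s ->] /=; elim: s => [|u s ih].
    exists [::], 0; split => // p; by rewrite !big_nil normr0 mulr0.
  have -> : (fun p : circle R * H => \sum_(v <- u :: s)
      re (v.1.1 (val p.1) * inner v.1.2 p.2 * inner p.2 v.2)) =
    (fun p => re (u.1.1 (val p.1) * inner u.1.2 p.2 * inner p.2 u.2)) +
    (fun p => \sum_(v <- s) re (v.1.1 (val p.1) * inner v.1.2 p.2 * inner p.2 v.2)).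
    by apply/funext => p; rewrite big_cons.
  apply: frdomD => //.
  have [k k0 uk] := disk_algebra_bounded (fbAlg_disk_algebra u.1.1).
  apply: (@frdom_prod R H (fun p => u.1.1 (val p.1) * inner u.1.2 p.2)
    (fun p => inner p.2 u.2) [:: u.1.2] [:: u.2] (k ^+ 2) 1) => // [|p|p].
  + by rewrite sqr_ge0.
  + rewrite big_seq1 nrmM exprMn ler_wpM2r ?sqr_ge0//.
    by rewrite lerXn2r ?nnegrE ?nrm_ge0.
  + by rewrite big_seq1 mul1r innerC nrm_conj.
- move=> f [s [c [c0 fc]]].
  exists (fun p => \sum_(u <- [seq (ofR c *: (1 : fbAlg B), h, h) | h <- s])
      re (u.1.1 (val p.1) * inner u.1.2 p.2 * inner p.2 u.2),
    \sum_(u <- [seq (ofR c *: (1 : fbAlg B), h, h) | h <- s])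
      re (inner (pi u.1.1 u.1.2) u.2)); first by eexists.
  move=> p; rewrite (le_trans (ler_norm _))// (le_trans (fc p))//=.
  have E h : re ((ofR c *: (1 : fbAlg B)) (val p.1) * inner h p.2 * inner p.2 h) =
      c * nrm (inner h p.2) ^+ 2.
    by rewrite fbAlgZE fbAlg1E mulr1 -mulrA (innerC p.2) mulCconj reRM re_ofR.
  by rewrite big_map mulr_sumr ler_sum// => h _; rewrite -E lexx.
exists phi; split => // f h k.
have := phiE (fun p => \sum_(u <- [:: (f, h, k)])
    re (u.1.1 (val p.1) * inner u.1.2 p.2 * inner p.2 u.2),
  \sum_(u <- [:: (f, h, k)]) re (inner (pi u.1.1 u.1.2) u.2)).
move=> /(_ (ex_intro _ [:: (f, h, k)] erefl)) /=.
rewrite big_seq1 /= => <-; congr phi.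
by apply/funext => p; rewrite big_seq1.
Qed.

End Extension.

Section Dilation.
Variables (R : realType) (N : nat) (B : finite_blaschke R N) (H : hilbertType R).
Variable pi : fbAlg B -> bop H.
Local Notation C := (cplx R).
Variable phi : (circle R * H -> R) -> R.
Hypothesis phiD : forall f g, frdom f -> frdom g -> phi (f + g) = phi f + phi g.
Hypothesis phiZ : forall (t : R) f, frdom f -> phi (fun x => t * f x) = t * phi f.
Hypothesis phi_ge0 : forall f, frdom f -> (forall x, 0 <= f x) -> 0 <= phi f.
Hypothesis phiE : forall (f : fbAlg B) (h k : H),
  phi (fun p => re (f (val p.1) * inner h p.2 * inner p.2 k)) = re (inner (pi f h) k).
Hypothesis pi1 : pi 1 = 1.

Lemma eform_self (g : efun H) p : eform g g p = nrm (inner (g p.1) p.2) ^+ 2.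
Proof. by rewrite /eform (innerC p.2) mulCconj re_ofR. Qed.

(** The form of Stinespring's construction for the map represented by [phi]. *)
Definition rho_form : semiform (efun H).
Proof.
apply: (@Semiform R (efun H) (fun f g => phi (eform f g))).
- move=> f g k; rewrite -phiD; [congr phi|exact: eform_dom|exact: eform_dom].
  by apply/funext => p; rewrite fctE /eform efunDE innerDl mulrDl reD.
- move=> t f g; rewrite -phiZ; [congr phi|exact: eform_dom].
  by apply/funext => p; rewrite /eform efunZE innerZl -mulrA reRM.
- move=> f g; congr phi; apply/funext => p; rewrite /eform.
  by rewrite (innerC (f p.1)) (innerC p.2 (g p.1)) -rmorphM conj_re mulrC.
- move=> f; apply: phi_ge0; first exact: eform_dom.
  by move=> p; rewrite eform_self sqr_ge0.
- move=> a f g; congr phi; apply/funext => p; rewrite /eform.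
  by rewrite !efunZE innerZl innerZr conjCK; congr re; ring.
Defined.

Local Notation rho := rho_form.

Lemma rhoE (f g : efun H) : rho f g = phi (eform f g). Proof. by []. Qed.

Lemma rho_emul_le (u : circle R -> C) (k : R) (uk : forall z, nrm (u z) <= k)
  (g : efun H) : rho (emul uk g) (emul uk g) <= k ^+ 2 * rho g g.
Proof.
rewrite !rhoE -phiZ; last exact: eform_dom.
set a := eform _ _; set b := fun p => _.
have da : frdom a by exact: eform_dom.
have db : frdom b by apply: frdomZ; exact: eform_dom.
have dna : frdom (fun p => -1 * a p) by exact: frdomZ.
rewrite -subr_ge0 -[- phi a]mulN1r -phiZ// -phiD//.
apply: phi_ge0; first exact: frdomD.
move=> p; rewrite fctE /b /a !eform_self /= innerZl nrmM exprMn mulN1r subr_ge0.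
rewrite ler_wpM2r ?sqr_ge0// lerXn2r ?nnegrE ?nrm_ge0//.
by rewrite (le_trans (nrm_ge0 _) (uk p.1)).
Qed.

Lemma conj_bound (u : circle R -> C) (k : R) (uk : forall z, nrm (u z) <= k) z :
  nrm (Num.conj (u z)) <= k.
Proof. by rewrite nrm_conj. Qed.

Lemma rho_emul_adj (u : circle R -> C) (k : R) (uk : forall z, nrm (u z) <= k)
  (f g : efun H) : rho (emul uk f) g = rho f (emul (conj_bound uk) g).
Proof.
rewrite !rhoE; congr phi; apply/funext => p; rewrite /eform /=.
by rewrite innerZl innerZr conjCK; congr re; ring.
Qed.

Local Notation K := (dual rho : hilbertType R).

(** Multiplication operators act on functionals through their adjoints. *)
Section Multiplication.
Variables (u : circle R -> C) (k : R) (uk : forall z, nrm (u z) <= k).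
Hypothesis k0 : 0 <= k.

Lemma mulop_dual_subproof (l : dual rho) :
  (fun g => l (emul (conj_bound uk) g)) \in is_dual rho.
Proof.
have eD f g : emul (conj_bound uk) (f + g) =
    emul (conj_bound uk) f + emul (conj_bound uk) g.
  by apply: efunP => z; exact: scalerDr.
have eZ (t : C) g : emul (conj_bound uk) (t *: g) = t *: emul (conj_bound uk) g.
  by apply: efunP => z; exact: scale_swap.
apply/asboolP; split; first by move=> f g; rewrite eD dualD.
split; first by move=> t g; rewrite eZ dualR.
exists (dsq l * k ^+ 2); split; first by rewrite mulr_ge0 ?sqr_ge0// dsq_ge0.
move=> g; rewrite (le_trans (dsq_bound _ _))// -mulrA ler_wpM2l ?dsq_ge0//.
exact: rho_emul_le.
Qed.

Definition mulop_dual (l : dual rho) : dual rho := Dual (mulop_dual_subproof l).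

Lemma dsq_mulop l : dsq (mulop_dual l) <= k ^+ 2 * dsq l.
Proof.
apply: dsq_le_bound => [|g]; first by rewrite mulr_ge0 ?sqr_ge0// dsq_ge0.
apply: (le_trans (dsq_bound l (emul (conj_bound uk) g))).
apply: (le_trans (ler_wpM2l (dsq_ge0 l) (rho_emul_le (conj_bound uk) g))).
by rewrite mulrCA mulrA.
Qed.

Lemma mulop_subproof : mulop_dual \in @is_bop R K.
Proof.
apply/asboolP; split.
  move=> a l m; apply: dualP => g.
  change (l (Num.conj a *: emul (conj_bound uk) g) + m (emul (conj_bound uk) g) =
    l (emul (conj_bound uk) (Num.conj a *: g)) + m (emul (conj_bound uk) g)).
  congr (dual_fun l _ + _).
  by apply: efunP => z; exact: scale_swap.
exists k => l; rewrite -ler_sqr ?nnegrE ?mulr_ge0 ?nrm_ge0//.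
by rewrite exprMn !nrm_dual !sqr_dnorm; exact: dsq_mulop.
Qed.

Definition mulop : bop K := Bop mulop_subproof.

Lemma mulop_riesz (f : efun H) : mulop (riesz rho f) = riesz rho (emul uk f).
Proof. by apply: dualP => g; exact: esym (rho_emul_adj uk f g). Qed.

End Multiplication.

Lemma pt_bound z : nrm (pt z : C) <= 1. Proof. by rewrite pt1. Qed.

(** The unitary of the dilation: multiplication by the coordinate. *)
Definition shift : bop K := mulop pt_bound ler01.
Definition shift_adj : bop K := mulop (conj_bound pt_bound) ler01.

Lemma shift_adjK : shift * shift_adj = 1.
Proof.
apply: bopP => l; apply: dualP => g; congr (dual_fun l _); apply: efunP => z /=.
by rewrite conjCK scalerA nrm1_conj ?pt1// scale1r.
Qed.

Lemma shiftK : shift_adj * shift = 1.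
Proof.
apply: bopP => l; apply: dualP => g; congr (dual_fun l _); apply: efunP => z /=.
by rewrite conjCK scalerA mulrC nrm1_conj ?pt1// scale1r.
Qed.

Lemma dsq_shift l : dsq (shift l) = dsq l.
Proof.
apply/eqP; rewrite eq_le; apply/andP; split.
  by have := dsq_mulop pt_bound l; rewrite expr1n mul1r.
have := dsq_mulop (conj_bound pt_bound) (shift l); rewrite expr1n mul1r.
by rewrite -[X in dsq X <= _]/((shift_adj * shift) l) shiftK.
Qed.

Lemma unitary_shift : unitary_op shift.
Proof.
exists shift_adj; split; [|exact: shiftK|exact: shift_adjK] => l m.
have dreS (l' m' : K) : dre (shift l') (shift m') = dre l' m'.
  by rewrite /dre -raddfD -raddfB !dsq_shift.
rewrite -{1}[m]/((1 : bop K) m) -shift_adjK bopME.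
move: (shift_adj m) => {}m.
rewrite -[LHS]/(dinner _ _) -[RHS]/(dinner _ _) /dinner dreS.
by rewrite -linearZ dreS.
Qed.

Lemma pact_shift_riesz (p : {poly C}) (u : circle R -> C) (k : R)
  (uk : forall z, nrm (u z) <= k) (f : efun H) : (forall z, u z = p.[pt z]) ->
  pact shift p (riesz rho f) = riesz rho (emul uk f).
Proof.
move=> up; have it n : exists2 g : efun H, iter n shift (riesz rho f) = riesz rho g &
    forall z, g z = pt z ^+ n *: f z.
  elim: n => [|n [g gE gz]].
    by exists f => // z; rewrite expr0 scale1r.
  exists (emul pt_bound g) => [|z]; first by rewrite iterS gE /shift mulop_riesz.
  by rewrite exprS -scalerA -gz.
have /choice[g gP] n : exists g : efun H,
    iter n shift (riesz rho f) = riesz rho g /\ forall z, g z = pt z ^+ n *: f z.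
  by have [g h1 h2] := it n; exists g.
have -> : emul uk f = \sum_(n < size p) p`_n *: g n.
  apply: efunP => z.
  have -> : (\sum_(n < size p) p`_n *: g n) z = \sum_(n < size p) p`_n *: g n z.
    by elim/big_rec2 : _ => // i a b _ <-.
  rewrite /= up horner_coef scaler_suml; apply: eq_bigr => n _.
  by rewrite (gP n).2 scalerA.
rewrite /pact raddf_sum; apply: eq_bigr => n _.
by rewrite (gP n).1 /= rieszZ.
Qed.

Definition embed (h : H) : K := riesz rho (econst h).

Lemma embed_linear : linear embed.
Proof.
move=> a x y; rewrite /embed -linearP; congr riesz.
exact: efunP.
Qed.

HB.instance Definition _ := GRing.isLinear.Build C H K _ embed embed_linear.

Lemma rho_fbAlg (f : fbAlg B) (k : R) (fk : forall z : circle R, nrm (f (val z)) <= k)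
  (h h' : H) : rho (emul fk (econst h)) (econst h') = re (inner (pi f h) h').
Proof.
rewrite -phiE rhoE; congr phi; apply/funext => p.
by rewrite /eform /= innerZl.
Qed.

Lemma rho_const h h' : rho (econst h) (econst h') = re (inner h h').
Proof.
have -> : inner h h' = inner (pi 1 h) h' by rewrite pi1.
by rewrite -phiE rhoE; congr phi; apply/funext => p; rewrite /eform fbAlg1E mul1r.
Qed.

Lemma inner_riesz (f g : efun H) :
  inner (riesz rho f : K) (riesz rho g : K) =
  ofR (rho f g) + iC R * ofR (rho f (iC R *: g)).
Proof.
by rewrite -[LHS]/(dinner _ _) /dinner -rieszZ !dre_riesz !rieszE.
Qed.

Lemma econstZ (a : C) (h : H) : a *: econst h = econst (a *: h).
Proof. exact: efunP. Qed.

Lemma re_inner_iC (x y : H) : re (inner x (iC R *: y)) = im (inner x y).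
Proof. by rewrite innerZr !cE; ring. Qed.

Lemma inner_embed h h' : inner (embed h) (embed h') = inner h h'.
Proof.
rewrite inner_riesz econstZ !rho_const re_inner_iC.
by apply: cplxP; rewrite !cE; ring.
Qed.

Lemma inner_emul_embed (f : fbAlg B) (k : R)
  (fk : forall z : circle R, nrm (f (val z)) <= k) (h h' : H) :
  inner (riesz rho (emul fk (econst h)) : K) (embed h') = inner (pi f h) h'.
Proof.
rewrite inner_riesz econstZ !rho_fbAlg re_inner_iC.
by apply: cplxP; rewrite !cE; ring.
Qed.

Lemma fb_den_inv_bounded : exists k, forall z : circle R,
  nrm ((fb_den B).[pt z]^-1) <= k.
Proof.
exists (\prod_(i < N) (1 - nrm (fb_zeros B i))^-1) => z.
rewrite fb_den_horner.
elim: (index_enum _) => [|i s ih]; first by rewrite !big_nil invr1 nrm1.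
have a1 : nrm (fb_zeros B i) < 1 by rewrite -normC1_nrm_lt fb_zeros_disk.
rewrite !big_cons invfM nrmM ler_pM ?nrm_ge0// nrmV lef_pV2 ?posrE ?subr_gt0//.
  by have := nrm_lerB (1 : C) (Num.conj (fb_zeros B i) * pt z);
    rewrite nrm1 nrmM nrm_conj pt1 mulr1.
by rewrite nrm_gt0// fb_den_neq0// normC1_nrm pt1.
Qed.

(** Take [y] to be the class of [h / q] in [B(U) q(U) y = b(U) y], where [q] is
    the denominator of [B]; [1 / q] is bounded on the circle. *)
Lemma shift_zjB (j : nat) (k : R)
  (fk : forall z : circle R, nrm (zjB B j (val z)) <= k) (h : H) :
  (shift ^+ j * fb_op B shift) (embed h) = riesz rho (emul fk (econst h)).
Proof.
have [kd Hd] := fb_den_inv_bounded.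
have pb (p : {poly C}) (z : circle R) : nrm p.[pt z] <= \sum_(i < size p) nrm p`_i.
  by apply: poly_disk_bounded; rewrite pt1.
pose y := riesz rho (emul Hd (econst h)) : K.
have den0 z : (fb_den B).[pt z] != 0.
  rewrite fb_den_horner; apply/prodf_neq0 => i _.
  by rewrite fb_den_neq0// normC1_nrm pt1.
have yE : pact shift (fb_den B) y = embed h.
  rewrite /y (pact_shift_riesz (pb (fb_den B))) => [|//].
  congr riesz; apply: efunP => z /=.
  by rewrite scalerA divff ?scale1r.
rewrite bopME -yE (fb_op_den B (unitary_isom unitary_shift)) bopXE -pact_iter.
have -> : iter j shift y = pact shift 'X^j y.
  rewrite /pact size_polyXn big_ord_recr /= coefXn eqxx scale1r big1 ?add0r// => i _.
  by rewrite coefXn ltn_eqF ?scale0r.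
rewrite -pactM /y (pact_shift_riesz (pb (fb_num B * 'X^j))) => [|//].
congr riesz; apply: efunP => z /=.
rewrite hornerM hornerXn -fb_fun_horner ?pt1// scalerA; congr (_ *: _).
rewrite -/(pt z); have d0 := den0 z; field; exact: d0.
Qed.

Lemma dilation_zjB (j : nat) (h : H) :
  embed (pi (zjB B j) h) = orth_proj (range embed) ((shift ^+ j * fb_op B shift) (embed h)).
Proof.
have [k k0 Hk] := disk_algebra_bounded (fbAlg_disk_algebra (zjB B j)).
have fk (z : circle R) : nrm (zjB B j (val z)) <= k by [].
have [h' [-> hO]] := @orth_proj_range R H K embed inner_embed
  ((shift ^+ j * fb_op B shift) (embed h)).
congr embed; apply/eqP; rewrite -subr_eq0; apply/eqP/nrm_eq0/eqP.
set d := pi _ _ - h'; have : inner d d = 0.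
  rewrite {1}/d innerDl innerNl -(inner_emul_embed fk) -inner_embed.
  by rewrite -innerNl -innerDl -(shift_zjB fk) hO.
rewrite inner_nrm => /(congr1 (@re R)); rewrite re_ofR => /eqP.
by rewrite sqrf_eq0.
Qed.

End Dilation.

(** * The characterization *)

Theorem theorem7p1 (R : realType) (N : nat) (hN : (2 <= N)%N)
    (B : finite_blaschke R N) (H : hilbertType R)
    (pi : fbAlg B -> bop H) (hpi : unital_rep pi) :
  completely_contractive pi <->
  exists (K : hilbertType R) (iota : {linear H -> K}) (U : bop K),
    [/\ forall x y : H, inner (iota x) (iota y) = inner x y,
        unitary_op U &
        forall (j : nat) (h : H),
          iota (pi (zjB B j) h) =
          orth_proj (range iota) ((U ^+ j * fb_op B U) (iota h))].
Proof.
split=> [pi_cc|[K [iota [U [iotaI Uu piE]]]]]; last first.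
  exact: dilation_completely_contractive hpi iotaI Uu piE.
have [phi [phiD phiZ phi0 phiE]] := cp_extension hpi pi_cc.
have pi1 := rep1 hpi.
exists (dual (rho_form phiD phiZ phi0) : hilbertType R), (embed phiD phiZ phi0),
  (shift phiD phiZ phi0).
split; [exact: inner_embed phiE pi1|exact: unitary_shift|].
exact: dilation_zjB phiE pi1.
Qed.
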